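(* Let $k\in\{3,4,5,6\}$, let $p$ be an odd prime in $\mathbf Z[\tau]$, let $q=|N(p)|$, and for $i=0,2,3$ let $G_i^p$ be the distinguished subgroup of $G^p$ that is generated by the reductions modulo $p$ of the matrices $\mathbf r_j$ with $j\neq i$, where $\mathbf r_0,\mathbf r_1,\mathbf r_2,\mathbf r_3$ are the matrices defined in the context. Then the following statements hold: (1) $G_0^p$ is the reduction modulo $p$ of the standard representation of the finite irreducible Coxeter group $\mathcal A_3$, $\mathcal B_3$, or $\mathcal H_3$, if $k=3$, $4$, or $5$, respectively; or is (isomorphic to) the automorphism group $[3,6]_{(s,0)}$ of the regular torus $\{3,6\}_{(s,0)}$, if $k=6$, where $s=5,\ p,\ q$ according as $p$ is in Class I, II, III, respectively (in Class II, $p$ being taken to be a positive rational prime). (2) $G_2^p$ is an orthogonal group of type $O(3,q,0)$ or $O_1(3,q,0)$, except when $k=6$ and $p$ is an associate of $3$. (3) $G_3^p$ is the reduction modulo $p$ of the standard representation of the finite irreducible Coxeter group $\mathcal H_3$.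
   Context: Let $\tau=\frac{1+\sqrt5}{2}$, $\mathbf Z[\tau]=\{a+b\tau\mid a,b\in\mathbf Z\}$, with norm $N(a+b\tau)=a^2+ab-b^2$. Up to multiplication by a unit, a prime $p$ of $\mathbf Z[\tau]$ belongs to one of three classes: Class I: $p=-1+2\tau=\sqrt5$; Class II: $p$ is a rational prime with $p\equiv\pm2\pmod5$; Class III: $p$ is a non-rational prime such that $N(p)\equiv\pm1\pmod 5$ and $|N(p)|$ is a rational prime. A prime is odd if it is not an associate of $2$. For an odd prime $p$, $\mathbf F_q=\mathbf Z[\tau]/(p)$ is a finite field of odd order $q=|N(p)|$. For $k\in\{3,4,5,6\}$ put $\rho_3=1$, $\rho_4=2$, $\rho_5=\tau^2$, $\rho_6=3$, and define the matrices over $\mathbf Z[\tau]$ $$\mathbf r_0=\begin{bmatrix}-1&\tau^2&0&0\\0&1&0&0\\0&0&1&0\\0&0&0&1\end{bmatrix},\quad \mathbf r_1=\begin{bmatrix}1&0&0&0\\1&-1&1&\rho_k\\0&0&1&0\\0&0&0&1\end{bmatrix},$$ $$\mathbf r_2=\begin{bmatrix}1&0&0&0\\0&1&0&0\\0&1&-1&0\\0&0&0&1\end{bmatrix},\quad \mathbf r_3=\begin{bmatrix}1&0&0&0\\0&1&0&0\\0&0&1&0\\0&1&0&-1\end{bmatrix},$$ $$\mathbf g=\begin{bmatrix}4&-2\tau^2&0&0\\-2\tau^2&4\tau^2&-2\tau^2&-2\tau^2\rho_k\\0&-2\tau^2&4\tau^2&0\\0&-2\tau^2\rho_k&0&4\tau^2\rho_k\end{bmatrix}.$$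 $G^p$ is the subgroup of $GL(4,\mathbf F_q)$ generated by the reductions modulo $p$ of $\mathbf r_0,\mathbf r_1,\mathbf r_2,\mathbf r_3$. It acts on the $\mathbf F_q$-space with basis $v_0,v_1,v_2,v_3$ (matrices acting on coordinate column vectors), endowed with the symmetric bilinear form $(\cdot)_p$ with Gram matrix $\mathbf g\bmod p$. The subgroup $G_i^p$ leaves the $3$-dimensional span $W_i$ of $\{v_j\mid j\ne i\}$ invariant; statements that $G_i^p$ is an orthogonal group in dimension $3$, or the reduction of the standard representation of a rank 3 Coxeter group, refer to its action on $W_i$ (with the restricted form). Orthogonal groups: for a $3$-dimensional space $V$ over $\mathbf F_q$ ($q$ odd) with non-singular symmetric bilinear form $(\cdot)_V$, $O(3,q,0)$ is the full group of invertible linear maps of $V$ preserving the form. For $v$ with $(v\cdot v)_V\ne0$ the reflection with root $v$ is $r_v(x)=x-2\frac{(x\cdot v)_V}{(v\cdot v)_V}v$, and $O_1(3,q,0)=\langle r_v\mid (v\cdot v)_V\in(\mathbf F_q^* )^2\rangle$. Coxeter groups: $\mathcal A_3,\mathcal B_3,\mathcal H_3$ are the finite irreducible Coxeter groups with linear diagrams $[3,3]$, $[3,4]$, $[3,5]$. The reduction modulo $p$ of the standard (real reflection) representation is obtained by writing the generating reflections as matrices over $\mathbf Z[\tau]$ with respect to a basis of suitably rescaled simple roots and reducing all entries modulo $p$; the resulting groups $\mathcal A_3^p,\mathcal B_3^p,\mathcal H_3^p$ have orders $24$, $48$, $120$. Torus: $\{3,6\}$ is the tessellation of the Euclidean plane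 by equilateral triangles, with vertex lattice $\Lambda$ and automorphism group the Coxeter group $[3,6]$. For $s\ge2$, $\{3,6\}_{(s,0)}$ is the regular toroidal map obtained as the quotient of $\{3,6\}$ by the translations in $s\Lambda$. Its automorphism group $[3,6]_{(s,0)}$ is the quotient of $[3,6]$ by the group of translations by $s\Lambda$; it is isomorphic to $(C_s\times C_s)\rtimes D_6$ and has order $12s^2$ (here $D_6$ is the dihedral group of order $12$).
   Formalization: Part (2) is additionally not claimed for k=3 with q≠5: there G_2^p is conjugate to G_3^p (swap v_2 and v_3), of order 120, while O_1(3,q,0) and O(3,q,0) have orders q(q²−1) and 2q(q²−1), so the printed claim is false; the case k=3, q=5 is kept. *)

(* Defs.v *)
From HB Require Import structures.
From mathcomp Require Import all_boot all_order all_algebra all_fingroup.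
From mathcomp Require Import ring.
From mathcomp Require Import reals trigo.

Set Implicit Arguments.
Unset Strict Implicit.
Unset Printing Implicit Defensive.

Import Order.TTheory GRing.Theory Num.Theory.
Local Open Scope ring_scope.

(* ZTau a b stands for a + b * tau, where tau ^+ 2 = tau + 1. *)
Record Ztau : Type := ZTau { cst : int; cft : int }.

Definition pair_of_Ztau (x : Ztau) : int * int := (cst x, cft x).
Definition Ztau_of_pair (x : int * int) : Ztau := ZTau x.1 x.2.
Fact pair_of_ZtauK : cancel pair_of_Ztau Ztau_of_pair.
Proof. by case. Qed.

HB.instance Definition _ := Choice.copy Ztau (can_type pair_of_ZtauK).

Definition Ztau_zero : Ztau := ZTau 0 0.
Definition Ztau_opp (x : Ztau) : Ztau := ZTau (- cst x) (- cft x).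
Definition Ztau_add (x y : Ztau) : Ztau :=
  ZTau (cst x + cst y) (cft x + cft y).

Fact Ztau_addA : associative Ztau_add.
Proof. by case=> a b [c d] [e f]; congr ZTau => /=; ring. Qed.
Fact Ztau_addC : commutative Ztau_add.
Proof. by case=> a b [c d]; congr ZTau => /=; ring. Qed.
Fact Ztau_add0 : left_id Ztau_zero Ztau_add.
Proof. by case=> a b; congr ZTau => /=; ring. Qed.
Fact Ztau_addN : left_inverse Ztau_zero Ztau_opp Ztau_add.
Proof. by case=> a b; congr ZTau => /=; ring. Qed.

HB.instance Definition _ := GRing.isZmodule.Build Ztau
  Ztau_addA Ztau_addC Ztau_add0 Ztau_addN.

Definition Ztau_one : Ztau := ZTau 1 0.
Definition Ztau_mul (x y : Ztau) : Ztau :=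
  ZTau (cst x * cst y + cft x * cft y)
       (cst x * cft y + cft x * cst y + cft x * cft y).

Fact Ztau_mulA : associative Ztau_mul.
Proof. by case=> a b [c d] [e f]; congr ZTau => /=; ring. Qed.
Fact Ztau_mulC : commutative Ztau_mul.
Proof. by case=> a b [c d]; congr ZTau => /=; ring. Qed.
Fact Ztau_mul1 : left_id Ztau_one Ztau_mul.
Proof. by case=> a b; congr ZTau => /=; ring. Qed.
Fact Ztau_mulDl : left_distributive Ztau_mul +%R.
Proof. by case=> a b [c d] [e f]; congr ZTau => /=; ring. Qed.
Fact Ztau_one_neq0 : Ztau_one != 0.
Proof. by []. Qed.

HB.instance Definition _ := GRing.Zmodule_isComNzRing.Build Ztau
  Ztau_mulA Ztau_mulC Ztau_mul1 Ztau_mulDl Ztau_one_neq0.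

Definition tau : Ztau := ZTau 0 1.

Definition Ztau_norm (x : Ztau) : int :=
  cst x ^+ 2 + cst x * cft x - cft x ^+ 2.

Definition Ztau_unit (x : Ztau) : bool := (`|Ztau_norm x|%N == 1)%N.
Definition Ztau_inv (x : Ztau) : Ztau :=
  if Ztau_unit x
  then ZTau (Ztau_norm x * (cst x + cft x)) (- (Ztau_norm x * cft x)) else x.

Fact Ztau_normM (x y : Ztau) : Ztau_norm (x * y) = Ztau_norm x * Ztau_norm y.
Proof. by case: x y => a b [c d]; rewrite /Ztau_norm /=; ring. Qed.

Fact Ztau_mulVr : {in Ztau_unit, left_inverse 1 Ztau_inv *%R}.
Proof.
move=> [a b] Ux; rewrite /Ztau_inv (_ : Ztau_unit _ = true) //.
have N2 : Ztau_norm (ZTau a b) ^+ 2 = 1.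
  by move: Ux; rewrite unfold_in /Ztau_unit -real_normK ?num_real // -abszE => /eqP ->.
congr ZTau; rewrite /=; last by ring.
by rewrite -[RHS]N2 /Ztau_norm /=; ring.
Qed.
Fact Ztau_unitP (x y : Ztau) : y * x = 1 -> Ztau_unit x.
Proof.
move=> yx1; have : (`|Ztau_norm y| * `|Ztau_norm x|)%N = 1%N.
  by rewrite -abszM -Ztau_normM yx1.
by move/eqP; rewrite muln_eq1 => /andP[].
Qed.
Fact Ztau_inv_out : {in [predC Ztau_unit], Ztau_inv =1 id}.
Proof.
move=> x; rewrite inE /= /Ztau_inv => nUx.
by rewrite (_ : Ztau_unit x = false) //; apply/negbTE.
Qed.

HB.instance Definition _ := GRing.ComNzRing_hasMulInverse.Build Ztau
  Ztau_mulVr Ztau_unitP Ztau_inv_out.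

Definition Ztau_val (R : realType) (x : Ztau) : R :=
  (cst x)%:~R + (cft x)%:~R * ((1 + Num.sqrt 5) / 2).

Definition divides (x y : Ztau) : Prop := exists z, y = x * z.

Definition associate (x y : Ztau) : Prop :=
  exists2 u : Ztau, u \is a GRing.unit & y = u * x.

Definition Ztau_prime (p : Ztau) : Prop :=
  [/\ p != 0, p \isn't a GRing.unit &
      forall x y, divides p (x * y) -> divides p x \/ divides p y].

Definition odd_prime (p : Ztau) : Prop := Ztau_prime p /\ ~ associate p 2.

Definition classI (p : Ztau) : Prop := associate p (-1 + 2 * tau).

(* n is the positive rational prime associated with p. *)
Definition classII (p : Ztau) (n : nat) : Prop :=
  [/\ prime n, n %% 5 = 2 \/ n %% 5 = 3 & associate p n%:R]%N.

Definition classIII (p : Ztau) : Prop :=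
  [/\ Ztau_prime p, ~ (exists n : int, associate p n%:~R),
      (Ztau_norm p = 1 %[mod 5] \/ Ztau_norm p = -1 %[mod 5])%Z &
      prime `|Ztau_norm p|%N].

(* red exhibits F as the quotient ring Z[tau]/(p). *)
Definition is_residue_field (p : Ztau) (F : finFieldType)
    (red : {rmorphism Ztau -> F}) : Prop :=
  (forall y, exists x, red x = y) /\ (forall x, red x = 0 <-> divides p x).

Definition rho (k : nat) : Ztau :=
  match k with
  | 3%N => 1 | 4%N => 2 | 5%N => tau ^+ 2 | 6%N => 3 | _ => 0
  end.

Definition mx4 (rows : seq (seq Ztau)) : 'M[Ztau]_4 :=
  \matrix_(i, j) nth 0 (nth [::] rows i) j.

Definition r0 : 'M[Ztau]_4 :=
  mx4 [:: [:: -1; tau ^+ 2; 0; 0];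
          [:: 0; 1; 0; 0];
          [:: 0; 0; 1; 0];
          [:: 0; 0; 0; 1]].
Definition r1 (k : nat) : 'M[Ztau]_4 :=
  mx4 [:: [:: 1; 0; 0; 0];
          [:: 1; -1; 1; rho k];
          [:: 0; 0; 1; 0];
          [:: 0; 0; 0; 1]].
Definition r2 : 'M[Ztau]_4 :=
  mx4 [:: [:: 1; 0; 0; 0];
          [:: 0; 1; 0; 0];
          [:: 0; 1; -1; 0];
          [:: 0; 0; 0; 1]].
Definition r3 : 'M[Ztau]_4 :=
  mx4 [:: [:: 1; 0; 0; 0];
          [:: 0; 1; 0; 0];
          [:: 0; 0; 1; 0];
          [:: 0; 1; 0; -1]].

Definition r (k : nat) (j : 'I_4) : 'M[Ztau]_4 :=
  tnth [tuple r0; r1 k; r2; r3] j.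

Definition gram (k : nat) : 'M[Ztau]_4 :=
  let t := tau ^+ 2 in
  mx4 [:: [:: 4; -2 * t; 0; 0];
          [:: -2 * t; 4 * t; -2 * t; -2 * t * rho k];
          [:: 0; -2 * t; 4 * t; 0];
          [:: 0; -2 * t * rho k; 0; 4 * t * rho k]].

Fact r_sqr (k : nat) (j : 'I_4) : r k j *m r k j = 1%:M.
Proof.
apply/matrixP=> a b; rewrite !mxE !big_ord_recl big_ord0.
by case: j => [[|[|[|[|?]]]] ?] //; case: a => [[|[|[|[|?]]]] ?] //;
  case: b => [[|[|[|[|?]]]] ?] //; rewrite /r (tnth_nth 0) !mxE /=; ring.
Qed.

Section ReductionModP.
Variables (F : finFieldType) (red : {rmorphism Ztau -> F}).

Fact red_r_unit (k : nat) (j : 'I_4) :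
  (map_mx red (r k j) : 'M_4) \is a GRing.unit.
Proof.
apply/unitrP; exists (map_mx red (r k j)).
by split; rewrite -[LHS]map_mxM r_sqr map_mx1.
Qed.

Definition rp (k : nat) (j : 'I_4) : {'GL_4[F]} :=
  FinRing.unit 'M[F]_4 (red_r_unit k j).

Definition Gp_sub (k : nat) (i : 'I_4) : {group {'GL_4[F]}} :=
  <<[set rp k j | j in [set~ i]]>>%G.

(* For injective b, the matrix, with respect to the basis v_(b 0), v_(b 1),
   v_(b 2), of the action of g on the span of these vectors, which is assumed
   to be g-invariant. *)
Definition restr (b : 'I_3 -> 'I_4) (g : {'GL_4[F]}) : 'M[F]_3 :=
  mxsub b b (val g).

Definition restricts_to (b : 'I_3 -> 'I_4) (G : {set {'GL_4[F]}})
    (H : {set {'GL_3[F]}}) : Prop :=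
  {in G &, injective (restr b)} /\
  [set restr b g | g in G] = [set val h | h in H].

Definition form_restr (k : nat) (b : 'I_3 -> 'I_4) : 'M[F]_3 :=
  mxsub b b (map_mx red (gram k)).

End ReductionModP.

Section Orthogonal.
Variables (F : finFieldType) (B : 'M[F]_3).

Definition bform (x y : 'cV[F]_3) : F := (x^T *m B *m y) 0 0.

Definition O3 : {set {'GL_3[F]}} :=
  [set h | [forall x, forall y, bform (val h *m x) (val h *m y) == bform x y]].

Definition is_reflection (v : 'cV[F]_3) (h : {'GL_3[F]}) : bool :=
  [forall x : 'cV[F]_3, val h *m x == x - (2 * bform x v / bform v v) *: v].

Definition nonzero_square (a : F) : bool :=
  [exists c : F, (c != 0) && (a == c ^+ 2)].

Definition O3_1 : {set {'GL_3[F]}} :=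
  <<[set h | [exists v, nonzero_square (bform v v) && is_reflection v h]]>>%g.

End Orthogonal.

Definition is_orthogonal_group (F : finFieldType) (red : {rmorphism Ztau -> F})
    (k : nat) (b : 'I_3 -> 'I_4) (G : {set {'GL_4[F]}}) : Prop :=
  let B := form_restr red k b in
  B \in unitmx /\ (restricts_to b G (O3 B) \/ restricts_to b G (O3_1 B)).

Definition coxeter_linear (m n : nat) (i j : 'I_3) : nat :=
  nth 0%N (nth [::] [:: [:: 1; m; 2]; [:: m; 1; n]; [:: 2; n; 1]]%N i) j.

Definition coxeter_A3 := coxeter_linear 3 3.
Definition coxeter_B3 := coxeter_linear 3 4.
Definition coxeter_H3 := coxeter_linear 3 5.

Section StandardRepresentation.
Variables (R : realType) (M : 'I_3 -> 'I_3 -> nat).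

Definition coxeter_form (i j : 'I_3) : R := - cos (pi / (M i j)%:R).

(* Column j is the image alpha_j - 2 (alpha_i . alpha_j) alpha_i of the simple
   root alpha_j. *)
Definition simple_reflection (i : 'I_3) : 'M[R]_3 :=
  \matrix_(l, j) ((l == j)%:R - 2 * coxeter_form i j * (l == i)%:R).

(* S i is the matrix of the i-th simple reflection with respect to the basis
   of rescaled simple roots c_j alpha_j. *)
Definition standard_over_Ztau (S : 'I_3 -> 'M[Ztau]_3) : Prop :=
  exists2 c : 'rV[R]_3, (forall j, 0 < c 0 j) &
    forall i, map_mx (@Ztau_val R) (S i) =
      invmx (diag_mx c) *m simple_reflection i *m diag_mx c.

End StandardRepresentation.

Definition reduced_group (F : finFieldType) (red : {rmorphism Ztau -> F})
    (S : 'I_3 -> 'M[Ztau]_3) : {set {'GL_3[F]}} :=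
  <<[set h : {'GL_3[F]} | [exists i, val h == map_mx red (S i)]]>>%g.

Definition is_reduction_of_standard (R : realType) (M : 'I_3 -> 'I_3 -> nat)
    (F : finFieldType) (red : {rmorphism Ztau -> F}) (b : 'I_3 -> 'I_4)
    (G : {set {'GL_4[F]}}) : Prop :=
  exists2 S, standard_over_Ztau R M S &
    restricts_to b G (reduced_group red S).

(* The vertex lattice of {3,6} is Z e_0 + Z e_1 with e_0, e_1 of equal length at
   an angle of 60 degrees: tri_gram is twice their Gram matrix.  A symmetry of
   {3,6} is a map x |-> A x + t with t in the lattice and A a linear isometry
   preserving the lattice; it is encoded, in the coordinates of this basis, by
   the pair (A, t). *)
Definition affine2 : Type := ('M[int]_2 * 'cV[int]_2)%type.

Definition affine2_comp (g h : affine2) : affine2 :=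
  (g.1 *m h.1, g.1 *m h.2 + g.2).

Definition tri_gram : 'M[int]_2 := \matrix_(i, j) (if i == j then 2 else 1).

Definition sym36 (g : affine2) : Prop :=
  g.1^T *m tri_gram *m g.1 = tri_gram.

Definition translation_in (s : nat) (g : affine2) : Prop :=
  g.1 = 1%:M /\ exists t : 'cV[int]_2, g.2 = s%:R *: t.

(* G is isomorphic to the quotient of [3,6] by its translations in s times the
   vertex lattice: there is an epimorphism from [3,6] onto G with that kernel. *)
Definition isomorphic_36_torus (gT : finGroupType) (G : {set gT}) (s : nat) :
    Prop :=
  exists f : affine2 -> gT,
    [/\ forall g h, sym36 g -> sym36 h ->
          f (affine2_comp g h) = (f g * f h)%g,
        forall x, x \in G <-> (exists2 g, sym36 g & f g = x) &
        forall g, sym36 g -> (f g = 1%g <-> translation_in s g)].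

(* Bases of W_0, W_2, W_3.  For W_0 and W_3 they are listed so that consecutive
   vectors are adjacent in the Coxeter diagrams [3,k] and [3,5]. *)
Definition W0_basis : 'I_3 -> 'I_4 := tnth [tuple inord 2; inord 1; inord 3].
Definition W2_basis : 'I_3 -> 'I_4 := tnth [tuple inord 0; inord 1; inord 3].
Definition W3_basis : 'I_3 -> 'I_4 := tnth [tuple inord 2; inord 1; inord 0].

(* Main.v *)
Require Import Defs.
From HB Require Import structures.
From mathcomp Require Import all_boot all_order all_algebra all_fingroup all_solvable all_field.
From mathcomp Require Import ring zify.
From mathcomp Require Import reals trigo.
Set Implicit Arguments.
Unset Strict Implicit.
Unset Printing Implicit Defensive.
Import Order.TTheory GRing.Theory Num.Theory.
Local Open Scope ring_scope.

(** Let W_i be spanned by the basis vectors other than v_i.  Except for G_0 with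
    k = 6, each of the three groups fixes a vector outside W_i, so its elements are
    determined by their restrictions to W_i, and the group is described by three
    explicit 3 x 3 matrices ([restricts_to_gen], [Gp_sub_restricts]).

    For G_3, and for G_0 when k is 3, 4 or 5, these matrices over Z[tau] are
    the simple reflections of a Coxeter group in a basis of rescaled simple roots,
    because 2 cos(pi/3) = 1, (2 cos(pi/4))^2 = 2 and 2 cos(pi/5) = tau
    ([W0_standard], [W3_standard]).

    For k = 6 the form is degenerate on W_0, with radical spanned by
    u = 2 v_1 + v_2 + v_3.  The elements of G_0 fix u and act on the quotient of W_0
    by u as the point group of the hexagonal lattice; in a basis adapted to u they
    are parabolic matrices, the values of a homomorphism [torus_mx] on the
    symmetries of {3,6}.  Twice the translation vector appears among the entries of
    the parabolic matrix, so the kernel consists of the translations by l times the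
    lattice, l being the characteristic of the residue field ([G0_torus]).

    The main work is G_2, which is generated by three reflections of a
    non-singular ternary space.  Two of the roots have square norm.  If the
    rotations of G_2 are transitive on the vectors of each non-zero norm, then
    G_2 contains every reflection whose root has square norm, and every
    reflection at all if the third root has non-square norm; the theorem of Cartan
    and Dieudonne then gives O_1 or O ([reflection_group_orthogonal]).

    Transitivity is obtained from the stabilizers of isotropic vectors.  A rotation
    fixing an isotropic vector x is determined by an element of F, its slope.  If
    the pointwise stabilizer of some isotropic x is full, that is of order |F|,
    then so is that of a second one, and together they are transitive
    ([full_pole_transitive]).

    A full stabilizer exists by a count in the group H of rotations of G_2.
    Every non-trivial rotation fixes a unique line, so the non-trivial elements of H
    are partitioned according to the orbit of their axis.  A class of anisotropic
    axes with pointwise stabilizer of order m has size (1 - 1/m) |H| or half of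
    that.  As in the classification of the finite rotation groups of Euclidean
    space, if no axis were isotropic then H would be cyclic, dihedral or the group
    of a Platonic solid; this is excluded because H is irreducible and contains an
    element of order 5 and another one whose square, cube and fifth power are
    non-trivial ([exists_isotropic_pole]); in characteristic 5 the element of order
    5 itself has an isotropic axis.  So some isotropic x has a non-trivial
    stabilizer, an l-group embedded in F.  The residue field is generated by tau, so
    it has l or l^2 elements.  In the first case the stabilizer is full.  In the
    second one 5 divides l^2 + 1, and a finer count, which includes the unipotent
    elements, excludes stabilizers of order l ([not_order_l]). *)

(** * Arithmetic of the partition of a rotation group *)

Section PoleArithmetic.
Local Open Scope nat_scope.

(** The numbers attached to an orbit of anisotropic axes in a rotation group of
    order h: s counts the non-trivial rotations about these axes, j is the number
    of axes, and n is j times the order of the pointwise stabilizer of an axis.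
    The stabilizer of the line has order h / j and contains the pointwise one with
    index 1 or 2.  Irreducibility gives 1 < j. *)
Definition class_numbers (h s j n : nat) :=
  [/\ 1 < j, s + j = n & h = n \/ h = 2 * n].

Lemma ten_le_of_dvd5 m : 5 %| m -> 4 <= m -> m <> 5 -> 10 <= m.
Proof. lia. Qed.

Variables (h sa ja na sb jb nb sc jc nc sd jd nd : nat).
Hypotheses (numa : class_numbers h sa ja na) (numb : class_numbers h sb jb nb)
  (numc : class_numbers h sc jc nc) (numd : class_numbers h sd jd nd).

Lemma one_class_not_full : sa.+1 <> h.
Proof. case: numa; lia. Qed.

Lemma two_classes_not_full :
  10 * ja <= na -> nb = 2 * jb \/ 3 * jb <= nb -> (sa + sb).+1 <> h.
Proof. case: numa; case: numb; lia. Qed.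

(** With the order m of the stabilizers, the size of a class is (1 - 1/m) h or half
    of it.  The Euclidean solutions of the count with three classes are the triples
    (2,2,m), (2,3,3), (2,3,4) and (2,3,5); a stabilizer of order at least 10 leaves
    (2,2,m), which has an axis class with j = 1. *)
Lemma three_classes_not_full : 10 * ja <= na ->
  nb = 2 * jb \/ 3 * jb <= nb -> nc = 2 * jc \/ 3 * jc <= nc ->
  (sa + sb + sc).+1 <> h.
Proof. case: numa; case: numb; case: numc; lia. Qed.

Lemma four_classes_overflow : 10 * ja <= na ->
  2 * jb <= nb -> 2 * jc <= nc -> 2 * jd <= nd -> h <= sa + sb + sc + sd.
Proof. case: numa; case: numb; case: numc; case: numd; lia. Qed.

Lemma two_large_classes_not_full :
  5 * ja <= na -> 4 * jb <= nb -> (sa + sb).+1 <> h.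
Proof. case: numa; case: numb; lia. Qed.

Lemma three_classes_overflow :
  5 * ja <= na -> 4 * jb <= nb -> 2 * jc <= nc -> h <= sa + sb + sc.
Proof. case: numa; case: numb; case: numc; lia. Qed.

End PoleArithmetic.

(** In this section sx is the number of non-trivial unipotent elements, when the
    isotropic axes form one orbit of j lines with pointwise stabilizers of order l
    and k multipliers; the indices a and d refer to an orbit of axes of elements of
    order 5 and to the axes of a split torus of order k. *)
Section UnipotentArithmetic.
Local Open Scope nat_scope.

Variables (l h k j sx sa ja na : nat).
Hypotheses (l_gt2 : 2 < l) (j_gt1 : 1 < j) (cx : sx + j = l * j)
  (hx : h = l * k * j) (numa : class_numbers h sa ja na) (ja5 : 5 * ja <= na).

Lemma trivial_torus_overflow : k = 1 -> h <= sx + sa.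
Proof.
case: numa => _ sE hE k1; have : 3 * j <= l * j by rewrite leq_mul2r l_gt2 orbT.
by have := hx; rewrite k1 muln1; lia.
Qed.

Variables (sd jd nd : nat).
Hypotheses (k_gt1 : 1 < k) (numd : class_numbers h sd jd nd) (Nd : nd = k * jd).

Lemma torus_double : h = 2 * nd -> l * j = 2 * jd.
Proof.
move=> E; apply/eqP; rewrite -(eqn_pmul2l (ltnW k_gt1)); apply/eqP.
by rewrite mulnCA [RHS]mulnCA -Nd -E hx mulnA mulnAC.
Qed.

(** Either these three classes already have too many elements, or they exhaust the
    group, or they leave a gap that is smaller than any further class. *)
Lemma torus_classes : h <= sx + sd + sa \/
  [/\ (sx + sd + sa).+1 = h, h = 2 * na & l * j + 2 = 2 * j + 2 * ja] \/
  (sx + sd + sa).+1 < h /\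
  forall sb jb nb, class_numbers h sb jb nb -> 2 * jb <= nb -> h <= sx + sd + sa + sb.
Proof.
have L3 : 3 * j <= l * j by rewrite leq_mul2r l_gt2 orbT.
have L2 : 2 * (l * j) <= h by rewrite hx mulnAC mulnC leq_mul2l k_gt1 orbT.
case: (numd) => _ sdE [hd | hd].
  have E : l * j = jd.
    apply/eqP; rewrite -(eqn_pmul2l (ltnW k_gt1)); apply/eqP.
    by rewrite mulnCA mulnA -hx hd Nd.
  by left; case: numa => _ saE haE; lia.
have E := torus_double hd.
case: numa => _ saE [ha | ha]; first by left; lia.
have [le | lt] := leqP h (sx + sd + sa); first by left.
right; move: lt; rewrite leq_eqVlt => /orP[/eqP full | lt]; [left | right].
  by split=> //; lia.
by split=> // sb jb nb [_ sbE hbE] jb2; lia.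
Qed.

End UnipotentArithmetic.

(** The surviving numerical possibility is the icosahedral group in
    characteristic 3.  Writing j = l i + 1 and m = k + c, the two equations
    combine into c ((l - 2) i + 1) = 2 k i with i dividing c; since k < l, only
    finitely many values of c and i remain. *)
Lemma unipotent_diophantine (l k j m ja : nat) : prime l -> (2 < l)%N ->
  (1 < j)%N -> j = 1 %[mod l] -> (k < l)%N -> (0 < k)%N ->
  (l * k * j = 2 * (m * ja))%N -> (l * j + 2 = 2 * j + 2 * ja)%N ->
  (5 %| m)%N -> (5 %| l ^ 2 + 1)%N -> [/\ l = 3, k = 2 & m = 5]%N.
Proof.
move=> pr_l l2 j1 jl kl k0 E1 E2 m5 l5.
have [i0 jE] : exists i, j = (l * i + 1)%N.
  exists (j %/ l)%N; rewrite {1}(divn_eq j l) mulnC jl.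
  by rewrite modn_small // prime_gt1.
have i_gt0 : (0 < i0)%N by case: i0 jE => // jE; rewrite jE muln0 in j1.
have [L lE] : exists L, l = L.+2 by exists l.-2; lia.
have Dpos : (0 < L * i0 + 1)%N by rewrite addn1.
have E3 : (m * (L * i0 + 1) = k * (l * i0 + 1))%N.
  have l0 : (0 < l)%N by lia.
  apply/eqP; rewrite -(eqn_pmul2l l0); apply/eqP.
  have -> : (l * (k * (l * i0 + 1)) = l * k * j)%N by rewrite jE mulnA.
  rewrite E1 mulnCA mulnC [RHS]mulnCA mulnC; congr (_ * _)%N.
  by rewrite lE jE lE in E2 *; nia.
have km : (k <= m)%N.
  rewrite -(leq_pmul2r Dpos) E3 leq_mul2l lE leq_add2r leq_mul2r -addn2 leq_addr.
  by rewrite !orbT.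
have [c mE] : exists c, m = (k + c)%N by exists (m - k)%N; rewrite subnKC.
have E4 : (c * (L * i0 + 1) = 2 * k * i0)%N.
  by rewrite mE lE in E3; nia.
have : (i0 %| c)%N.
  have : (i0 %| c * (L * i0 + 1))%N by rewrite E4 dvdn_mull.
  by rewrite Gauss_dvdl // /coprime gcdnMDl gcdn1.
case/dvdnP=> c' cE.
have E5 : (c' * (L * i0 + 1) = 2 * k)%N.
  apply/eqP; rewrite -(eqn_pmul2r i_gt0) -E4 cE; apply/eqP; ring.
have L1 : (1 <= L)%N by lia.
have small : (c' * i0 <= 3)%N.
  rewrite leqNgt; apply/negP=> big.
  have : (L * 4 <= L * (c' * i0))%N by rewrite leq_mul2l big orbT.
  have : (1 <= c')%N by case: c' big {cE E5}.
  move: E5; rewrite mulnDr muln1 mulnCA lE in kl *.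
  by move: (L * (c' * i0))%N => X {E1 E2 E3 E4 jl jE l5 m5}; lia.
have c'0 : (0 < c')%N by case: c' E5 {cE small} => //; lia.
have c'3 : (c' <= 3)%N by apply: leq_trans small; rewrite leq_pmulr.
have i3 : (i0 <= 3)%N by apply: leq_trans small; rewrite leq_pmull.
have l5' : (l %% 5 = 2 \/ l %% 5 = 3)%N.
  move: l5; rewrite /dvdn -modnDml -modnXm; move: (ltn_pmod l (isT : (0 < 5)%N)).
  by case: (l %% 5)%N => [|[|[|[|[|?]]]]] //= _ _; [left | right].
clear E1 E2 jl jE E3 E4 Dpos j1 l5 pr_l j ja.
have split3 : l = 3%N /\ k = 2%N /\ m = 5%N -> [/\ l = 3, k = 2 & m = 5]%N.
  by case=> -> [-> ->].
apply: split3; move: c'0 c'3 i_gt0 i3 small E5 cE.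
case: c' => [|[|[|[|?]]]] //; case: i0 => [|[|[|[|?]]]] // _ _ _ _ _ E5 cE;
  rewrite ?muln1 ?mul1n in E5 cE; lia.
Qed.

(** * Triples of column vectors *)

Definition col3 (F : fieldType) (a b c : 'cV[F]_3) : 'M[F]_3 :=
  \matrix_(i, j) tnth [tuple a i 0; b i 0; c i 0] j.

Section Columns.
Variable F : fieldType.
Implicit Types (a b c v w : 'cV[F]_3) (M : 'M[F]_3).

Definition vec3 (x y z : F) : 'cV[F]_3 := \col_i tnth [tuple x; y; z] i.

Lemma vec3_eta v : v = vec3 (v 0 0) (v 1 0) (v 2%:R 0).
Proof.
apply/colP=> i; rewrite mxE (tnth_nth 0).
by case: i => [[|[|[|?]]] ?] //=; congr (v _ 0); apply: val_inj.
Qed.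

Lemma col3_mul a b c v :
  col3 a b c *m v = v 0 0 *: a + v 1 0 *: b + v 2%:R 0 *: c.
Proof.
apply/colP=> i; rewrite !mxE !big_ord_recl big_ord0 !mxE !(tnth_nth 0) /=.
have -> : lift ord0 ord0 = 1 :> 'I_3 by apply: val_inj.
have -> : lift ord0 (lift ord0 ord0) = 2%:R :> 'I_3 by apply: val_inj.
ring.
Qed.

Lemma mul_col3 M a b c : M *m col3 a b c = col3 (M *m a) (M *m b) (M *m c).
Proof.
apply/matrixP=> i j; rewrite !mxE !(tnth_nth 0) /=.
by case: j => [[|[|[|?]]] ?] //=; apply: eq_bigr => k _;
  rewrite !mxE (tnth_nth 0).
Qed.

Lemma det3 M : \det M =
  M 0 0 * (M 1 1 * M 2%:R 2%:R - M 1 2%:R * M 2%:R 1)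
  - M 0 1 * (M 1 0 * M 2%:R 2%:R - M 1 2%:R * M 2%:R 0)
  + M 0 2%:R * (M 1 0 * M 2%:R 1 - M 1 1 * M 2%:R 0).
Proof.
have E n (N : 'M[F]_n.+1) : exists f, forall i j, N i j = f (val i) (val j).
  by exists (fun k l => N (inord k) (inord l)) => i j; rewrite !inord_val.
have d2 (N : 'M[F]_2) : \det N = N 0 0 * N 1 1 - N 0 1 * N 1 0.
  rewrite (expand_det_row _ 0) !big_ord_recl big_ord0 /cofactor !det_mx11 !mxE.
  have [f Ef] := E _ N; rewrite !Ef /= /bump /=.
  by ring.
rewrite (expand_det_row _ 0) !big_ord_recl big_ord0 /cofactor !d2 !mxE.
have [f Ef] := E _ M; rewrite !Ef /= /bump /=.
by ring.
Qed.

Lemma col3_unit a b c :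
  (forall x y z, x *: a + y *: b + z *: c = 0 -> [/\ x = 0, y = 0 & z = 0]) ->
  col3 a b c \in unitmx.
Proof.
move=> free; rewrite -unitmx_tr unitmxE unitfE; apply/det0P => -[v vn0 v0].
case/eqP: vn0; apply: trmx_inj; rewrite trmx0 [LHS]vec3_eta.
have := free (v^T 0 0) (v^T 1 0) (v^T 2%:R 0).
rewrite -col3_mul -[_ *m _]trmxK trmx_mul trmxK v0 trmx0 => /(_ erefl)[-> -> ->].
by apply/colP=> i; rewrite !mxE (tnth_nth 0); case: i => [[|[|[|?]]] ?].
Qed.

Lemma col3_span a b c v : col3 a b c \in unitmx ->
  exists x y z, v = x *: a + y *: b + z *: c.
Proof.
move=> U; pose w := invmx (col3 a b c) *m v.
by exists (w 0 0), (w 1 0), (w 2%:R 0); rewrite -col3_mul mulKVmx.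
Qed.

Lemma eq_on_col3 a b c M N : col3 a b c \in unitmx ->
  M *m a = N *m a -> M *m b = N *m b -> M *m c = N *m c -> M = N.
Proof.
move=> U Ea Eb Ec; apply: (can_inj (mulmxK U)).
by rewrite !mul_col3 Ea Eb Ec.
Qed.

Lemma det_on_col3 a b c M (x1 x2 x3 y1 y2 y3 z1 z2 z3 : F) : col3 a b c \in unitmx ->
  M *m a = x1 *: a + x2 *: b + x3 *: c ->
  M *m b = y1 *: a + y2 *: b + y3 *: c ->
  M *m c = z1 *: a + z2 *: b + z3 *: c ->
  \det M = x1 * (y2 * z3 - y3 * z2) - y1 * (x2 * z3 - x3 * z2)
           + z1 * (x2 * y3 - x3 * y2).
Proof.
move=> U Ea Eb Ec.
pose N := col3 (vec3 x1 x2 x3) (vec3 y1 y2 y3) (vec3 z1 z2 z3).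
have MN : M *m col3 a b c = col3 a b c *m N.
  by rewrite !mul_col3 !col3_mul !mxE !(tnth_nth 0) /= Ea Eb Ec.
have dU : \det (col3 a b c) != 0 by rewrite -unitfE -unitmxE.
have : \det M = \det N.
  apply: (mulIf dU); by rewrite -det_mulmx MN det_mulmx mulrC.
move=> ->; rewrite det3 !mxE !(tnth_nth 0) /=. ring.
Qed.

End Columns.

(** * Rotations of a ternary quadratic space *)

Section Geometry.
Variables (F : finFieldType) (B : 'M[F]_3).
Hypotheses (Bsym : B^T = B) (Bunit : B \in unitmx) (F2 : 2 != 0 :> F).
Implicit Types (v w x y z : 'cV[F]_3) (M : 'M[F]_3).
Local Notation dot := (bform B).

Lemma dotC x y : dot x y = dot y x.
Proof.
rewrite /bform; have -> : x^T *m B *m y = (y^T *m B *m x)^T.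
  by rewrite !trmx_mul trmxK Bsym mulmxA.
by rewrite mxE.
Qed.

Lemma dotDr x y z : dot x (y + z) = dot x y + dot x z.
Proof. by rewrite /bform mulmxDr mxE. Qed.

Lemma dotZr k x y : dot x (k *: y) = k * dot x y.
Proof. by rewrite /bform -scalemxAr mxE. Qed.

Lemma dotDl x y z : dot (x + y) z = dot x z + dot y z.
Proof. by rewrite dotC dotDr !(dotC z). Qed.

Lemma dotZl k x y : dot (k *: x) y = k * dot x y.
Proof. by rewrite dotC dotZr dotC. Qed.

Lemma dotNr x y : dot x (- y) = - dot x y.
Proof. by rewrite -scaleN1r dotZr mulN1r. Qed.

Lemma dotNl x y : dot (- x) y = - dot x y.
Proof. by rewrite dotC dotNr dotC. Qed.

Lemma dot0r x : dot x 0 = 0.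
Proof. by rewrite -(scale0r 0) dotZr mul0r. Qed.

Lemma dot0l x : dot 0 x = 0.
Proof. by rewrite dotC dot0r. Qed.

Definition dotE := (dotDl, dotDr, dotZl, dotZr, dotNl, dotNr, dot0l, dot0r).

Lemma dot_nondegenerate x : (forall y, dot x y = 0) -> x = 0.
Proof.
move=> x0; apply: trmx_inj; apply: (can_inj (mulmxK Bunit)).
rewrite trmx0 mul0mx; apply/rowP=> i.
have := x0 (delta_mx i 0); rewrite /bform !mxE (bigD1 i) //= big1 => [|j ji].
  by rewrite !mxE !eqxx mulr1 addr0.
by rewrite [delta_mx _ _ _ _]mxE (negPf ji) mulr0.
Qed.

Lemma exists_dot_neq0 x : x != 0 -> exists y, dot x y != 0.
Proof.
move=> xn0; case: (pickP (fun y => dot x y != 0)) => [y ?|all0]; first by exists y.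
by case/eqP: xn0; apply: dot_nondegenerate => y; have := all0 y => /negbFE/eqP.
Qed.

Lemma dot_basis_eq0 (a b c : 'cV[F]_3) x : col3 a b c \in unitmx ->
  dot x a = 0 -> dot x b = 0 -> dot x c = 0 -> x = 0.
Proof.
move=> U xa xb xc; apply: dot_nondegenerate => y.
have [s [t [u ->]]] := col3_span y U.
by rewrite !dotE xa xb xc !mulr0 !addr0.
Qed.

(** Two homogeneous linear equations in three unknowns. *)
Lemma exists_perp2 v w : exists2 z, z != 0 & dot z v = 0 /\ dot z w = 0.
Proof.
pose M := col3 (B *m v) (B *m w) 0.
have /eqP/det0P[u un0 uM] : \det M = 0.
  by rewrite det3 ![M _ 2%:R]mxE !(tnth_nth 0) /= !mxE; ring.
exists u^T; first by rewrite -(inj_eq trmx_inj) trmxK trmx0.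
rewrite /bform !trmxK; split; rewrite -mulmxA.
  have := congr1 (fun N : 'rV_3 => N 0 0) uM; rewrite !mxE => E.
  by rewrite ?mxE -[RHS]E; apply: eq_bigr => i _; rewrite [M _ _]mxE (tnth_nth 0).
have := congr1 (fun N : 'rV_3 => N 0 1) uM; rewrite !mxE => E.
by rewrite ?mxE -[RHS]E; apply: eq_bigr => i _; rewrite [M _ _]mxE (tnth_nth 0).
Qed.

Definition isometry M := forall x y, dot (M *m x) (M *m y) = dot x y.
Definition rotation M := isometry M /\ \det M = 1.

Lemma isometry_inj M x : isometry M -> M *m x = 0 -> x = 0.
Proof.
move=> isoM Mx0; apply: dot_nondegenerate => y.
by rewrite -isoM Mx0 dot0l.
Qed.

Lemma isometry_mx M : isometry M -> M^T *m B *m M = B.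
Proof.
move=> isoM; apply/matrixP=> i j.
have := isoM (delta_mx i 0) (delta_mx j 0).
have E (N : 'M[F]_3) : N i j = ((delta_mx i 0 : 'cV[F]_3)^T *m N *m (delta_mx j 0 : 'cV[F]_3)) 0 0.
  by rewrite -mulmxA -colE trmx_delta -rowE !mxE.
by rewrite /bform (E (_ *m M)) (E B) trmx_mul !mulmxA.
Qed.

(** Since M^T B (M - 1) = - (M - 1)^T B and the dimension is odd, the determinant of
    M - 1 is its own opposite. *)
Lemma rotation_axis M : rotation M -> exists2 v : 'cV[F]_3, v != 0 & M *m v = v.
Proof.
case=> isoM detM.
have : \det (M - 1%:M) = 0.
  have E : M^T *m B *m (M - 1%:M) = (-1) *: ((M - 1%:M)^T *m B).
    rewrite mulmxBr isometry_mx // mulmx1 linearB /= trmx1 mulmxBl mul1mx.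
    by rewrite scaleN1r opprB.
  have := congr1 determinant E; rewrite detZ !det_mulmx !det_tr detM mul1r.
  rewrite [\det B * _]mulrC mulrA.
  have dB : \det B != 0 by rewrite -unitfE -unitmxE.
  move/(mulIf dB); rewrite -signr_odd /= expr1 mulN1r => /eqP.
  rewrite -subr_eq0 opprK -mulr2n -mulr_natl mulf_eq0 (negPf F2) /=.
  by move/eqP.
rewrite -det_tr => /eqP/det0P[u un0 uM].
exists u^T; first by rewrite -(inj_eq trmx_inj) trmxK trmx0.
apply/eqP; rewrite -subr_eq0 -{2}[u^T]mul1mx -mulmxBl.
by rewrite -(inj_eq trmx_inj) trmx_mul trmxK uM trmx0.
Qed.

(** A rotation fixing a plane pointwise is trivial.  Let z be orthogonal to the
    plane.  If z is anisotropic, it completes a basis and is an eigenvector whose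
    eigenvalue is the determinant.  If z is isotropic, it lies in the plane, and for
    x outside the plane M x - x turns out to be orthogonal to a whole basis. *)
Lemma rotation_unique_axis M v w : rotation M -> v != 0 ->
  M *m v = v -> M *m w = w -> M != 1%:M -> exists k, w = k *: v.
Proof.
move=> [isoM detM] vn0 Mv Mw Mn1.
case: (pickP (fun k => w == k *: v)) => [k /eqP ?|wv]; first by exists k.
have free2 s t : s *: v + t *: w = 0 -> s = 0 /\ t = 0.
  have [-> | tn0] := eqVneq t 0.
    rewrite scale0r addr0 => /eqP; rewrite scaler_eq0 (negPf vn0) orbF.
    by move/eqP.
  move/eqP; rewrite addrC addr_eq0 => /eqP E.
  have := wv (- (t^-1 * s)); rewrite scaleNr -scalerA -scalerN -E scalerA.
  by rewrite mulVf // scale1r eqxx.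
case/eqP: Mn1; have [z zn0 [zv zw]] := exists_perp2 v w.
have [z0 | zn] := eqVneq (dot z z) 0; last first.
  have U : col3 v w z \in unitmx.
    apply: col3_unit => s t u E.
    have u0 : u = 0.
      have := congr1 (dot z) E; rewrite !dotE zv zw !mulr0 !add0r => /eqP.
      by rewrite mulf_eq0 (negPf zn) orbF => /eqP.
    by move: E; rewrite u0 scale0r addr0 => /free2[].
  have [s [t [u E]]] := col3_span (M *m z) U.
  have d0 : M *m z - u *: z = 0.
    apply: (dot_basis_eq0 U); rewrite !dotE.
    - by rewrite -{1}Mv isoM zv mulr0 subr0.
    - by rewrite -{1}Mw isoM zw mulr0 subr0.
    - by rewrite E !dotE (dotC v) (dotC w) zv zw !mulr0 !add0r subrr.
  move/eqP: d0; rewrite subr_eq0 => /eqP Mz.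
  have u1 : u = 1.
    rewrite -detM (det_on_col3 (x1 := 1) (x2 := 0) (x3 := 0) (y1 := 0) (y2 := 1)
      (y3 := 0) (z1 := 0) (z2 := 0) (z3 := u) U) ?Mv ?Mw ?Mz;
    by rewrite ?scale1r ?scale0r ?addr0 ?add0r //; ring.
  apply: (eq_on_col3 U); rewrite mul1mx //.
  by rewrite Mz u1 scale1r.
have [x zx] := exists_dot_neq0 zn0.
have U : col3 v w x \in unitmx.
  apply: col3_unit => s t u E.
  have u0 : u = 0.
    have := congr1 (dot z) E; rewrite !dotE zv zw !mulr0 !add0r => /eqP.
    by rewrite mulf_eq0 (negPf zx) orbF => /eqP.
  by move: E; rewrite u0 scale0r addr0 => /free2[].
have fixperp y : dot z y = 0 -> M *m y = y.
  have [s [t [u ->]]] := col3_span y U.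
  rewrite !dotE zv zw !mulr0 !add0r => /eqP.
  rewrite mulf_eq0 (negPf zx) orbF => /eqP ->.
  by rewrite scale0r addr0 mulmxDr -!scalemxAr Mv Mw.
have [d dE] : exists d, d = M *m x - x by exists (M *m x - x).
have dv : dot d v = 0 by rewrite dE !dotE -{1}Mv isoM subrr.
have dw : dot d w = 0 by rewrite dE !dotE -{1}Mw isoM subrr.
have dz : dot z d = 0 by rewrite dE !dotE -{1}(fixperp z z0) isoM subrr.
have dd : dot d d = 0.
  have [s [t [u E]]] := col3_span d U.
  have u0 : u = 0.
    have := congr1 (dot z) E; rewrite dz !dotE zv zw !mulr0 !add0r => /esym/eqP.
    by rewrite mulf_eq0 (negPf zx) orbF => /eqP.
  by rewrite {2}E u0 !dotE dv dw; ring.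
have dx : dot d x = 0.
  have := isoM x x; rewrite -[M *m x](subrK x) -dE !dotE dd (dotC x d) => E.
  have : 2 * dot d x = 0.
    by rewrite -(subrr (dot x x)) -{1}E; ring.
  by move/eqP; rewrite mulf_eq0 (negPf F2) => /eqP.
apply: (eq_on_col3 U); rewrite mul1mx //.
by apply/eqP; rewrite -subr_eq0 -dE; apply/eqP/(dot_basis_eq0 U).
Qed.

Definition hyperbolic x y := [/\ dot x x = 0, dot y y = 0 & dot x y = 1].
(** Coordinates adapted to a pair of isotropic lines: a hyperbolic pair x, y and an
    anisotropic z orthogonal to both. *)
Definition frame x z y :=
  hyperbolic x y /\ [/\ dot x z = 0, dot y z = 0 & dot z z != 0].

Lemma frame_unit x z y : frame x z y -> col3 x z y \in unitmx.
Proof.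
move=> [[xx yy xy] [xz yz zz]]; apply: col3_unit => s t u E.
have := (congr1 (dot x) E, congr1 (dot y) E, congr1 (dot z) E).
rewrite !dotE xx yy xz yz (dotC z) xz (dotC z) yz (dotC y) xy.
rewrite !mulr0 !mulr1 !addr0 !add0r => -[[-> ->] /eqP].
by rewrite mulf_eq0 (negPf zz) orbF => /eqP ->.
Qed.

Lemma frame_expand x z y v : frame x z y ->
  v = dot v y *: x + (dot v z / dot z z) *: z + dot v x *: y.
Proof.
move=> fr; have U := frame_unit fr; case: fr => [[xx yy xy] [xz yz zz]].
apply/eqP; rewrite -subr_eq0; apply/eqP/(dot_basis_eq0 U); rewrite !dotE.
- by rewrite xx (dotC z) xz (dotC y) xy; ring.
- by rewrite xz yz divfK //; ring.
- by rewrite xy yy (dotC z) yz; ring.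
Qed.

Lemma frame_of_perp x z : x != 0 -> dot x x = 0 -> dot x z = 0 ->
  dot z z != 0 -> exists y, frame x z y.
Proof.
move=> xn0 xx xz zz; have [y0 xy0] := exists_dot_neq0 xn0.
pose y1 := (dot x y0)^-1 *: y0 - (dot x y0)^-1 * (dot y0 z / dot z z) *: z.
have xy1 : dot x y1 = 1 by rewrite /y1 !dotE xz mulVf //; ring.
have y1z : dot y1 z = 0 by rewrite /y1 !dotE -!mulrA mulVf //; ring.
exists (y1 - (dot y1 y1 / 2) *: x); clearbody y1.
split; split; rewrite ?dotE //.
- by rewrite xx xy1 (dotC y1) xy1; field.
- by rewrite xx xy1; ring.
- by rewrite y1z xz; ring.
Qed.

Lemma frame_of_hyperbolic x y : hyperbolic x y -> exists z, frame x z y.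
Proof.
move=> [xx yy xy]; have [z zn0 [zx zy]] := exists_perp2 x y.
exists z; split; split; rewrite // 1?dotC //.
have U : col3 x z y \in unitmx.
  apply: col3_unit => s t u E.
  have := (congr1 (dot x) E, congr1 (dot y) E).
  rewrite !dotE xx yy (dotC x) zx (dotC y z) zy xy (dotC y) xy.
  rewrite !mulr0 !mulr1 !addr0 !add0r => -[u0 s0].
  move: E; rewrite u0 s0 !scale0r addr0 add0r => /eqP.
  by rewrite scaler_eq0 (negPf zn0) orbF => /eqP.
by apply: contra zn0 => /eqP z0; apply/eqP/(dot_basis_eq0 U).
Qed.

Lemma hyperbolic_partner x : x != 0 -> dot x x = 0 -> exists y, hyperbolic x y.
Proof.
move=> xn0 xx; have [y0 xy0] := exists_dot_neq0 xn0.
pose y1 := (dot x y0)^-1 *: y0.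
have xy1 : dot x y1 = 1 by rewrite /y1 !dotE mulVf.
exists (y1 - (dot y1 y1 / 2) *: x); clearbody y1; split; rewrite ?dotE //.
- by rewrite xx xy1 (dotC y1) xy1; field.
- by rewrite xx xy1; ring.
Qed.

Lemma frame_of_isotropic x : x != 0 -> dot x x = 0 -> exists z y, frame x z y.
Proof.
move=> xn0 xx; have [y hyp] := hyperbolic_partner xn0 xx.
by have [z fr] := frame_of_hyperbolic hyp; exists z, y.
Qed.

Lemma frame_neq0 x z y : frame x z y -> [/\ x != 0, z != 0 & y != 0].
Proof.
move=> [[xx yy xy] [xz yz zz]]; split; apply/eqP=> E.
- by move: xy; rewrite E dot0l => /esym/eqP; rewrite oner_eq0.
- by move: zz; rewrite E dot0l eqxx.
- by move: xy; rewrite E dot0r => /esym/eqP; rewrite oner_eq0.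
Qed.

Lemma frame_sym x z y : frame x z y -> frame y z x.
Proof. by move=> [[xx yy xy] [xz yz zz]]; split; split=> //; rewrite dotC. Qed.

(** The eigenvalues of M on the flag x, x^perp, F^3 are c, the one on z, and
    c^-1, and their product is 1. *)
Lemma rotation_stabilizer x z y M c : rotation M -> frame x z y ->
  M *m x = c *: x -> c != 0 /\ M *m z = z + dot (M *m z) y *: x.
Proof.
move=> [isoM detM] fr Mx; have U := frame_unit fr.
have [xn0 _ _] := frame_neq0 fr.
have c0 : c != 0.
  apply: contra xn0 => /eqP c0; apply/eqP/(isometry_inj isoM).
  by rewrite Mx c0 scale0r.
have perpx w : dot (M *m w) x = c^-1 * dot w x.
  by rewrite -(isoM w x) Mx !dotE mulKf.
have Ez := frame_expand (M *m z) fr; have Ey := frame_expand (M *m y) fr.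
case: fr => [[xx yy xy] [xz yz zz]].
rewrite perpx (dotC z) xz mulr0 in Ez; rewrite perpx (dotC y x) xy mulr1 in Ey.
split=> //.
have : dot (M *m z) z / dot z z = 1.
  rewrite -[RHS]detM.
  rewrite (det_on_col3 (x1 := c) (x2 := 0) (x3 := 0) U _ Ez Ey).
    by field; rewrite zz c0.
  by rewrite Mx !scale0r !addr0.
by move=> d1; rewrite {1}Ez d1 scale1r scale0r addr0 addrC.
Qed.

(** So a rotation fixing x is unipotent and is determined by the scalar s. *)
Lemma rotation_fix_isotropic x z y M : rotation M -> frame x z y ->
  M *m x = x -> let s := dot (M *m z) y in
  M *m y = y - (s / dot z z) *: z - (s ^+ 2 / (2 * dot z z)) *: x.
Proof.
move=> rotM fr Mx s; have [|_ Mz] := rotation_stabilizer (c := 1) rotM fr.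
  by rewrite scale1r.
have Ey := frame_expand (M *m y) fr; case: (rotM) => isoM _.
case: fr => [[xx yy xy] [xz yz zz]]; rewrite -/s in Mz.
have Myx : dot (M *m y) x = 1 by rewrite -{1}Mx isoM dotC.
have Myz : dot (M *m y) z = - s.
  have := isoM y z; rewrite Mz yz !dotE Myx mulr1 => /eqP.
  by rewrite addr_eq0 => /eqP.
have Myy : dot (M *m y) y = - (s ^+ 2 / (2 * dot z z)).
  have := isoM y y; rewrite yy {1}Ey !dotE (dotC x) Myx (dotC z) Myz (dotC y) => E.
  have E2 : 2 * dot (M *m y) y = - (s ^+ 2 / dot z z).
    apply/eqP; rewrite -subr_eq0 -[0]E; apply/eqP; field.
    by [].
  by apply: (mulfI F2); rewrite E2; field; rewrite zz F2.
rewrite Ey Myx Myz Myy scale1r !scaleNr mulNr scaleNr.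
by rewrite addrC addrA addrAC -addrA [- _ - _]addrC addrA.
Qed.

(** M acts on the hyperbolic plane orthogonal to d with determinant 1, whereas an
    isometry exchanging the two isotropic lines of this plane has determinant -1. *)
Lemma rotation_perp_axis M d x : rotation M -> M *m d = d -> dot d d != 0 ->
  x != 0 -> dot x x = 0 -> dot x d = 0 -> exists c, M *m x = c *: x.
Proof.
move=> [isoM detM] Md dd xn0 xx xd; have [y fr] := frame_of_perp xn0 xx xd dd.
have U := frame_unit fr; have Ex := frame_expand (M *m x) fr.
have Ey := frame_expand (M *m y) fr.
case: fr => [[_ yy xy] [_ yd _]].
have perpd w : dot w d = 0 -> dot (M *m w) d = 0 by move=> <-; rewrite -{1}Md isoM.
rewrite perpd // mul0r scale0r addr0 in Ex.
rewrite perpd // mul0r scale0r addr0 in Ey.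
have null w a b : dot w w = 0 -> M *m w = a *: x + b *: y -> a * b = 0.
  move=> ww E; apply: (mulfI F2); rewrite mulr0 -[RHS]ww -(isoM w w) E !dotE.
  by rewrite xx yy xy (dotC y) xy; ring.
have /eqP := null _ _ _ xx Ex.
rewrite mulf_eq0 => /orP[/eqP a0 | /eqP b0]; last first.
  by exists (dot (M *m x) y); rewrite {1}Ex b0 scale0r addr0.
have /eqP := null _ _ _ yy Ey.
have := isoM x y; rewrite xy {1}Ex a0 scale0r add0r !dotE (dotC y) => Exy.
rewrite mulf_eq0 => /orP[/eqP d0 | /eqP e0].
  by move: Exy; rewrite d0 mulr0 => /esym/eqP; rewrite oner_eq0.
have E : 1 = - (dot (M *m x) x * dot (M *m y) y).
  rewrite -[LHS]detM (det_on_col3 (x1 := 0) (x2 := 0) (x3 := dot (M *m x) x)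
    (y1 := 0) (y2 := 1) (y3 := 0) (z1 := dot (M *m y) y) (z2 := 0) (z3 := 0) U).
  - by ring.
  - by rewrite {1}Ex a0 !scale0r !add0r.
  - by rewrite Md !scale0r add0r addr0 scale1r.
  - by rewrite {1}Ey e0 !scale0r !addr0.
by case/eqP: F2; rewrite -[2]/(1 + 1) {1}E Exy; ring.
Qed.

(** * Axes in a finite group of rotations *)

Local Notation GL3 := {'GL_3[F]}.
Definition mx_of (g : GL3) : 'M[F]_3 := val g.
Definition vact (g : GL3) v : 'cV[F]_3 := mx_of g *m v.

Lemma vactM g h v : vact (g * h)%g v = vact g (vact h v).
Proof. by rewrite /vact mulmxA. Qed.

Lemma vact1 v : vact 1%g v = v.
Proof. by rewrite /vact mul1mx. Qed.

Lemma vactK g v : vact g^-1%g (vact g v) = v.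
Proof. by rewrite -vactM mulVg vact1. Qed.

Lemma vactKV g v : vact g (vact g^-1%g v) = v.
Proof. by rewrite -vactM mulgV vact1. Qed.

Lemma vactZ g k v : vact g (k *: v) = k *: vact g v.
Proof. by rewrite /vact scalemxAr. Qed.

Lemma vactD g v w : vact g (v + w) = vact g v + vact g w.
Proof. by rewrite /vact mulmxDr. Qed.

Lemma vact_eq0 g v : (vact g v == 0) = (v == 0).
Proof.
apply/eqP/eqP=> [E | ->]; last by rewrite /vact mulmx0.
by rewrite -[v](vactK g) E /vact mulmx0.
Qed.

Lemma vact_inj g h : (forall v, vact g v = vact h v) -> g = h.
Proof.
move=> E; apply: val_inj; apply/matrixP=> i j.
have := E (delta_mx j 0); rewrite /vact -!colE => /colP/(_ i).
by rewrite !mxE.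
Qed.

Section RotationGroup.
Variable H : {group GL3}.
Hypothesis rotH : forall g : GL3, g \in H -> rotation (mx_of g).

Lemma dot_act g v w : g \in H -> dot (vact g v) (vact g w) = dot v w.
Proof. by move=> /rotH[isog _]; exact: isog. Qed.

Definition fixer v := [set g in H | vact g v == v].
Definition line_stab v := [set g in H | [exists c, vact g v == c *: v]].

Fact fixer_group_set v : group_set (fixer v).
Proof.
apply/group_setP; split=> [|g h]; first by rewrite inE group1 vact1 eqxx.
rewrite !inE => /andP[Hg /eqP gv] /andP[Hh /eqP hv].
by rewrite groupM // vactM hv gv eqxx.
Qed.
Canonical fixer_group v := Group (fixer_group_set v).

Fact line_stab_group_set v : group_set (line_stab v).
Proof.
apply/group_setP; split=> [|g h].
  by rewrite inE group1; apply/existsP; exists 1; rewrite vact1 scale1r.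
rewrite !inE => /andP[Hg /existsP[c /eqP gv]] /andP[Hh /existsP[d /eqP hv]].
rewrite groupM //; apply/existsP; exists (d * c).
by rewrite vactM hv vactZ gv scalerA.
Qed.
Canonical line_stab_group v := Group (line_stab_group_set v).

Lemma fixer_sub v : fixer v \subset H.
Proof. by apply/subsetP=> g; rewrite inE => /andP[]. Qed.

Lemma line_stab_sub v : line_stab v \subset H.
Proof. by apply/subsetP=> g; rewrite inE => /andP[]. Qed.

Lemma mem_fixerJ v g h : g \in H -> h \in H ->
  (g ^ h \in fixer v)%g = (g \in fixer (vact h v)).
Proof.
move=> Hg Hh; rewrite !inE Hg groupJ //= !vactM.
apply/eqP/eqP=> [E | ->]; last by rewrite vactK.
by rewrite -[LHS](vactKV h) E.
Qed.

Lemma fixer_act v h : h \in H -> fixer (vact h v) = (fixer v :^ h^-1)%g.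
Proof.
move=> Hh; apply/setP=> g; rewrite mem_conjg invgK.
case Hg: (g \in H); first by rewrite mem_fixerJ.
by rewrite !inE Hg groupJr //= Hg.
Qed.

Lemma fixerZ v k : k != 0 -> fixer (k *: v) = fixer v.
Proof.
move=> k0; apply/setP=> g; rewrite !inE vactZ; congr (_ && _).
by apply/eqP/eqP=> [/(scalerI k0) | ->].
Qed.

Lemma fixer_axis v w g : v != 0 -> g \in fixer v -> g != 1%g -> vact g w = w ->
  exists k, w = k *: v.
Proof.
move=> v0; rewrite inE => /andP[Hg /eqP gv] g1 gw.
apply: (rotation_unique_axis (rotH Hg) v0 gv gw).
by apply: contra g1 => /eqP E; apply/eqP/val_inj.
Qed.

(** A non-trivial rotation determines its axis, so a conjugate of the stabilizer
    meets it only if the conjugating element preserves the axis. *)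
Lemma fixer_TI v : v != 0 -> fixer v :!=: 1%g ->
  normedTI (fixer v)^# H (line_stab v).
Proof.
move=> v0 C1; apply/normedTI_memJ_P; split.
- by rewrite setD_eq0 subG1.
- exact: line_stab_sub.
move=> g h /setD1P[g1 Cg] Hh; have Hg := subsetP (fixer_sub v) g Cg.
rewrite 2!inE conjg_eq1 g1 /= mem_fixerJ // [in RHS]inE Hh /=.
apply/idP/existsP=> [| [c /eqP hv]].
  rewrite inE Hg /= => /eqP ghv.
  by have [k ->] := fixer_axis v0 Cg g1 ghv; exists k.
have c0 : c != 0.
  by apply: contraNneq v0 => c0; rewrite -(vact_eq0 h) hv c0 scale0r.
by rewrite hv fixerZ.
Qed.

(** The non-trivial elements of H whose axis lies in the orbit of the line of v. *)
Definition axis_class v := class_support (fixer v)^# H.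

Lemma axis_classP v g : reflect
  [/\ g \in H, g != 1%g & exists2 h, h \in H & vact g (vact h v) = vact h v]
  (g \in axis_class v).
Proof.
apply: (iffP imset2P) => [[a h /setD1P[a1 Ca] Hh ->] | [Hg g1 [h Hh gv]]].
  have Ha := subsetP (fixer_sub v) a Ca.
  split; rewrite ?groupJ ?conjg_eq1 //; exists h^-1%g; rewrite ?groupV //.
  move: Ca; rewrite inE Ha => /eqP av.
  by rewrite !vactM vactKV av.
exists (g ^ h)%g h^-1%g; rewrite ?groupV ?conjgK //.
by rewrite 2!inE conjg_eq1 g1 mem_fixerJ // inE Hg gv eqxx.
Qed.

Lemma axis_class_sub v : axis_class v \subset H^#%g.
Proof. by apply/subsetP=> g /axis_classP[Hg g1 _]; rewrite !inE g1. Qed.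

Lemma card_axis_class v : v != 0 -> fixer v :!=: 1%g ->
  (#|axis_class v| = (#|fixer v| - 1) * #|H : line_stab v|%g)%N.
Proof.
move=> v0 C1; rewrite (card_support_normedTI (fixer_TI v0 C1)).
by rewrite (cardsD1 1%g (fixer v)) group1 add1n subn1.
Qed.

Definition multipliers v :=
  [set c : F | [exists g in H, vact g v == c *: v]].

Lemma card_multipliers_gt0 v : (0 < #|multipliers v|)%N.
Proof.
apply/card_gt0P; exists 1; rewrite inE; apply/existsP; exists 1%g.
by rewrite group1 vact1 scale1r eqxx.
Qed.

Lemma card_line_stab v : v != 0 ->
  (#|line_stab v| = #|fixer v| * #|multipliers v|)%N.
Proof.
move=> v0; pose mult g := odflt 0 [pick c | vact g v == c *: v].
have multE g c : vact g v = c *: v -> mult g = c.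
  move=> E; rewrite /mult; case: pickP => [d|/(_ c)]; rewrite E ?eqxx //=.
  by rewrite -subr_eq0 -scalerBl scaler_eq0 (negPf v0) orbF subr_eq0 => /eqP.
rewrite -sum1_card (partition_big mult (mem (multipliers v))) /=; last first.
  move=> g; rewrite !inE => /andP[Hg /existsP[c /eqP gv]].
  by apply/existsP; exists g; rewrite Hg (multE _ _ gv) gv eqxx.
rewrite mulnC -sum_nat_const; apply: eq_bigr => c.
rewrite inE => /existsP[g0 /andP[Hg0 /eqP g0v]].
rewrite -(card_lcoset _ g0) -sum1_card; apply: eq_bigl => g.
have c0 : c != 0.
  by apply: contraNneq v0 => c0; rewrite -(vact_eq0 g0) g0v c0 scale0r.
have g0V : vact g0^-1%g v = c^-1 *: v.
  by apply: (scalerI c0); rewrite -vactZ -g0v vactK scalerA divff ?scale1r.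
rewrite mem_lcoset !inE groupMl ?groupV //.
case Hg: (g \in H) => //=; apply/andP/eqP=> [[/existsP[d /eqP gv] /eqP gc] | E].
  by rewrite vactM gv -gc (multE _ _ gv) in g0V *; rewrite vactZ g0V scalerA
    divff ?scale1r // -(multE _ _ gv) gc.
have gv : vact g v = c *: v by rewrite -g0v -{2}E vactM vactKV.
by rewrite (multE _ _ gv) eqxx; split=> //; apply/existsP; exists c; rewrite gv.
Qed.

(** A multiplier of an anisotropic vector has square 1. *)
Lemma card_line_stab_anisotropic v : dot v v != 0 ->
  (#|line_stab v| = #|fixer v| \/ #|line_stab v| = 2 * #|fixer v|)%N.
Proof.
move=> vv; have v0 : v != 0 by apply: contraNneq vv => ->; rewrite dot0l.
rewrite card_line_stab // mulnC.
have sub : multipliers v \subset [set 1; -1].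
  apply/subsetP=> c; rewrite !inE => /existsP[g /andP[Hg /eqP gv]].
  have := dot_act v v Hg; rewrite gv !dotE mulrA => /eqP.
  rewrite -subr_eq0 -{2}[dot v v]mul1r -mulrBl mulf_eq0 (negPf vv) orbF.
  by rewrite subr_eq0 -expr2 sqrf_eq1.
have pos := card_multipliers_gt0 v.
have := subset_leq_card sub; rewrite cards2.
move=> le2; have {le2} : (#|multipliers v| <= 2)%N.
  by apply: leq_trans le2 _; case: (_ != _).
case: #|multipliers v| pos => [|[|[|n]]] // _ _; last by right.
by left; rewrite mul1n.
Qed.

(** Equality of the orbits of the lines spanned by v and w. *)
Definition same_orbit v w := exists h c, [/\ h \in H, c != 0 & w = c *: vact h v].

Lemma same_orbit_axis_class v w : same_orbit v w -> axis_class w = axis_class v.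
Proof.
have half x y : same_orbit x y -> axis_class y \subset axis_class x.
  move=> [h [c [Hh c0 ->]]]; apply/subsetP=> g /axis_classP[Hg g1 [k Hk]].
  rewrite !vactZ => /(scalerI c0) E; apply/axis_classP; split=> //.
  by exists (k * h)%g; rewrite ?groupM // vactM.
move=> vw; apply/eqP; rewrite eqEsubset half // half //.
case: vw => h [c [Hh c0 ->]]; exists h^-1%g, c^-1; split; rewrite ?groupV ?invr_eq0 //.
by rewrite vactZ vactK scalerA mulVf // scale1r.
Qed.

Lemma same_orbit_card_fixer v w : same_orbit v w -> #|fixer w| = #|fixer v|.
Proof. by move=> [h [c [Hh c0 ->]]]; rewrite fixerZ // fixer_act // cardJg. Qed.

Lemma same_orbit_dot v w : same_orbit v w -> (dot w w == 0) = (dot v v == 0).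
Proof.
move=> [h [c [Hh c0 ->]]]; rewrite !dotE dot_act //.
by rewrite !mulf_eq0 (negPf c0).
Qed.

Lemma axis_class_same_orbit v w g : v != 0 -> w != 0 -> g \in axis_class v ->
  vact g w = w -> same_orbit v w.
Proof.
move=> v0 w0 /axis_classP[Hg g1 [h Hh ghv]] gw.
have hv0 : vact h v != 0 by rewrite vact_eq0.
have [|k E] := fixer_axis hv0 _ g1 gw; first by rewrite inE Hg ghv eqxx.
exists h, k; split=> //; apply: contraNneq w0 => k0.
by rewrite E k0 scale0r.
Qed.

Lemma mem_axis_class g w : g \in H -> g != 1%g -> vact g w = w -> g \in axis_class w.
Proof. by move=> Hg g1 gw; apply/axis_classP; split=> //; exists 1%g; rewrite ?vact1. Qed.

Lemma axis_class_disjoint v w : v != 0 -> w != 0 ->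
  axis_class v != axis_class w -> [disjoint axis_class v & axis_class w].
Proof.
move=> v0 w0; apply: contraR => /pred0Pn[g /= /andP[gv gw]].
have [Hg g1 [h Hh ghw]] := axis_classP _ _ gw.
have hw0 : vact h w != 0 by rewrite vact_eq0.
rewrite -(same_orbit_axis_class (axis_class_same_orbit v0 hw0 gv ghw)); apply/eqP.
by apply: same_orbit_axis_class; exists h, 1; rewrite oner_eq0 scale1r.
Qed.

Lemma exists_axis g : g \in H -> exists2 v, v != 0 & vact g v = v.
Proof. by move/rotH/rotation_axis. Qed.

Lemma axis_fixer_neq1 g v : g \in H -> g != 1%g -> vact g v = v -> fixer v :!=: 1%g.
Proof.
move=> Hg g1 gv; apply: contra g1 => /eqP/setP/(_ g).
by rewrite !inE Hg gv eqxx /= => <-.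
Qed.

(** * Existence of an isotropic axis *)

Definition pole v := v != 0 /\ fixer v :!=: 1%g.

Lemma pole_card_fixer v : pole v -> (1 < #|fixer v|)%N.
Proof. by case=> _; rewrite -cardG_gt1. Qed.

(** The unions of axis classes, described without choosing representatives: they are
    what has been counted at each stage of the partition of H. *)
Definition saturated (U : {set GL3}) :=
  forall e g, e != 0 -> g \in U -> vact g e = e -> axis_class e \subset U.

Lemma saturated_axis_class v : v != 0 -> saturated (axis_class v).
Proof.
move=> v0 e g e0 gv ge.
by rewrite (same_orbit_axis_class (axis_class_same_orbit v0 e0 gv ge)).
Qed.

Lemma saturatedU U V : saturated U -> saturated V -> saturated (U :|: V).
Proof.
move=> sU sV e g e0; rewrite inE => /orP[gU | gV] ge.
  by rewrite subsetU // (sU e g).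
by rewrite subsetU // (sV e g) ?orbT.
Qed.

(** The step of the enumeration of classes: as long as some non-trivial element is
    missing, its axis provides a class disjoint from those already counted. *)
Lemma exists_next_pole (U : {set GL3}) : saturated U -> U \subset H^#%g ->
  #|U|.+1 = #|H| \/ exists e, pole e /\ [disjoint U & axis_class e].
Proof.
move=> satU subU; have cH : #|H| = #|H^#%g|.+1.
  by rewrite (cardsD1 1%g H) group1 add1n.
have [E | ] := eqVneq U H^#%g; first by left; rewrite cH E.
rewrite eqEsubset subU /= => /subsetPn[g]; rewrite !inE => /andP[g1 Hg] gU.
right; have [e e0 ge] := exists_axis Hg; exists e.
split; first by split; rewrite ?(axis_fixer_neq1 Hg g1 ge).
rewrite disjoint_subset; apply/subsetP=> x xU; rewrite inE.
apply: contra gU => xe; have [Hx x1 [h Hh xhe]] := axis_classP _ _ xe.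
have he0 : vact h e != 0 by rewrite vact_eq0.
have := satU _ _ he0 xU xhe; rewrite (@same_orbit_axis_class e).
  by move/subsetP; apply; apply: mem_axis_class.
by exists h, 1; rewrite oner_eq0 scale1r.
Qed.

Section Irreducible.
Hypothesis irrH : forall v, v != 0 -> line_stab v != H.

Lemma index_line_stab v : v != 0 -> (1 < #|H : line_stab v|%g)%N.
Proof.
move=> v0; rewrite indexg_gt1; apply: contra (irrH v0) => sub.
by rewrite eqEsubset line_stab_sub.
Qed.

Lemma anisotropic_count v : pole v -> dot v v != 0 -> exists j n,
  (n = #|fixer v| * j)%N /\ class_numbers #|H| #|axis_class v| j n.
Proof.
move=> pv vv; have [v0 v1] := pv; have m1 := pole_card_fixer pv.
exists #|H : line_stab v|%g, (#|fixer v| * #|H : line_stab v|%g)%N.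
split=> //; split; first exact: index_line_stab.
  by rewrite card_axis_class // mulnBl mul1n subnK // leq_pmull // ltnW.
rewrite -(Lagrange (line_stab_sub v)).
by case: (card_line_stab_anisotropic vv) => ->; [left | right; rewrite mulnA].
Qed.

Lemma fixer_expg_card v g : g \in fixer v -> (g ^+ #|fixer v| = 1)%g.
Proof. exact: expg_cardG. Qed.

Lemma prime_order_dvd_fixer l g v : prime l -> g \in H -> g != 1%g ->
  (g ^+ l = 1)%g -> vact g v = v -> (l %| #|fixer v|)%N.
Proof.
move=> pr_l Hg g1 gl gv; have Cg : g \in fixer v by rewrite inE Hg gv eqxx.
by rewrite -(nt_prime_order pr_l gl g1) (order_dvdG Cg).
Qed.

Lemma disjoint_setU (U V W : {set GL3}) : [disjoint U & W] -> [disjoint V & W] ->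
  [disjoint U :|: V & W].
Proof. by rewrite -!setI_eq0 setIUl => /eqP -> /eqP ->; rewrite setU0 eqxx. Qed.

Lemma cardsU_disjoint (U V : {set GL3}) : [disjoint U & V] ->
  #|U :|: V| = (#|U| + #|V|)%N.
Proof. by move=> dUV; rewrite cardsU disjoint_setI0 // cards0 subn0. Qed.

Lemma card_lt_group (U : {set GL3}) : U \subset H^#%g -> (#|U| < #|H|)%N.
Proof.
move/subset_leq_card=> le; rewrite (cardsD1 1%g H) group1 add1n ltnS.
exact: le.
Qed.

Lemma dvdn_gt n (m j N : nat) : N = (m * j)%N -> (n <= m)%N -> (n * j <= N)%N.
Proof. by move=> -> le; rewrite leq_mul2r le orbT. Qed.

(** The elements A and w exclude the groups of the Platonic solids: among these only
    the icosahedral group contains elements of order 5, and all its elements have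
    order 1, 2, 3 or 5. *)
Section FiveElement.
Variables A w : GL3.
Hypotheses (HA : A \in H) (A1 : A != 1%g) (A5 : (A ^+ 5 = 1)%g).
Hypotheses (Hw : w \in H) (w2 : (w ^+ 2 != 1)%g) (w3 : (w ^+ 3 != 1)%g)
  (w5 : (w ^+ 5 != 1)%g).

Lemma w_neq1 : w != 1%g.
Proof. by apply: contra w2 => /eqP ->; rewrite expg1n. Qed.

Lemma fixer_w_card e : vact w e = e -> (4 <= #|fixer e| /\ #|fixer e| <> 5)%N.
Proof.
move=> we; have Cw : w \in fixer e by rewrite inE Hw we eqxx.
have ne n : (w ^+ n != 1)%g -> #|fixer e| <> n.
  by move=> wn nE; case/eqP: wn; rewrite -nE; apply: fixer_expg_card.
have := cardG_gt0 [group of fixer e] => /=.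
have := ne 1%N w_neq1; move: (ne _ w2) (ne _ w3) (ne _ w5).
by case: #|fixer e| => [|[|[|[|[|[|n]]]]]].
Qed.

(** Otherwise every class obeys the Euclidean count.  If the axes of A and of w are
    in one orbit, the stabilizers there have order at least 10, and enumerating the
    other classes fits (2,2,m) only, against irreducibility.  If they are in
    different orbits, two stabilizers have order at least 4 and 5, and already a
    third class overflows. *)
Lemma exists_isotropic_pole : exists v, pole v /\ dot v v = 0.
Proof.
case: (pickP (fun v => (v != 0) && (fixer v != 1%g) && (dot v v == 0))) => [v|no].
  by case/andP=> /andP[v0 v1] /eqP vv; exists v.
have aniso v : pole v -> dot v v != 0.
  by case=> v0 v1; have := no v; rewrite v0 v1 /= => ->.
have poleE v : pole v -> exists j n,
    (n = #|fixer v| * j)%N /\ class_numbers #|H| #|axis_class v| j n.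
  by move=> pv; apply: anisotropic_count => //; apply: aniso.
exfalso.
have [a a0 Aa] := exists_axis HA; have [e e0 we] := exists_axis Hw.
have pa : pole a by split=> //; apply: (axis_fixer_neq1 HA A1 Aa).
have pe : pole e by split=> //; apply: (axis_fixer_neq1 Hw w_neq1 we).
have dv5 : (5 %| #|fixer a|)%N by apply: (prime_order_dvd_fixer _ HA A1).
have [me4 me5] := fixer_w_card we.
have [ja [na [Na numa]]] := poleE a pa.
have two_or_three v j n : pole v -> (n = #|fixer v| * j)%N ->
    (n = 2 * j \/ 3 * j <= n)%N.
  move=> pv Nv; have := pole_card_fixer pv; rewrite leq_eqVlt => /orP[/eqP E | m3].
    by left; rewrite Nv -E.
  by right; apply: dvdn_gt Nv m3.
have subS v := axis_class_sub v.
have satS v : pole v -> saturated (axis_class v).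
  by case=> v0 _; apply: saturated_axis_class.
have [same | diff] := eqVneq (axis_class a) (axis_class e).
  have ae : same_orbit a e.
    apply: (axis_class_same_orbit (g := w)) => //.
    by rewrite same; apply: mem_axis_class => //; apply: w_neq1.
  rewrite (same_orbit_card_fixer ae) in me4 me5.
  have le10 := dvdn_gt Na (ten_le_of_dvd5 dv5 me4 me5).
  have [full | [d [pd dad]]] := exists_next_pole (satS a pa) (subS a).
    exact: (one_class_not_full numa).
  have [jd [nd [Nd numd]]] := poleE d pd; have twod := two_or_three d _ _ pd Nd.
  have sat2 := saturatedU (satS a pa) (satS d pd).
  have sub2 : axis_class a :|: axis_class d \subset H^#%g by rewrite subUset !subS.
  have [|[c [pc dc]]] := exists_next_pole sat2 sub2.
    by rewrite cardsU_disjoint //; exact: (two_classes_not_full numa numd).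
  have [jc [nc [Nc numc]]] := poleE c pc; have twoc := two_or_three c _ _ pc Nc.
  have sat3 := saturatedU sat2 (satS c pc).
  have sub3 : axis_class a :|: axis_class d :|: axis_class c \subset H^#%g.
    by rewrite subUset sub2 subS.
  have [|[b [pb db]]] := exists_next_pole sat3 sub3.
    by rewrite 2?cardsU_disjoint //; exact: (three_classes_not_full numa numd numc).
  have [jb [nb [Nb numb]]] := poleE b pb.
  have sub4 : axis_class a :|: axis_class d :|: axis_class c :|: axis_class b \subset H^#%g.
    by rewrite subUset sub3 subS.
  have := card_lt_group sub4; rewrite 3?cardsU_disjoint // ltnNge.
  by rewrite (four_classes_overflow numa numd numc numb le10) ?(dvdn_gt Nd) ?(dvdn_gt Nc)
    ?(dvdn_gt Nb) ?pole_card_fixer.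
have dae := axis_class_disjoint a0 e0 diff.
have [je [ne [Ne nume]]] := poleE e pe.
have le5 : (5 * ja <= na)%N by apply: (dvdn_gt Na); rewrite dvdn_leq.
have le4 := dvdn_gt Ne me4.
have sat2 := saturatedU (satS a pa) (satS e pe).
have sub2 : axis_class a :|: axis_class e \subset H^#%g by rewrite subUset !subS.
have [|[c [pc dc]]] := exists_next_pole sat2 sub2.
    by rewrite cardsU_disjoint //; exact: (two_large_classes_not_full numa nume).
have [jc [nc [Nc numc]]] := poleE c pc.
have sub3 : axis_class a :|: axis_class e :|: axis_class c \subset H^#%g.
  by rewrite subUset sub2 subS.
have := card_lt_group sub3; rewrite 2?cardsU_disjoint // ltnNge.
by rewrite (three_classes_overflow numa nume numc) ?(dvdn_gt Nc) ?pole_card_fixer.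
Qed.

(** * Stabilizers of isotropic vectors *)

End FiveElement.
End Irreducible.

Lemma same_orbit_of_eq v w : v != 0 -> pole w -> axis_class v = axis_class w ->
  same_orbit v w.
Proof.
move=> v0 [w0 w1] E; case/trivgPn: w1 => g gw g1.
have := gw; rewrite inE => /andP[Hg /eqP gwE].
by apply: (axis_class_same_orbit (g := g)) => //; rewrite E; apply: mem_axis_class.
Qed.

Section IsotropicStabilizer.
Variables x z y : 'cV[F]_3.
Hypothesis fr : frame x z y.

(** The scalar that determines a rotation u fixing x: u z = z + slope u x. *)
Definition slope (u : GL3) : F := dot (vact u z) y.

Lemma line_stab_act g c : g \in H -> vact g x = c *: x ->
  c != 0 /\ vact g z = z + slope g *: x.
Proof. by move=> Hg; apply: rotation_stabilizer (rotH Hg) fr. Qed.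

Lemma fixer_act_z u : u \in fixer x -> vact u z = z + slope u *: x.
Proof.
rewrite inE => /andP[Hu /eqP ux].
by have [|_] := line_stab_act (c := 1) Hu; rewrite ?scale1r.
Qed.

Lemma slope_eq u s : vact u z = z + s *: x -> slope u = s.
Proof.
by case: fr => [[_ _ xy] [_ yz _]]; rewrite /slope => ->;
  rewrite !dotE xy (dotC z) yz mulr1 add0r.
Qed.

Lemma slopeM u u' : u \in fixer x -> u' \in fixer x ->
  slope (u * u')%g = slope u + slope u'.
Proof.
move=> Cu Cv; apply: slope_eq; rewrite vactM fixer_act_z // vactD vactZ fixer_act_z //.
by move: Cu; rewrite inE => /andP[_ /eqP ->]; rewrite scalerDl addrA.
Qed.

Lemma slope1 : slope 1%g = 0.
Proof. by apply: slope_eq; rewrite vact1 scale0r addr0. Qed.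

Lemma slopeX u n : u \in fixer x -> slope (u ^+ n)%g = slope u *+ n.
Proof.
move=> Cu; elim: n => [|n IHn]; first exact: slope1.
by rewrite expgS slopeM ?groupX // IHn mulrS.
Qed.

Lemma slope_inj : {in fixer x &, injective slope}.
Proof.
move=> u u'; rewrite !inE => /andP[Hu /eqP ux] /andP[Hv /eqP vx] E.
apply: val_inj; apply: (eq_on_col3 (frame_unit fr)).
- by rewrite [LHS]ux [RHS]vx.
- rewrite [LHS]fixer_act_z ?[RHS]fixer_act_z ?inE ?Hu ?Hv ?ux ?vx ?eqxx //.
  by rewrite E.
- rewrite [LHS](rotation_fix_isotropic (rotH Hu) fr ux).
  rewrite [RHS](rotation_fix_isotropic (rotH Hv) fr vx).
  by rewrite -/(vact u z) -/(vact u' z) -/(slope u) -/(slope u') E.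
Qed.

(** A multiplier c of x acts on the slopes as multiplication by c: this bounds the
    number of multipliers by the number of non-zero slopes. *)
Lemma slopeJ g c u : g \in H -> vact g x = c *: x -> u \in fixer x ->
  (u ^ g^-1)%g \in fixer x /\ slope (u ^ g^-1)%g = c * slope u.
Proof.
move=> Hg gx Cu; have [c0 gz] := line_stab_act Hg gx.
have Hu := subsetP (fixer_sub x) u Cu.
have ux : vact u x = x by move: Cu; rewrite inE => /andP[_ /eqP].
split.
  rewrite mem_fixerJ ?groupV // inE Hu.
  have -> : vact g^-1 x = c^-1 *: x.
    by apply: (scalerI c0); rewrite -vactZ -gx vactK scalerA divff ?scale1r.
  by rewrite vactZ ux eqxx.
apply: slope_eq; rewrite conjgE invgK mulgA !vactM.
have gVx : vact g^-1 x = c^-1 *: x.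
  by apply: (scalerI c0); rewrite -vactZ -gx vactK scalerA divff ?scale1r.
have gVz : vact g^-1 z = z - (slope g * c^-1) *: x.
  apply: (can_inj (vactK g)); rewrite vactKV vactD -scaleNr vactZ gz gx scalerA.
  by rewrite mulNr -mulrA mulVf // mulr1 scaleNr addrK.
rewrite gVz !vactD -!scaleNr !vactZ ux fixer_act_z // vactD gz !vactZ gx.
rewrite !scalerA -!addrA; congr (_ + _); rewrite -!scalerDl; congr (_ *: _).
by field.
Qed.

Variable l : nat.
Hypotheses (pr_l : prime l) (l_char : l \in [pchar F]).

Lemma fixer_expg_char u : u \in fixer x -> (u ^+ l = 1)%g.
Proof.
move=> Cu; apply: slope_inj; rewrite ?groupX ?group1 //.
by rewrite slopeX // slope1 mulrn_pchar.
Qed.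

Lemma fixer_pgroup : (l.-group (fixer x))%g.
Proof.
apply/pgroupP=> r pr_r /(Cauchy pr_r)[u Cu ur].
have := fixer_expg_char Cu; rewrite inE /= -(dvdn_prime2 pr_r pr_l) -ur.
by move=> E; rewrite order_dvdn E.
Qed.

Lemma card_fixer_le : (#|fixer x| <= #|F|)%N.
Proof. by rewrite -(card_in_imset slope_inj) max_card. Qed.

Lemma fixer_full_of_prime_field : #|F| = l -> fixer x :!=: 1%g -> #|fixer x| = #|F|.
Proof.
move=> Fl C1; apply/eqP; rewrite eqn_leq card_fixer_le Fl dvdn_leq ?cardG_gt0 //.
by have [_ ? _] := pgroup_pdiv fixer_pgroup C1.
Qed.

(** Multiplying one fixed non-zero slope by the multipliers yields distinct
    non-zero slopes. *)
Lemma card_multipliers_le : #|fixer x| = l -> (#|multipliers x| <= l.-1)%N.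
Proof.
move=> Cl; have C1 : fixer x :!=: 1%g by rewrite -cardG_gt1 Cl prime_gt1.
have [u Cu u1] := trivgPn _ C1.
have su0 : slope u != 0.
  by apply: contra u1 => /eqP E; apply/eqP/slope_inj; rewrite ?group1 // slope1.
have inj : injective (fun c => c * slope u) by apply: mulIf.
rewrite -(card_imset _ inj) -{1}Cl -(card_in_imset slope_inj).
rewrite [X in (_ <= X.-1)%N](cardsD1 0) [0 \in _](_ : _ = true) /=; last first.
  by apply/imsetP; exists 1%g; rewrite ?group1 ?slope1.
apply/subset_leq_card/subsetP=> _ /imsetP[c cm ->].
move: cm; rewrite !inE => /existsP[g /andP[Hg /eqP gx]].
have [c0 _] := line_stab_act Hg gx; rewrite mulf_neq0 //=.
by have [C E] := slopeJ Hg gx Cu; apply/imsetP; exists (u ^ g^-1)%g.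
Qed.

Lemma slope_surj : #|fixer x| = #|F| -> forall s, exists2 u, u \in fixer x & slope u = s.
Proof.
move=> full s; have : s \in slope @: fixer x.
  have /eqP -> : slope @: fixer x == setT; last by rewrite inE.
  by rewrite eqEcard subsetT cardsT (card_in_imset slope_inj) full leqnn.
by case/imsetP=> u Cu ->; exists u.
Qed.

End IsotropicStabilizer.

(** * Stabilizers of prime order *)

Lemma isotropic_perp_parallel x d : x != 0 -> dot x x = 0 -> dot d d = 0 ->
  dot x d = 0 -> exists k, d = k *: x.
Proof.
move=> x0 xx dd xd; have [z [y fr]] := frame_of_isotropic x0 xx.
have E := frame_expand d fr; exists (dot d y).
rewrite {1}E (dotC d x) xd scale0r addr0.
case: fr => [[_ _ _] [xz _ zz]]; move: dd.
rewrite {1}E (dotC d x) xd scale0r addr0 !dotE xd mulr0 add0r (dotC z d) => /eqP.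
rewrite mulf_eq0 mulf_eq0 invr_eq0 (negPf zz) orbF orbb => /eqP ->.
by rewrite mul0r scale0r addr0.
Qed.

(** The multipliers form a subgroup of the multiplicative group of the field, hence a
    cyclic group; g realizes a generator c, whose order is the number of
    multipliers. *)
Lemma multipliers_generator v : v != 0 -> exists g c,
  [/\ g \in H, vact g v = c *: v, (#|multipliers v| %| #|F|.-1)%N
    & forall n, c ^+ n = 1 -> (#|multipliers v| %| n)%N].
Proof.
move=> v0; pose M := [set u : {unit F} | FinRing.uval u \in multipliers v].
have gM : group_set M.
  apply/group_setP; split=> [|u1 u2]; rewrite !inE.
    by apply/existsP; exists 1%g; rewrite group1 vact1 scale1r eqxx.
  move=> /existsP[g1 /andP[H1 /eqP E1]] /existsP[g2 /andP[H2 /eqP E2]].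
  apply/existsP; exists (g1 * g2)%g; rewrite groupM // vactM E2 vactZ E1 scalerA.
  by rewrite mulrC eqxx.
have cM : #|M| = #|multipliers v|.
  rewrite -(card_imset _ (val_inj : injective (@FinRing.uval F))).
  apply: eq_card => c; apply/imsetP/idP=> [[u Mu ->] | cm]; first by rewrite inE in Mu.
  have := cm; rewrite inE => /existsP[g /andP[Hg /eqP gv]].
  have c0 : c \is a GRing.unit.
    rewrite unitfE; apply: contraNneq v0 => c0.
    by rewrite -(vact_eq0 g) gv c0 scale0r.
  by exists (FinRing.unit F c0) => //; rewrite [_ \in M]inE.
have /cyclicP[u Mu] := field_unit_group_cyclic (Group gM).
have : u \in M by rewrite [M]Mu cycle_id.
rewrite inE inE => /existsP[g /andP[Hg /eqP gv]].
exists g, (FinRing.uval u); split=> //.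
  by rewrite -cM -card_finField_unit; apply: (@cardSg _ [group of setT] (Group gM)); apply: subsetT.
move=> n un; rewrite -cM [M]Mu -/(order u) order_dvdn; apply/eqP/val_inj.
by rewrite FinRing.val_unitX.
Qed.

Section Subfield.
Variable l : nat.
Hypotheses (pr_l : prime l) (l_char : l \in [pchar F]).
Variable x : 'cV[F]_3.
Hypotheses (px : pole x) (xx : dot x x = 0) (cardCx : #|fixer x| = l).

(** The normalizer of the stabilizer is the stabilizer of the line, in which it has
    index at most l - 1; so it is self-normalizing in any l-group containing it. *)
Lemma fixer_order_l_Sylow : (l.-Sylow(H) (fixer x))%g.
Proof.
have [x0 x1] := px; have [z [y fr]] := frame_of_isotropic x0 xx.
have lC := fixer_pgroup fr pr_l l_char.
have [P sylP CP] := Sylow_superset (fixer_sub x) lC.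
have [sPH lP _] := and3P sylP.
suff -> : fixer x = P :> {set _} by [].
have nE : 'N_H(fixer x)%g = line_stab x.
  by have /and3P[_ _ /eqP] := fixer_TI x0 x1; rewrite normD1.
rewrite (nilpotent_sub_norm (pgroup_nil lP) CP) //.
set N := 'N_P(fixer x)%g.
have CN : fixer x \subset N by rewrite subsetI CP normG.
have lN : (l.-group N)%g by apply: pgroupS lP; apply: subsetIl.
have NH : N \subset line_stab x by rewrite -nE; apply: setSI.
have : (#|N| %| #|fixer x|)%N.
  have := cardSg NH; rewrite card_line_stab // Gauss_dvdl //.
  have [//|_ dv [n ->]] := pgroup_pdiv lN (_ : N :!=: 1%g).
    by apply: contra x1; rewrite -!subG1; apply: subset_trans.
  rewrite coprimeXl // prime_coprime //; apply/negP=> /dvdn_leq.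
  move/(_ (card_multipliers_gt0 x)); rewrite leqNgt; case/negP.
  by apply: leq_ltn_trans (card_multipliers_le fr pr_l cardCx) _; rewrite prednK ?prime_gt0.
move/dvdn_leq => /(_ (cardG_gt0 _)) le.
by have /eqP <- : fixer x == N :> {set _}; rewrite ?eqEcard ?CN.
Qed.

(** Both stabilizers are l-groups, and the one of x is a Sylow subgroup. *)
Lemma isotropic_poles_conjugate v : pole v -> dot v v = 0 -> axis_class v = axis_class x.
Proof.
move=> pv vv; have [v0 v1] := pv; have [z [y fr]] := frame_of_isotropic v0 vv.
have [x0 _] := px.
have [h Hh sub] := Sylow_subJ fixer_order_l_Sylow (fixer_sub v)
  (fixer_pgroup fr pr_l l_char).
have [g gv g1] := trivgPn _ v1.
have Hg := subsetP (fixer_sub v) g gv.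
have := subsetP sub g gv; rewrite -{1}[h]invgK -fixer_act ?groupV // inE Hg /= => /eqP gx.
move: gv; rewrite inE Hg => /eqP gv.
have gsx : g \in axis_class x by apply/axis_classP; split=> //; exists h^-1%g; rewrite ?groupV.
exact: same_orbit_axis_class (axis_class_same_orbit x0 v0 gsx gv).
Qed.

(** This index is the number of Sylow subgroups. *)
Lemma index_line_stab_mod : #|H : line_stab x|%g = 1 %[mod l].
Proof.
have [x0 x1] := px; have syl := fixer_order_l_Sylow.
have /and3P[_ _ /eqP] := fixer_TI x0 x1; rewrite normD1 => <-.
by rewrite -(card_Syl syl) card_Syl_mod // modn_small // prime_gt1.
Qed.
End Subfield.

(** * Excluding groups over the prime field *)

Section SubfieldExclusion.
Hypothesis irrH : forall v, v != 0 -> line_stab v != H.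
Variables A w : GL3.
Hypotheses (HA : A \in H) (A1 : A != 1%g) (A5 : (A ^+ 5 = 1)%g).
Hypotheses (Hw : w \in H) (w2 : (w ^+ 2 != 1)%g) (w3 : (w ^+ 3 != 1)%g)
  (w5 : (w ^+ 5 != 1)%g).
Variable l : nat.
Hypotheses (pr_l : prime l) (l_char : l \in [pchar F]) (cardF : #|F| = (l ^ 2)%N)
  (l5 : (5 %| l ^ 2 + 1)%N).

Lemma char_gt2 : (2 < l)%N.
Proof.
rewrite ltn_neqAle prime_gt1 // andbT; apply: contraNneq F2 => E.
by move: l_char; rewrite -E inE => /andP[_].
Qed.

(** An element g realizing a generating multiplier of x is semisimple: its axis d is
    orthogonal to x and anisotropic.  Conversely every rotation about d preserves
    the line of x and is determined by its multiplier there. *)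
Lemma split_torus x : pole x -> dot x x = 0 -> (1 < #|multipliers x|)%N ->
  exists d, [/\ pole d, dot d d != 0, #|fixer d| = #|multipliers x|
    & (#|multipliers x| %| #|F|.-1)%N].
Proof.
move=> [x0 x1] xx k1; have [g [c [Hg gx k_dv c_ord]]] := multipliers_generator x0.
have c1 : c != 1.
  by apply: contraTneq k1 => c1; have := c_ord 1%N; rewrite c1 dvdn1 => /(_ erefl)/eqP ->.
have g1 : g != 1%g.
  apply: contra c1 => /eqP E; move: gx; rewrite E vact1 => /eqP.
  by rewrite -{1}[x]scale1r -subr_eq0 -scalerBl scaler_eq0 (negPf x0) orbF subr_eq0 eq_sym.
have [d d0 gd] := exists_axis Hg.
have Cg : g \in fixer d by rewrite inE Hg gd eqxx.
have xd : dot x d = 0.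
  have := dot_act x d Hg; rewrite gx gd !dotE => /eqP.
  by rewrite -subr_eq0 -{2}[dot x d]mul1r -mulrBl mulf_eq0 subr_eq0 (negPf c1) => /eqP.
have dd : dot d d != 0.
  apply: contra c1 => /eqP dd; have [k dE] := isotropic_perp_parallel x0 xx dd xd.
  have k0 : k != 0 by apply: contraNneq d0 => k0; rewrite dE k0 scale0r.
  move: gd; rewrite dE vactZ gx => /(scalerI k0)/eqP.
  by rewrite -subr_eq0 -{2}[x]scale1r -scalerBl scaler_eq0 (negPf x0) orbF subr_eq0.
exists d; split=> //; first by split=> //; apply: axis_fixer_neq1 Hg g1 gd.
apply/eqP; rewrite eqn_leq; apply/andP; split; last first.
  rewrite dvdn_leq ?cardG_gt0 //; apply: dvdn_trans (order_dvdG Cg).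
  apply: c_ord; have := expg_order g; move: #[g]%g => n gn.
  have E : vact (g ^+ n)%g x = c ^+ n *: x.
    elim: n {gn} => [|n IHn]; first by rewrite vact1 expr0 scale1r.
    by rewrite expgS vactM IHn vactZ gx scalerA exprSr.
  move: E; rewrite gn vact1 => /eqP.
  by rewrite -{1}[x]scale1r -subr_eq0 -scalerBl scaler_eq0 (negPf x0) orbF subr_eq0
    => /eqP.
have [y fr] := frame_of_perp x0 xx xd dd.
have multE u : u \in fixer d -> vact u x = dot (vact u x) y *: x.
  rewrite inE => /andP[Hu /eqP ud].
  have [k uE] := rotation_perp_axis (rotH Hu) ud dd x0 xx xd.
  rewrite -/(vact u x) in uE; rewrite uE !dotE; congr (_ *: _).
  by case: fr => [[_ _ ->] _]; rewrite mulr1.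
have inj : {in fixer d &, injective (fun u => dot (vact u x) y)}.
  move=> u1 u2 C1 C2 E; apply/eqP; rewrite eq_mulgV1; apply/negPn/negP=> u3.
  have C3 : (u1 * u2^-1)%g \in fixer d by rewrite groupM ?groupV.
  have fixE : vact (u1 * u2^-1)%g (vact u2 x) = vact u2 x.
    by rewrite vactM vactK (multE _ C1) (multE _ C2) E.
  have u2x0 : vact u2 x != 0 by rewrite vact_eq0.
  have [k E2] := fixer_axis d0 C3 u3 fixE.
  case/eqP: dd; have H2 := subsetP (fixer_sub d) _ C2.
  have k0 : k != 0 by apply: contraNneq u2x0 => k0; rewrite E2 k0 scale0r.
  have := dot_act x x H2; rewrite E2 !dotE xx => /eqP.
  by rewrite !mulf_eq0 (negPf k0) => /eqP.
rewrite -(card_in_imset inj); apply/subset_leq_card/subsetP=> _ /imsetP[u Cu ->].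
rewrite inE; apply/existsP; exists u; rewrite (subsetP (fixer_sub d)) //=.
by rewrite -multE.
Qed.

(** Count the classes of x, of the axis a of A, and of the torus axis d when x has
    more than one multiplier.  The axis a is anisotropic because l is not 5, and is
    not conjugate to d because 5 does not divide the order of the torus, which
    divides l^2 - 1.  Since all isotropic axes are
    conjugate to x, a fourth class would be anisotropic, and it would overflow.  If
    the three classes exhaust H, then l = 3 and the stabilizers have orders 3, 2
    and 5, which leaves no room for the axis of w. *)
Lemma not_order_l x : pole x -> dot x x = 0 -> #|fixer x| <> l.
Proof.
move=> px xx cardCx; have [x0 x1] := px; have l2 := char_gt2.
have [z [y fr]] := frame_of_isotropic x0 xx.
set k := #|multipliers x|; set j := #|H : line_stab x|%g.
have hx : (#|H| = l * k * j)%N.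
  by rewrite -(Lagrange (line_stab_sub x)) card_line_stab // cardCx.
have sx : (#|axis_class x| + j = l * j)%N.
  by rewrite card_axis_class // cardCx mulnBl mul1n subnK // leq_pmull // prime_gt0.
have j1 : (1 < j)%N by apply: index_line_stab.
have [a a0 Aa] := exists_axis HA.
have pa : pole a by split=> //; apply: axis_fixer_neq1 HA A1 Aa.
have dv5 : (5 %| #|fixer a|)%N by apply: (prime_order_dvd_fixer _ HA A1).
have aa : dot a a != 0.
  apply/eqP=> aa; have [za [ya fra]] := frame_of_isotropic a0 aa.
  have [_ _ [n cE]] := pgroup_pdiv (fixer_pgroup fra pr_l l_char) (proj2 pa).
  move: dv5; rewrite cE Euclid_dvdX // dvdn_prime2 // andbT => /eqP E.
  by move: l5; rewrite -E.
have [ja [na [Na numa]]] := anisotropic_count irrH pa aa.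
have ja5 : (5 * ja <= na)%N by apply: (dvdn_gt Na); rewrite dvdn_leq.
have dxa : [disjoint axis_class x & axis_class a].
  apply: axis_class_disjoint => //; apply: contraNneq aa => E.
  by rewrite (same_orbit_dot (same_orbit_of_eq x0 pa E)) xx.
have subS v := axis_class_sub v.
have sub2 : axis_class x :|: axis_class a \subset H^#%g by rewrite subUset !subS.
have k0 : (0 < k)%N := card_multipliers_gt0 x.
have [k1 | k1] := leqP k 1.
  have kE : k = 1%N by apply/eqP; rewrite eqn_leq k1 k0.
  have := card_lt_group sub2; rewrite cardsU_disjoint // ltnNge.
  by rewrite (trivial_torus_overflow l2 j1 sx hx numa ja5 kE).
have [d [pd dd cd k_dv]] := split_torus px xx k1.
have [d0 d1] := pd; have [jd [nd [Nd numd]]] := anisotropic_count irrH pd dd.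
rewrite cd -/k in Nd.
have k5 : ~~ (5 %| k)%N.
  apply/negP=> k5; have : (5 %| l ^ 2 - 1)%N.
    by rewrite subn1 -cardF; apply: dvdn_trans k_dv.
  move: l5; have : (0 < l ^ 2)%N by rewrite expn_gt0 prime_gt0.
  by move: (l ^ 2)%N => L; clear; lia.
have dxd : [disjoint axis_class x & axis_class d].
  apply: axis_class_disjoint => //; apply: contraNneq dd => E.
  by rewrite (same_orbit_dot (same_orbit_of_eq x0 pd E)) xx.
have dda : [disjoint axis_class d & axis_class a].
  apply: axis_class_disjoint => //; apply: contraNneq k5 => E.
  by rewrite -[k]cd -(same_orbit_card_fixer (same_orbit_of_eq d0 pa E)).
have dxda := disjoint_setU dxa dda.
have sub3 : axis_class x :|: axis_class d :|: axis_class a \subset H^#%g.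
  by rewrite !subUset !subS.
have card3 : #|axis_class x :|: axis_class d :|: axis_class a| =
    (#|axis_class x| + #|axis_class d| + #|axis_class a|)%N.
  by rewrite !cardsU_disjoint.
have := card_lt_group sub3; rewrite card3 ltnNge.
case: (torus_classes l2 j1 sx hx numa ja5 k1 numd Nd) => [-> // | ].
case=> [[full E2 E3] | [lt over]] _.
  have kl : (k < l)%N.
    by apply: leq_ltn_trans (card_multipliers_le fr pr_l cardCx) _;
      rewrite prednK ?prime_gt0.
  have jl : j = 1 %[mod l] by apply: index_line_stab_mod.
  have E4 : (l * k * j = 2 * (#|fixer a| * ja))%N by rewrite -hx E2 Na.
  have [lE kE mE] := unipotent_diophantine pr_l l2 j1 jl kl k0 E4 E3 dv5 l5.
  have [e e0 we] := exists_axis Hw.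
  have w1 := w_neq1 w2.
  have pe : pole e by split=> //; apply: axis_fixer_neq1 Hw w1 we.
  have [me4 me5] := fixer_w_card Hw w2 w3 w5 we.
  have ee : dot e e != 0.
    apply: contra w3 => /eqP ee; have [ze [ye fre]] := frame_of_isotropic e0 ee.
    have wl : (w ^+ l == 1)%g.
      by rewrite (fixer_expg_char fre l_char) // inE Hw we eqxx.
    by rewrite lE in wl.
  have dxe : [disjoint axis_class x & axis_class e].
    apply: axis_class_disjoint => //; apply: contraNneq ee => E.
    by rewrite (same_orbit_dot (same_orbit_of_eq x0 pe E)) xx.
  have dde : [disjoint axis_class d & axis_class e].
    apply: axis_class_disjoint => //; apply/eqP=> E.
    by move: me4; rewrite (same_orbit_card_fixer (same_orbit_of_eq d0 pe E)) cd -/k kE.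
  have dae : [disjoint axis_class a & axis_class e].
    apply: axis_class_disjoint => //; apply/eqP=> E; apply: me5.
    by rewrite (same_orbit_card_fixer (same_orbit_of_eq a0 pe E)).
  have dU := disjoint_setU (disjoint_setU dxe dde) dae.
  have sub4 : axis_class x :|: axis_class d :|: axis_class a :|: axis_class e \subset H^#%g.
    by rewrite !subUset !subS.
  have := card_lt_group sub4; rewrite cardsU_disjoint // card3.
  rewrite -full ltnS -[leqRHS]addn0 leq_add2l leqn0 cards_eq0 => /eqP/setP/(_ w).
  by rewrite inE mem_axis_class.
have sat3 : saturated (axis_class x :|: axis_class d :|: axis_class a).
  by do 2?[apply: saturatedU]; apply: saturated_axis_class.
have [|[b [pb db]]] := exists_next_pole sat3 sub3.
  by rewrite card3 => E; rewrite E ltnn in lt.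
have bb : dot b b != 0.
  apply/eqP=> bb; have E := isotropic_poles_conjugate pr_l l_char px xx cardCx pb bb.
  move: db; rewrite E -setI_eq0 => /eqP/setP; have [b0 b1] := pb.
  case/trivgPn: x1 => g gx g1 /(_ g); have Hg := subsetP (fixer_sub x) g gx.
  have gsx : g \in axis_class x.
    by apply: mem_axis_class => //; move: gx; rewrite inE => /andP[_ /eqP].
  by rewrite !inE gsx.
have [jb [nb [Nb numb]]] := anisotropic_count irrH pb bb.
have sub4 : axis_class x :|: axis_class d :|: axis_class a :|: axis_class b \subset H^#%g.
  by rewrite !subUset !subS.
have := card_lt_group sub4; rewrite cardsU_disjoint // card3 ltnNge.
by rewrite (over _ _ _ numb) // (dvdn_gt Nb) // pole_card_fixer.
Qed.

(** The order of the stabilizer is a power of l between l and l^2. *)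
Lemma exists_full_pole_of_square_field : exists v,
  [/\ pole v, dot v v = 0 & #|fixer v| = #|F|].
Proof.
have [x [px xx]] := exists_isotropic_pole irrH HA A1 A5 Hw w2 w3 w5.
exists x; split=> //; have [x0 x1] := px.
have [z [y fr]] := frame_of_isotropic x0 xx.
have [_ _ [n cE]] := pgroup_pdiv (fixer_pgroup fr pr_l l_char) x1.
have := card_fixer_le fr; rewrite cE cardF leq_exp2l ?prime_gt1 //.
case: n cE => [|[|n]] // cE _.
by case: (not_order_l px xx); rewrite [LHS]cE expn1.
Qed.
End SubfieldExclusion.

(** * Transitivity on vectors of equal norm *)

Section Transitivity.
Variables x z y : 'cV[F]_3.
Hypothesis fr : frame x z y.

Definition frame_vec (al ga be : F) : 'cV[F]_3 :=
  al *: x + (ga / dot z z) *: z + be *: y.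

Lemma frame_vecE al ga be : [/\ dot (frame_vec al ga be) x = be,
  dot (frame_vec al ga be) z = ga, dot (frame_vec al ga be) y = al
  & dot (frame_vec al ga be) (frame_vec al ga be) = 2 * (al * be) + ga ^+ 2 / dot z z].
Proof.
case: fr => [[xx yy xy] [xz yz zz]]; rewrite /frame_vec !dotE xx yy xz yz xy.
rewrite (dotC y x) (dotC z x) (dotC z y) xy xz yz.
by split; field.
Qed.

Lemma frame_norm v :
  dot v v = 2 * (dot v y * dot v x) + dot v z ^+ 2 / dot z z.
Proof.
rewrite {1 2}(frame_expand v fr).
by have [_ _ _] := frame_vecE (dot v y) (dot v z) (dot v x).
Qed.

Definition conjugate_vec v v' := exists2 g, g \in H & vact g v = v'.

Lemma conjugate_vec_trans v v' v'' :
  conjugate_vec v v' -> conjugate_vec v' v'' -> conjugate_vec v v''.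
Proof.
move=> [g Hg <-] [h Hh <-]; exists (h * g)%g; first exact: groupM.
by rewrite vactM.
Qed.

Lemma conjugate_vec_sym v v' : conjugate_vec v v' -> conjugate_vec v' v.
Proof. by move=> [g Hg <-]; exists g^-1%g; rewrite ?groupV ?vactK. Qed.

Hypothesis full_x : #|fixer x| = #|F|.

(** A full stabilizer of x contains the element that corrects the z-coordinate; the
    norm and the pairing with x then determine the third coordinate. *)
Lemma conjugate_same_height v v' : dot v v = dot v' v' -> dot v x = dot v' x ->
  dot v x != 0 -> conjugate_vec v v'.
Proof.
move=> nE xE x0; have [u Cu sE] := slope_surj fr full_x ((dot v' z - dot v z) / dot v x).
have Hu := subsetP (fixer_sub x) u Cu.
have uz := fixer_act_z fr Cu; rewrite sE in uz.
have ux : vact u x = x by move: Cu; rewrite inE => /andP[_ /eqP].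
have dotV a b : dot (vact u^-1%g a) b = dot a (vact u b).
  by rewrite -(dot_act _ _ Hu) vactKV.
exists u^-1%g; first by rewrite groupV.
have wx : dot (vact u^-1%g v) x = dot v' x by rewrite dotV ux.
have wz : dot (vact u^-1%g v) z = dot v' z.
  by rewrite dotV uz !dotE divfK // addrC subrK.
have wy : dot (vact u^-1%g v) y = dot v' y.
  have : dot (vact u^-1%g v) (vact u^-1%g v) = dot v' v' by rewrite dot_act ?groupV.
  rewrite (frame_norm (vact _ v)) (frame_norm v') wx wz => /addIr/(mulfI F2)/mulIf; apply.
  by rewrite -xE.
by rewrite (frame_expand (vact u^-1%g v) fr) wx wy wz -frame_expand.
Qed.
End Transitivity.

(** On the vectors orthogonal to y the stabilizer of y changes the last coordinate
    freely, which treats the vectors excluded when the previous lemma is applied to y. *)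
Lemma conjugate_shift x z y ga be be' : frame x z y -> #|fixer y| = #|F| ->
  ga != 0 -> conjugate_vec (frame_vec x z y 0 ga be) (frame_vec x z y 0 ga be').
Proof.
move=> fr full_y ga0; have fr' := frame_sym fr.
have zz : dot z z != 0 by case: fr => _ [].
have [u Cu sE] := slope_surj fr' full_y ((be' - be) * dot z z / ga).
have Hu := subsetP (fixer_sub y) u Cu.
have uz := fixer_act_z fr' Cu; rewrite sE in uz.
have uy : vact u y = y by move: Cu; rewrite inE => /andP[_ /eqP].
exists u => //; rewrite /frame_vec !scale0r !add0r vactD !vactZ uz uy scalerDr.
rewrite scalerA -addrA -scalerDl; congr (_ + _ *: _).
by field; rewrite zz ga0.
Qed.

Lemma card_squares : (#|F| < 2 * #|[set c ^+ 2 | c : F]|)%N.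
Proof.
set Sq := [set c ^+ 2 | c : F].
have S0 : 0 \in Sq by apply/imsetP; exists 0; rewrite ?expr0n.
have -> : #|F| = (\sum_(s in Sq) #|[set c : F | c ^+ 2 == s]|)%N.
  rewrite -[#|F|]sum1_card (partition_big (fun c : F => c ^+ 2) (mem Sq)) /=.
    by apply: eq_bigr => s _; rewrite sum1dep_card; apply: eq_card => c; rewrite !inE.
  by move=> c _; apply/imsetP; exists c.
rewrite (bigD1 0) //= [#|[set _ | _]|](_ : _ = 1%N); last first.
  by apply/eqP/cards1P; exists 0; apply/setP=> c; rewrite !inE sqrf_eq0.
have : (\sum_(s in Sq | s != 0%R) #|[set c : F | (c ^+ 2 == s)%R]|
    <= \sum_(s in Sq | s != 0%R) 2)%N.
  apply: leq_sum => s /andP[/imsetP[c _ ->] _].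
  apply: leq_trans (_ : #|[set c; (- c)%R]| <= 2)%N; last by rewrite cards2; case: (_ != _).
  by apply/subset_leq_card/subsetP=> d; rewrite !inE eqf_sqr.
rewrite sum_nat_const => le.
have -> : #|Sq| = #|[pred s in Sq | s != 0]|.+1.
  rewrite (cardD1 0) S0 add1n; congr _.+1.
  by apply: eq_card => s; rewrite !inE andbC.
by move: le; rewrite mulnC; set a := #|_|; set b := (\sum_(i in _ | _) _)%N; lia.
Qed.

Lemma squares_meet (A1 A2 : {set F}) : (#|F| < #|A1| + #|A2|)%N ->
  exists2 c, c \in A1 & c \in A2.
Proof.
move=> lt; case: (set_0Vmem (A1 :&: A2)) => [E | [c /setIP[c1 c2]]]; last by exists c.
by move: lt; rewrite ltnNge -cardsUI E cards0 addn0 max_card.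
Qed.

(** The values of al allowed by the first equation, and those allowed by the second
    one, are affine images of the set of squares, which has more than |F| / 2
    elements; so two such images meet. *)
Lemma common_height (n d be be' : F) : d != 0 -> be != 0 -> be' != 0 ->
  exists al ga ga', n = 2 * (al * be) + ga ^+ 2 / d /\ n = 2 * (al * be') + ga' ^+ 2 / d.
Proof.
move=> d0 b0 b0'; pose Sq := [set c ^+ 2 | c : F].
pose f b := fun s : F => (n - s / d) / (2 * b).
have f_inj b : b != 0 -> injective (f b).
  move=> bn0 s t; have i0 : (2 * b)^-1 != 0 by rewrite invr_eq0 mulf_neq0.
  have d0' : d^-1 != 0 by rewrite invr_eq0.
  by rewrite /f => /(mulIf i0)/addrI/oppr_inj/(mulIf d0').
have [|al /imsetP[_ /imsetP[ga _ ->] E] /imsetP[_ /imsetP[ga' _ ->] E']] :=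
    @squares_meet (f be @: Sq) (f be' @: Sq).
  by rewrite (card_imset _ (f_inj _ b0)) (card_imset _ (f_inj _ b0')) addnn -mul2n card_squares.
exists al, ga, ga'; split; [rewrite E | rewrite E']; rewrite /f; field.
  by rewrite d0 F2 b0.
by rewrite d0 F2 b0'.
Qed.

(** First move both vectors off the plane orthogonal to x.  The stabilizer of x
    then brings them to vectors with the same pairing al with y, and the stabilizer
    of y identifies these if al is not zero.  If al = 0, the z-coordinates agree up
    to sign, and shifting along y makes the pairings with x agree. *)
Lemma full_transitive x z y v v' : frame x z y ->
  #|fixer x| = #|F| -> #|fixer y| = #|F| ->
  dot v v = dot v' v' -> dot v v != 0 -> conjugate_vec v v'.
Proof.
move=> fr full_x full_y; have fr' := frame_sym fr.
have zz : dot z z != 0 by case: fr => _ [].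
have rise u : dot u u != 0 -> exists2 u1, conjugate_vec u u1 & dot u1 x != 0.
  move=> n0; have [ux0 | ?] := eqVneq (dot u x) 0; last first.
    by exists u => //; exists 1%g; rewrite ?vact1.
  have [uy0 | uy] := eqVneq (dot u y) 0; last first.
    have [ex _ ey en] := frame_vecE fr (dot u y) 0 (dot u u / (2 * dot u y)).
    exists (frame_vec x z y (dot u y) 0 (dot u u / (2 * dot u y))).
      by apply: (conjugate_same_height fr' full_y); rewrite ?ey // en; field; rewrite zz F2 uy.
    by rewrite ex mulf_neq0 // invr_eq0 mulf_neq0.
  have uz : dot u z != 0.
    apply: contraNneq n0 => uz.
    by rewrite (frame_norm fr) ux0 uy0 uz expr0n /= !(mul0r, mulr0, addr0).
  exists (frame_vec x z y 0 (dot u z) 1); last first.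
    by have [-> _ _ _] := frame_vecE fr 0 (dot u z) 1; apply: oner_neq0.
  rewrite {1}(frame_expand u fr) uy0 ux0; exact: conjugate_shift.
move=> nE n0; have [v1 c1 x1] := rise v n0.
have [|v1' c1' x1'] := rise v'; first by rewrite -nE.
have norm_conj a b : conjugate_vec a b -> dot b b = dot a a.
  by move=> [g Hg <-]; rewrite dot_act.
suff mid : conjugate_vec v1 v1'.
  by apply: conjugate_vec_trans c1 (conjugate_vec_trans mid (conjugate_vec_sym c1')).
have {c1}n1 := norm_conj _ _ c1; have {c1'}n1' := norm_conj _ _ c1'.
rewrite -nE in n1'.
have [al [ga [ga' [E E']]]] := common_height (dot v v) zz x1 x1'.
have [fx _ fy fn] := frame_vecE fr al ga (dot v1 x).
have [fx' _ fy' fn'] := frame_vecE fr al ga' (dot v1' x).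
have l1 : conjugate_vec v1 (frame_vec x z y al ga (dot v1 x)).
  by apply: (conjugate_same_height fr full_x); rewrite ?fx // n1 fn.
have l1' : conjugate_vec v1' (frame_vec x z y al ga' (dot v1' x)).
  by apply: (conjugate_same_height fr full_x); rewrite ?fx' // n1' fn'.
apply: conjugate_vec_trans l1 (conjugate_vec_trans _ (conjugate_vec_sym l1')).
have [al0 | al0] := eqVneq al 0; last first.
  by apply: (conjugate_same_height fr' full_y); rewrite ?fy ?fy' // fn fn' -E -E'.
move: E E'; rewrite al0 !mul0r mulr0 !add0r => E E'.
have ga0 : ga != 0 by apply: contraNneq n0 => g0; rewrite E g0 expr0n mul0r.
have : (ga == ga') || (ga == - ga').
  by rewrite -eqf_sqr; apply/eqP/(mulIf (_ : (dot z z)^-1 != 0)); rewrite ?invr_eq0 // -E.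
case/orP=> /eqP gE; first by rewrite -gE; apply: conjugate_shift.
pose m := frame_vec x z y 0 ga (dot v1' x).
apply: (conjugate_vec_trans (v' := m)); first exact: conjugate_shift.
have [mx _ _ mn] := frame_vecE fr 0 ga (dot v1' x).
rewrite al0 mul0r mulr0 add0r in fn' mn.
rewrite al0 in fx'.
by apply: (conjugate_same_height fr full_x); rewrite ?mx ?fx' // mn fn' add0r -E -E'.
Qed.

(** By irreducibility some g in H moves the line of v; its image spans with v a
    hyperbolic plane, and its stabilizer is conjugate to that of v. *)
Lemma full_pole_pair v : (forall v, v != 0 -> line_stab v != H) ->
  pole v -> dot v v = 0 -> #|fixer v| = #|F| ->
  exists x z y, [/\ frame x z y, #|fixer x| = #|F| & #|fixer y| = #|F|].
Proof.
move=> irr [v0 v1] vv full.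
have : ~~ (H \subset line_stab v).
  by apply: contra (irr v v0) => sub; rewrite eqEsubset line_stab_sub.
case/subsetPn=> g Hg; rewrite inE Hg negb_exists => /forallP gv.
pose b := dot v (vact g v).
have b0 : b != 0.
  have gvv : dot (vact g v) (vact g v) = 0 by rewrite dot_act.
  apply/eqP=> b0; have [k E] := isotropic_perp_parallel v0 vv gvv b0.
  by have := gv k; rewrite E eqxx.
have hyp : hyperbolic v (b^-1 *: vact g v).
  by split=> //; rewrite !dotE ?dot_act // ?vv ?mulr0 // mulVf.
have [z fr] := frame_of_hyperbolic hyp; exists v, z, (b^-1 *: vact g v); split=> //.
by rewrite fixerZ ?invr_eq0 // fixer_act // cardJg.
Qed.

Lemma full_pole_transitive v : (forall v, v != 0 -> line_stab v != H) ->
  pole v -> dot v v = 0 -> #|fixer v| = #|F| ->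
  forall u u', dot u u = dot u' u' -> dot u u != 0 -> conjugate_vec u u'.
Proof.
move=> irr pv vv full u u'; have [x [z [y [fr fx fy]]]] := full_pole_pair irr pv vv full.
exact: full_transitive fr fx fy.
Qed.

End RotationGroup.

(** * Groups generated by reflections *)

Lemma reflectionP v (r : GL3) : reflect
  (forall x, vact r x = x - (2 * dot x v / dot v v) *: v) (is_reflection B v r).
Proof.
apply: (iffP forallP) => [E x | E x]; first exact: (eqP (E x)).
by apply/eqP; exact: E.
Qed.

Lemma reflection_unique v (r r' : GL3) :
  is_reflection B v r -> is_reflection B v r' -> r = r'.
Proof.
move=> /reflectionP E /reflectionP E'; apply: vact_inj => x.
by rewrite E E'.
Qed.

Lemma reflection_isometry v (r : GL3) : dot v v != 0 -> is_reflection B v r ->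
  isometry (mx_of r).
Proof.
move=> vv /reflectionP E x y; rewrite -/(vact r x) -/(vact r y) !E !dotE (dotC v y).
by field.
Qed.

Lemma reflectionZ k v (r : GL3) : k != 0 -> is_reflection B v r ->
  is_reflection B (k *: v) r.
Proof.
move=> k0 /reflectionP E; apply/reflectionP => x; rewrite E; congr (_ - _).
have [vv | vv] := eqVneq (dot v v) 0.
  by rewrite !dotE vv !mulr0 invr0 !mulr0 !scale0r.
by rewrite !dotE scalerA; congr (_ *: _); field; rewrite vv k0.
Qed.

Lemma reflectionJ g v (r r' : GL3) : isometry (mx_of g) -> is_reflection B v r ->
  (forall x, vact r' x = vact g (vact r (vact g^-1%g x))) ->
  is_reflection B (vact g v) r'.
Proof.
move=> isog /reflectionP E E'; apply/reflectionP => x; rewrite E' E.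
rewrite vactD -scaleNr vactZ vactKV scaleNr.
have isog' a b : dot (vact g a) (vact g b) = dot a b by apply: isog.
by rewrite isog' -[dot (vact _ x) v]isog' vactKV.
Qed.

(** The reflection has to be constructed as an element of the general linear group,
    hence with its inverse, which is itself. *)
Lemma exists_reflection v : dot v v != 0 -> exists r : GL3, is_reflection B v r.
Proof.
move=> vv; pose M := 1%:M - (2 / dot v v) *: (v *m v^T *m B).
have ME x : M *m x = x - (2 * dot x v / dot v v) *: v.
  rewrite mulmxBl mul1mx -scalemxAl -!mulmxA (mulmxA _ B) [v^T *m B *m x]mx11_scalar.
  rewrite -/(dot v x) mul_mx_scalar scalerA (dotC v); congr (_ - _ *: _).
  by rewrite mulrAC.
have MM : M *m M = 1%:M.
  apply/matrixP=> i j; have : M *m (M *m delta_mx j 0) = delta_mx j 0 :> 'cV[F]_3.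
    rewrite !ME !dotE -addrA -opprD -scalerDl.
    set s := (X in X *: v); have -> : s = 0 by rewrite /s; field.
    by rewrite scale0r subr0.
  rewrite mulmxA -{1}[delta_mx j 0 in RHS]mul1mx -!colE => /colP/(_ i).
  by rewrite !mxE.
have UM : M \is a GRing.unit by have [] := mulmx1_unit MM.
by exists (FinRing.unit 'M[F]_3 UM); apply/reflectionP; apply: ME.
Qed.

Lemma anisotropic_perp a : dot a a != 0 -> exists2 y, dot y y != 0 & dot y a = 0.
Proof.
move=> aa; have [z z0 [za _]] := exists_perp2 a a.
have [zz | zz] := eqVneq (dot z z) 0; last by exists z.
have [t0 zt0] := exists_dot_neq0 z0; pose t := t0 - (dot t0 a / dot a a) *: a.
have ta : dot t a = 0 by rewrite /t !dotE; field.
have zt : dot z t != 0 by rewrite /t !dotE za mulr0 subr0.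
clearbody t.
have [tt | tt] := eqVneq (dot t t) 0; last by exists t.
exists (z + t); last by rewrite !dotE za ta addr0.
rewrite !dotE zz tt (dotC t z) add0r addr0.
have -> : dot z t + dot z t = 2 * dot z t by ring.
by rewrite mulf_neq0.
Qed.

Lemma O3P (h : GL3) : reflect (isometry (mx_of h)) (h \in O3 B).
Proof.
rewrite in_set; apply: (iffP forallP) => [E x y | E x].
  exact: eqP (forallP (E x) y).
by apply/forallP=> y; apply/eqP; exact: E.
Qed.

(** The theorem of Cartan and Dieudonne in dimension 3, and the
    recognition of the two orthogonal groups by their reflections. *)
Section ReflectionGroup.
Variable G : {group GL3}.
Hypothesis isoG : forall g : GL3, g \in G -> isometry (mx_of g).

Definition has_reflection v := forall r : GL3, is_reflection B v r -> r \in G.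

Lemma isometry_act (h : GL3) : isometry (mx_of h) ->
  forall v w, dot (vact h v) (vact h w) = dot v w.
Proof. by move=> iso v w; apply: iso. Qed.

(** The vectors y - h y and y + h y are orthogonal and have norms adding up to 4 times
    that of y, so one of them is anisotropic.  The reflection in the first one maps
    h y to y, the reflection in the second one maps h y to - y, which
    the reflection in y corrects. *)
Lemma move_fixing (h : GL3) a y : isometry (mx_of h) ->
  (forall v, dot v v != 0 -> has_reflection v) ->
  vact h a = a -> dot y y != 0 -> dot y a = 0 ->
  exists2 g, g \in G & vact g a = a /\ vact g (vact h y) = y.
Proof.
move=> isoh allr ha yy ya; have [y' y'E] : exists y', y' = vact h y by exists (vact h y).
rewrite -y'E.
have y'a : dot y' a = 0 by rewrite y'E -ha isometry_act.
have y'y' : dot y' y' = dot y y by rewrite y'E isometry_act.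
have fixa r v : is_reflection B v r -> dot v a = 0 -> vact r a = a.
  by move=> /reflectionP -> va; rewrite (dotC a) va mulr0 mul0r scale0r subr0.
have [E | ne] := eqVneq (dot (y - y') (y - y')) 0; last first.
  have [r rv] := exists_reflection ne; exists r; first exact: allr ne _ rv.
  split; first by apply: fixa rv _; rewrite !dotE ya y'a subrr.
  move/reflectionP: rv => ->; set s := _ / _; have -> : s = -1.
    rewrite /s; apply: (mulIf ne); rewrite divfK // !dotE y'y' (dotC y' y); ring.
  by rewrite scaleN1r opprK addrC subrK.
have ne : dot (y + y') (y + y') != 0.
  have -> : dot (y + y') (y + y') = 2 * 2 * dot y y.
    rewrite -[RHS]subr0 -E !dotE y'y' (dotC y' y); ring.
  by rewrite !mulf_neq0.
have [r rv] := exists_reflection ne; have [r' rv'] := exists_reflection yy.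
exists (r' * r)%g; first by rewrite groupM ?(allr _ yy _ rv') ?(allr _ ne _ rv).
rewrite !vactM (fixa _ _ rv) ?(fixa _ _ rv') //; last by rewrite !dotE ya y'a addr0.
split=> //; move/reflectionP: rv => ->; set s := _ / _; have -> : s = 1.
  rewrite /s; apply: (mulIf ne); rewrite divfK // !dotE y'y' (dotC y' y); ring.
rewrite scale1r opprD addrCA subrr addr0; move/reflectionP: rv' => ->.
set t := _ / _; have -> : t = - 2 by rewrite /t !dotE; field.
by rewrite scaleNr opprK scaler_nat mulr2n addrA addNr add0r.
Qed.

(** Multiplying h by elements of G makes it fix a, then a vector y orthogonal to a;
    what remains is the identity or the reflection along the third axis. *)
Lemma all_reflections_O3 a : dot a a != 0 ->
  (forall v, dot v v != 0 -> has_reflection v) ->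
  (forall v, dot v v = dot a a -> exists2 g, g \in G & vact g v = a) ->
  forall h : GL3, isometry (mx_of h) -> h \in G.
Proof.
move=> aa allr trans h isoh.
have closed g k : g \in G -> isometry (mx_of k) -> isometry (mx_of (g * k)%g).
  by move=> Gg isok v w; rewrite -!/(vact _ _) !vactM !isometry_act //; apply: isoG.
have [g Gg ga] := trans (vact h a) (isometry_act isoh a a).
rewrite -(groupMl _ Gg); have {isoh} := closed _ _ Gg isoh.
have : vact (g * h)%g a = a by rewrite vactM.
move: (g * h)%g => {g Gg ga}{}h ha isoh.
have [y yy ya] := anisotropic_perp aa.
have [g Gg [ga gy]] := move_fixing isoh allr ha yy ya.
rewrite -(groupMl _ Gg); have {isoh} := closed _ _ Gg isoh.
have {ha} : vact (g * h)%g a = a by rewrite vactM ha.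
have : vact (g * h)%g y = y by rewrite vactM.
move: (g * h)%g => {g Gg ga gy}{}h hy ha isoh.
have [z z0 [za zy]] := exists_perp2 a y.
have free : col3 a y z \in unitmx.
  apply: col3_unit => s t u E.
  have s0 : s = 0.
    have := congr1 (dot a) E; rewrite !dotE (dotC a y) ya (dotC a z) za => /eqP.
    by rewrite !mulr0 !addr0 mulf_eq0 (negPf aa) orbF => /eqP.
  have t0 : t = 0.
    have := congr1 (dot y) E; rewrite !dotE ya (dotC y z) zy => /eqP.
    by rewrite !mulr0 addr0 add0r mulf_eq0 (negPf yy) orbF => /eqP.
  move: E; rewrite s0 t0 !scale0r !add0r => /eqP.
  by rewrite scaler_eq0 (negPf z0) orbF => /eqP.
have zz : dot z z != 0.
  by apply: contra z0 => /eqP zz; apply/eqP; apply: (dot_basis_eq0 free).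
have [s [t [u E]]] := col3_span (vact h z) free.
have hz : vact h z = u *: z.
  have dota : dot (vact h z) a = 0 by rewrite -{1}ha isometry_act.
  have doty : dot (vact h z) y = 0 by rewrite -{1}hy isometry_act.
  move: dota doty; rewrite E !dotE za zy ya (dotC a y) ya !mulr0 !addr0 add0r.
  move=> /eqP; rewrite mulf_eq0 (negPf aa) orbF => /eqP -> /eqP.
  by rewrite mulf_eq0 (negPf yy) orbF => /eqP ->; rewrite !scale0r !add0r.
have : u ^+ 2 == 1.
  have := isometry_act isoh z z; rewrite hz !dotE mulrA -{2}[dot z z]mul1r.
  by move/(mulIf zz) <-.
rewrite sqrf_eq1 => /orP[] /eqP uE.
  have -> : h = 1%g; last exact: group1.
  apply: val_inj; apply: (eq_on_col3 free); rewrite /= mul1mx //.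
  by rewrite [LHS]hz uE scale1r.
have [r rz] := exists_reflection zz; have Gr := allr _ zz _ rz.
suff -> : h = r by [].
move/reflectionP: rz => rE; apply: val_inj; apply: (eq_on_col3 free).
- by rewrite [LHS]ha [RHS]rE (dotC a) za mulr0 mul0r scale0r subr0.
- by rewrite [LHS]hy [RHS]rE (dotC y) zy mulr0 mul0r scale0r subr0.
- by rewrite [LHS]hz uE [RHS]rE mulfK // scaleN1r scaler_nat mulr2n opprD addrA subrr sub0r.
Qed.

(** The squares and their multiples by a non-square d both have more than |F| / 2
    elements and share only 0, so they cover the field. *)
Lemma square_classes (d e : F) : ~~ nonzero_square d -> d != 0 -> e != 0 ->
  nonzero_square e \/ exists2 c, c != 0 & e = c ^+ 2 * d.
Proof.
move=> nd d0 e0; pose Sq := [set c ^+ 2 | c : F].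
have inj : injective (fun s => s * d) by apply: mulIf.
have inj' : injective (fun s => e - s) by move=> s t /addrI/oppr_inj.
case: (boolP (nonzero_square e)) => [|ne]; [by left | right].
pose f := fun s : F => s * d.
have cardU : (#|F| <= #|Sq :|: f @: Sq|)%N.
  have := card_squares; rewrite -/Sq => lt.
  have I0 : Sq :&: f @: Sq \subset [set 0].
    apply/subsetP=> s; rewrite !inE => /andP[/imsetP[c _ ->] /imsetP[_ /imsetP[b _ ->]]].
    have [-> | b0 E] := eqVneq b 0; first by rewrite /f expr0n /= mul0r => ->.
    apply: contraR nd => c0; apply/existsP; exists (c / b).
    rewrite mulf_neq0 ?invr_eq0 //=; last by apply: contra c0 => /eqP ->; rewrite expr0n.
    by rewrite expr_div_n E /f mulrAC divff ?mul1r // expf_neq0.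
  have := subset_leq_card I0; rewrite cards1 => le1.
  have := cardsUI Sq (f @: Sq); rewrite (card_imset _ inj); lia.
have : e \in Sq :|: f @: Sq.
  have /eqP -> : Sq :|: f @: Sq == setT; last by rewrite inE.
  by rewrite eqEcard subsetT cardsT.
rewrite inE => /orP[/imsetP[c _ E] | /imsetP[_ /imsetP[c _ ->] E]].
  case/negP: ne; apply/existsP; exists c; rewrite E eqxx andbT.
  by apply: contraNneq e0 => c0; rewrite E c0 expr0n.
exists c => //; apply: contraNneq e0 => c0.
by rewrite E c0 /f expr0n mul0r.
Qed.

(** Transitivity makes the set of roots depend only on the norm, and scaling a root
    multiplies its norm by a square. *)
Theorem reflection_group_orthogonal a b c (ra rb rc : GL3) :
  is_reflection B a ra -> is_reflection B b rb -> is_reflection B c rc ->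
  nonzero_square (dot a a) -> nonzero_square (dot b b) -> dot c c != 0 ->
  G :=: <<[set ra; rb; rc]>>%g ->
  (forall v v', dot v v = dot v' v' -> dot v v != 0 ->
     exists2 g, g \in G & vact g v = v') ->
  G :=: O3 B \/ G :=: O3_1 B.
Proof.
move=> Ra Rb Rc sqa sqb cc GE trans.
have memG r : r \in [set ra; rb; rc] -> r \in G by rewrite GE; apply: mem_gen.
have Gra : ra \in G by apply: memG; rewrite !inE eqxx.
have Grc : rc \in G by apply: memG; rewrite !inE eqxx orbT.
have conj u ru v k : is_reflection B u ru -> ru \in G -> dot u u != 0 -> k != 0 ->
    dot v v = k ^+ 2 * dot u u -> has_reflection v.
  move=> Ru Gu uu k0 vE r rv.
  have k0' : k^-1 != 0 by rewrite invr_eq0.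
  have [|g Gg gu] := trans u (k^-1 *: v) _ uu.
    by rewrite !dotE vE; field.
  have Gr : (g * ru * g^-1)%g \in G by rewrite !groupM ?groupV.
  have := reflectionJ (r' := (g * ru * g^-1)%g) (isoG Gg) Ru.
  rewrite gu => R1; rewrite (reflection_unique (reflectionZ k0' rv) (R1 _)) //.
  by move=> x; rewrite !vactM.
have [ea /andP[ea0 /eqP aE]] := existsP sqa.
have aa : dot a a != 0 by rewrite aE expf_neq0.
have sqG v : nonzero_square (dot v v) -> has_reflection v.
  case/existsP=> e /andP[e0 /eqP vE]; apply: (conj a ra v (e / ea)) => //.
    by rewrite mulf_neq0 ?invr_eq0.
  by rewrite vE aE; field.
case: (boolP (nonzero_square (dot c c))) => sqc; [right | left].
  apply/eqP; rewrite eqEsubset {1}GE; apply/andP; split.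
    apply: genS; apply/subsetP=> r; rewrite !inE -orbA.
    by case/or3P=> /eqP ->; apply/existsP; [exists a | exists b | exists c]; apply/andP.
  rewrite gen_subG; apply/subsetP=> r; rewrite inE => /existsP[v /andP[sqv rv]].
  exact: sqG rv.
have allr v : dot v v != 0 -> has_reflection v.
  move=> vv; case: (square_classes sqc cc vv) => [/sqG // | [k k0 vE]].
  exact: conj Rc Grc cc k0 vE.
apply/eqP; rewrite eqEsubset; apply/andP; split.
  by apply/subsetP=> g Gg; apply/O3P; apply: isoG.
apply/subsetP=> h /O3P isoh.
apply: (all_reflections_O3 aa allr) isoh => v vE.
by apply: trans; rewrite // vE.
Qed.
End ReflectionGroup.

(** * Restriction to a coordinate hyperplane *)

Definition rotation_part (G : {group GL3}) := [set g in G | \det (mx_of g) == 1].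

Fact rotation_part_group_set G : group_set (rotation_part G).
Proof.
apply/group_setP; split=> [|g h]; first by rewrite inE group1 /mx_of det1 eqxx.
rewrite !inE => /andP[Gg /eqP dg] /andP[Gh /eqP dh]; rewrite groupM //=.
by rewrite /mx_of [val _]/(_ *m _) det_mulmx [\det _]dg [\det _]dh mulr1.
Qed.
Canonical rotation_part_group G := Group (rotation_part_group_set G).

Lemma rotation_partP (G : {group GL3}) :
  (forall g : GL3, g \in G -> isometry (mx_of g)) ->
  forall g : GL3, g \in rotation_part G -> rotation (mx_of g).
Proof. by move=> isoG g; rewrite inE => /andP[/isoG iso /eqP]. Qed.

End Geometry.

Section Restriction.
Variables (F : finFieldType) (b : 'I_3 -> 'I_4) (i : 'I_4).
Hypotheses (b_inj : injective b) (b_neq : forall l, b l != i).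
Local Notation GL4 := {'GL_4[F]}.
Local Notation GL3 := {'GL_3[F]}.

Lemma codom_compl j : j != i -> exists m, j = b m.
Proof.
move=> ji; have : j \in [set b l | l : 'I_3]; last by case/imsetP=> m _ ->; exists m.
have /eqP -> : [set b l | l : 'I_3] == [set~ i]; last by rewrite !inE.
rewrite eqEcard card_imset // cardsC1 !card_ord leqnn andbT.
by apply/subsetP=> _ /imsetP[m _ ->]; rewrite !inE.
Qed.

Lemma sum_avoiding (f : 'I_4 -> F) : \sum_j f j = f i + \sum_l f (b l).
Proof.
rewrite (bigD1 i) //=; congr (_ + _).
have -> : \sum_(l < 3) f (b l) = \sum_(j in [set b l | l : 'I_3]) f j.
  by rewrite big_imset //= => l m _ _; apply: b_inj.
apply: eq_bigl => j; apply/idP/imsetP=> [/codom_compl[m ->] | [m _ ->] //].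
by exists m.
Qed.

Definition mx4_of (g : GL4) : 'M[F]_4 := val g.

Definition stabilizing := [set g : GL4 | [forall l, mx4_of g i (b l) == 0]].

Fact stabilizing_group_set : group_set stabilizing.
Proof.
apply/group_setP; split=> [|g h].
  by rewrite inE; apply/forallP=> l; rewrite mxE [i == _]eq_sym (negPf (b_neq l)).
rewrite !inE => /forallP g0 /forallP h0; apply/forallP=> l.
rewrite [mx4_of _]/(mx4_of g *m mx4_of h) mxE sum_avoiding (eqP (h0 l)) mulr0 add0r.
by rewrite big1 // => m _; rewrite (eqP (g0 m)) mul0r.
Qed.
Canonical stabilizing_group := Group stabilizing_group_set.

Lemma restrM g h : h \in stabilizing -> restr b (g * h)%g = restr b g *m restr b h.
Proof.
rewrite inE => /forallP h0; apply/matrixP=> l m.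
rewrite mxE [val _]/(mx4_of g *m mx4_of h) mxE sum_avoiding (eqP (h0 m)) mulr0 add0r mxE.
by apply: eq_bigr => j _; rewrite !mxE.
Qed.

Lemma restr1 : restr b (1%g : GL4) = 1%:M.
Proof. by apply/matrixP=> l m; rewrite !mxE (inj_eq b_inj). Qed.

Definition rest (g : GL4) : GL3 := insubd (1%g : GL3) (restr b g).

Lemma restE g : g \in stabilizing -> val (rest g) = restr b g.
Proof.
move=> Dg; rewrite /rest val_insubd.
have -> // : restr b g \is a GRing.unit.
have DV := groupVr Dg.
have := restrM g DV; rewrite mulgV restr1 => /esym.
by case/mulmx1_unit.
Qed.

Lemma restM : {in stabilizing &, {morph rest : g h / (g * h)%g}}.
Proof.
move=> g h Dg Dh; apply: val_inj; rewrite restE ?groupM // restrM //.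
by rewrite -restE // -[X in _ *m X]restE.
Qed.

Canonical rest_morphism := Morphism restM.

(** The vector c complements the hyperplane spanned by the basis vectors with index
    in the image of b; as it is fixed by the whole group, an element acting
    trivially on the hyperplane is trivial. *)
Lemma restricts_to_gen (S : {set GL4}) (T : {set GL3}) (c : 'cV[F]_4) :
  c i 0 != 0 ->
  (forall g, g \in S -> (forall l, mx4_of g i (b l) = 0) /\ mx4_of g *m c = c) ->
  [set restr b g | g in S] = [set val h | h in T] ->
  restricts_to b <<S>>%g <<T>>%g.
Proof.
move=> ci0 stabS ST.
have SD : S \subset stabilizing.
  apply/subsetP=> g /stabS[g0 _]; rewrite inE; apply/forallP=> l.
  by rewrite g0.
have GD : <<S>>%g \subset stabilizing by rewrite gen_subG.
have restS : (rest @* S)%g = T.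
  have E : [set val h | h in (rest @* S)%g] = [set val h | h in T].
    rewrite -ST morphimEsub // -imset_comp; apply: eq_in_imset => g Sg /=.
    by rewrite restE // (subsetP SD).
  apply/setP=> h; have /setP/(_ (val h)) := E.
  by rewrite !(mem_imset _ _ val_inj).
split; last first.
  rewrite -restS -morphim_gen // morphimEsub // -imset_comp.
  by apply: eq_in_imset => g Gg /=; rewrite restE // (subsetP GD).
have fixc g : g \in <<S>>%g -> mx4_of g *m c = c.
  move=> Gg; have : <<S>>%g \subset [set g | mx4_of g *m c == c].
    have gr : group_set [set g | mx4_of g *m c == c].
      apply/group_setP; split=> [|g1 g2]; first by rewrite inE [mx4_of _]/(1%:M) mul1mx eqxx.
      rewrite !inE => /eqP E1 /eqP E2.
      by rewrite [mx4_of _]/(mx4_of g1 *m mx4_of g2) -mulmxA E2 E1.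
    rewrite (gen_subG S (Group gr)).
    by apply/subsetP=> g' /stabS[_ /eqP]; rewrite inE.
  by move/subsetP/(_ g Gg); rewrite inE => /eqP.
move=> g h Gg Gh E.
have colE j l : mx4_of g j (b l) = mx4_of h j (b l).
  have [-> | ji] := eqVneq j i.
    have := subsetP GD h Gh; have := subsetP GD g Gg; rewrite !inE.
    by move=> /forallP/(_ l)/eqP -> /forallP/(_ l)/eqP ->.
  have [m ->] := codom_compl ji; have /matrixP/(_ m l) := E.
  by rewrite !mxE.
apply: val_inj; apply/matrixP=> j m.
have [-> | mi] := eqVneq m i; last first.
  by have [l ->] := codom_compl mi; apply: colE.
have : (mx4_of g *m c) j 0 = (mx4_of h *m c) j 0 by rewrite !fixc.
rewrite !mxE !sum_avoiding.
under [X in _ + X = _]eq_bigr => l _ do rewrite colE.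
by move/addIr/(mulIf ci0).
Qed.

End Restriction.

(** * Residue fields of the primes of Z[tau] *)

Section ResidueField.
Variables (p : Ztau) (F : finFieldType) (red : {rmorphism Ztau -> F}).
Hypothesis (hF : is_residue_field p red).

Lemma tau_sqr : tau ^+ 2 = tau + 1.
Proof. by congr ZTau. Qed.

Lemma red_tau_sqr : red tau ^+ 2 = red tau + 1.
Proof. by rewrite -rmorphXn tau_sqr rmorphD rmorph1. Qed.

Lemma Ztau_nat (n : nat) : n%:R = ZTau n 0.
Proof.
by elim: n => [|n IHn] //; rewrite -addn1 natrD IHn; congr ZTau.
Qed.

Lemma Ztau_int (n : int) : n%:~R = ZTau n 0.
Proof.
case: n => n; first exact: Ztau_nat.
by rewrite NegzE mulrNz [X in - X](Ztau_nat n.+1); congr ZTau.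
Qed.

Lemma Ztau_expand (x : Ztau) : x = (cst x)%:~R + (cft x)%:~R * tau.
Proof. by case: x => a b; rewrite !Ztau_int; congr ZTau => /=; ring. Qed.

Lemma residue_expand (y : F) : exists a b : int, y = a%:~R + b%:~R * red tau.
Proof.
have [x <-] := hF.1 y; exists (cst x), (cft x).
by rewrite {1}(Ztau_expand x) rmorphD rmorphM /= !rmorph_int.
Qed.

Lemma red_norm0 : (Ztau_norm p)%:~R = 0 :> F.
Proof.
rewrite -(rmorph_int red); apply/hF.2; exists (ZTau (cst p + cft p) (- cft p)).
by rewrite Ztau_int; case: (p) => a b; congr ZTau; rewrite /Ztau_norm /=; ring.
Qed.

Lemma red_abs_norm0 : (`|Ztau_norm p|%N)%:R = 0 :> F.
Proof.
have := red_norm0; case: (Ztau_norm p) => n //.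
by rewrite NegzE mulrNz => /eqP; rewrite oppr_eq0 => /eqP.
Qed.

Lemma red_nat_eq0 (n : nat) : (n%:R == 0 :> F) -> divides p n%:R.
Proof. by move=> /eqP n0; apply/hF.2; rewrite rmorph_nat. Qed.

(** 2 and 3 are inert in Z[tau]: a norm divisible by 2 or by 3 is divisible by 4 or
    by 9. *)
Lemma divides_two_three n : n \in [:: 2; 3]%N -> Ztau_prime p -> divides p n%:R ->
  associate p n%:R.
Proof.
move=> n23 [_ pU _] [z E]; exists z; last by rewrite mulrC.
have normE : Ztau_norm p * Ztau_norm z = (n ^ 2)%:Z.
  rewrite -Ztau_normM -E Ztau_nat /Ztau_norm /=; lia.
have absE : (`|Ztau_norm p| * `|Ztau_norm z| = n ^ 2)%N by rewrite -abszM normE.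
have pr_n : prime n by move: n23; rewrite !inE => /orP[] /eqP ->.
have : (`|Ztau_norm p| %| n ^ 2)%N by rewrite -absE dvdn_mulr.
case/(dvdn_pfactor _ _ pr_n) => [[|[|[|m]]]] // _ pE.
- by case/negP: pU; rewrite unfold_in /= /Ztau_unit pE.
- exfalso; move: n23 pE; rewrite /Ztau_norm expn1; case: (p) => a b /=.
  rewrite !inE => /orP[] /eqP ->.
    have [a' [i [aE i2]]] : exists a' i, a = 2 * a' + i /\ (i = 0 \/ i = 1).
      by exists (a %/ 2)%Z, (a %% 2)%Z; lia.
    have [b' [j [bE j2]]] : exists b' j, b = 2 * b' + j /\ (j = 0 \/ j = 1).
      by exists (b %/ 2)%Z, (b %% 2)%Z; lia.
    rewrite aE bE; case: i2 => ->; case: j2 => -> E2; nia.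
  have [a' [i [aE i2]]] : exists a' i, a = 3 * a' + i /\ (i = 0 \/ i = 1 \/ i = 2).
    by exists (a %/ 3)%Z, (a %% 3)%Z; lia.
  have [b' [j [bE j2]]] : exists b' j, b = 3 * b' + j /\ (j = 0 \/ j = 1 \/ j = 2).
    by exists (b %/ 3)%Z, (b %% 3)%Z; lia.
  rewrite aE bE; case: i2 => [|[]] ->; case: j2 => [|[]] -> E2; nia.
- rewrite unfold_in /= /Ztau_unit; apply/eqP.
  have n2 : (0 < n ^ 2)%N by rewrite expn_gt0 prime_gt0.
  by apply/eqP; rewrite -(eqn_pmul2l n2) -{1}pE absE muln1.
Qed.

Section Characteristic.
Variable l : nat.
Hypotheses (l_char : l \in [pchar F]).
Local Notation frob := (pFrobenius_aut l_char).

Let pr_l : prime l := pcharf_prime l_char.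

Lemma residue_int (a : int) : exists n : 'I_l, a%:~R = n%:R :> F.
Proof.
have l0 := prime_gt0 pr_l; have lz : (l : int) != 0 by rewrite -lt0n.
have lt : (`|(a %% l)%Z| < l)%N.
  by rewrite -ltz_nat gez0_abs ?modz_ge0 // ltz_pmod.
exists (Ordinal lt) => /=.
rewrite {1}(divz_eq a l) intrD intrM [l%:~R](_ : _ = 0) ?mulr0 ?add0r; last first.
  exact: (pcharf0 l_char).
by rewrite -{1}[(a %% l)%Z]gez0_abs ?modz_ge0.
Qed.

Lemma natr_ord_inj (m n : 'I_l) : m%:R = n%:R :> F -> m = n.
Proof.
wlog mn : m n / (m <= n)%N => [sym|].
  by have [/sym //|/ltnW/sym sym' /esym/sym'->] := leqP m n.
move=> E; apply/val_inj/eqP; rewrite eqn_leq mn /= -subn_eq0.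
have : (n - m)%:R == 0 :> F by rewrite natrB // E subrr.
rewrite -(dvdn_pcharf l_char); case: (n - m)%N (leq_subr m n) => // d dn.
by move=> /(dvdn_leq (ltn0Sn d)); rewrite leqNgt (leq_ltn_trans dn).
Qed.

(** The field is generated by tau over the prime field, so if the Frobenius
    automorphism fixes tau then it fixes every element. *)
Lemma card_residue_prime : red tau ^+ l = red tau -> #|F| = l.
Proof.
move=> tl; have fixF (y : F) : y ^+ l = y.
  have [a [b ->]] := residue_expand y; rewrite -(pFrobenius_autE l_char).
  by rewrite rmorphD rmorphM !rmorph_int /= pFrobenius_autE tl.
apply/eqP; rewrite eqn_leq; apply/andP; split.
  pose P : {poly F} := 'X^l - 'X.
  have szP : size P = l.+1.
    by rewrite size_polyDl ?size_polyXn // size_polyN size_polyX ltnS prime_gt1.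
  have P0 : P != 0 by rewrite -size_poly_eq0 szP.
  rewrite cardE -ltnS -szP; apply: max_poly_roots P0 _ (enum_uniq _).
  by apply/allP=> y _; rewrite /root !hornerE fixF subrr.
rewrite -[leqLHS]card_ord; apply: (@leq_card _ _ (fun n : 'I_l => n%:R : F)).
by move=> m n /natr_ord_inj.
Qed.

Lemma card_residue_square : red tau ^+ l != red tau -> #|F| = (l ^ 2)%N.
Proof.
move=> tl; have fixn (n : nat) : n%:R ^+ l = n%:R :> F.
  by rewrite -(pFrobenius_autE l_char) rmorph_nat.
pose f (ab : 'I_l * 'I_l) : F := ab.1%:R + ab.2%:R * red tau.
have f_inj : injective f.
  move=> [a b] [a' b']; rewrite /f /= => E.
  have [bE | bn] := eqVneq b b'.
    by move: E; rewrite bE => /addIr/natr_ord_inj ->.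
  have d0 : b%:R - b'%:R != 0 :> F.
    by apply: contra bn; rewrite subr_eq0 => /eqP/natr_ord_inj ->.
  have tE : red tau = (a'%:R - a%:R) / (b%:R - b'%:R).
    apply: (mulIf d0); rewrite divfK //; apply/eqP; rewrite -subr_eq0.
    have : a%:R + b%:R * red tau - (a'%:R + b'%:R * red tau) == 0 :> F.
      by rewrite subr_eq0 E.
    by apply: etrans; congr (_ == 0); ring.
  case/eqP: tl; rewrite tE -(pFrobenius_autE l_char) fmorph_div !rmorphB.
  by rewrite !rmorph_nat.
have f_surj : codom f =i F.
  move=> y; rewrite inE; apply/codomP; have [a [b ->]] := residue_expand y.
  have [m ->] := residue_int a; have [n ->] := residue_int b.
  by exists (m, n).
by rewrite -(eq_card f_surj) card_codom // card_prod !card_ord mulnn.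
Qed.

(** In characteristic 5 the equation of tau is (tau - 3)^2 = 0. *)
Lemma residue_char5_tau : l = 5%N -> red tau = 3%:R.
Proof.
move=> l5; have five0 : 5%:R = 0 :> F by apply/eqP; rewrite -(dvdn_pcharf l_char) l5.
apply/eqP; rewrite -subr_eq0 -sqrf_eq0; apply/eqP.
transitivity (red tau ^+ 2 - red tau - 1 - (red tau - 2) * 5%:R); first ring.
by rewrite five0 red_tau_sqr; ring.
Qed.

Lemma residue_char5 : l = 5%N -> red tau ^+ l = red tau.
Proof.
by move=> /residue_char5_tau ->; rewrite -(pFrobenius_autE l_char) rmorph_nat.
Qed.

(** Otherwise l is 1 or -1 modulo 5, and the field with l^2 elements contains a
    primitive fifth root of unity z.  The Frobenius automorphism fixes
    z + z^4, and tau is - (z + z^4) or 1 + (z + z^4). *)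
Lemma five_dvd_square : red tau ^+ l != red tau -> (5 %| l ^ 2 + 1)%N.
Proof.
move=> tl; have cF := card_residue_square tl.
have l5 : (l %% 5 != 0)%N.
  apply: contra tl => l5; apply/eqP/residue_char5.
  by apply/esym/eqP; rewrite -(dvdn_prime2 _ pr_l).
apply/negPn/negP => n5; have l14 : (l %% 5 = 1 \/ l %% 5 = 4)%N.
  move: n5; rewrite /dvdn -modnDml -modnXm; move: (ltn_pmod l (isT : (0 < 5)%N)) l5.
  by case: (l %% 5)%N => [|[|[|[|[|?]]]]] //=; [left | right].
have dv5 : (5 %| #|[set: {unit F}]|)%N.
  rewrite card_finField_unit cF -subn1 (_ : (l ^ 2 - 1 = (l - 1) * (l + 1))%N).
    by rewrite Euclid_dvdM //; case: l14 => E; apply/orP; [left | right];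
      have := prime_gt1 pr_l; move: E; clear; lia.
  by rewrite -[1%N in LHS](exp1n 2) subn_sqr.
have [u _ u5] := Cauchy (isT : prime 5) dv5.
pose z : F := FinRing.uval u.
have z5 : z ^+ 5 = 1 by rewrite /z -FinRing.val_unitX -u5 expg_order.
have z1 : z != 1.
  apply/eqP=> z1; have u1 : u = 1%g by apply: val_inj.
  by move: u5; rewrite u1 order1.
have cyc : z ^+ 4 + z ^+ 3 + z ^+ 2 + z + 1 = 0.
  apply: (mulfI (_ : z - 1 != 0)); first by rewrite subr_eq0.
  by transitivity (z ^+ 5 - 1); [ring | rewrite z5 subrr mulr0].
(* The sum be is a root of X^2 + X - 1, whose roots are - tau and tau - 1. *)
pose be := z + z ^+ 4.
have zl : z ^+ l = z \/ z ^+ l = z ^+ 4.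
  by rewrite (divn_eq l 5) exprD mulnC exprM z5 expr1n mul1r;
     case: l14 => ->; [left | right].
have bl : frob be = be.
  rewrite /be rmorphD rmorphXn /= !pFrobenius_autE.
  case: zl => -> //; rewrite -exprM addrC; congr (_ + _).
  by rewrite (_ : (4 * 4 = 5 * 3 + 1)%N) // exprD exprM z5 expr1n mul1r.
have zero : (red tau + be) * (red tau - be - 1) = 0.
  transitivity (red tau ^+ 2 - red tau - (be ^+ 2 + be)); first ring.
  have -> : be ^+ 2 + be = 1.
    transitivity ((z ^+ 5) * z ^+ 3 + z ^+ 5 + z ^+ 5 + z ^+ 2 + z + z ^+ 4).
      by rewrite /be; ring.
    rewrite z5 mul1r -[RHS]addr0 -cyc; ring.
  by rewrite red_tau_sqr; ring.
case/negP: tl; rewrite -(pFrobenius_autE l_char).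
move/eqP: zero; rewrite mulf_eq0 -addrA -opprD subr_eq0 addr_eq0 => /orP[] /eqP ->.
  by rewrite rmorphN /= bl.
by rewrite rmorphD rmorph1 /= bl.
Qed.
Lemma residue_card : #|F| = l \/ (#|F| = l ^ 2 /\ 5 %| l ^ 2 + 1)%N.
Proof.
have [tl | tl] := eqVneq (red tau ^+ l) (red tau).
  by left; apply: card_residue_prime.
by right; split; [apply: card_residue_square | apply: five_dvd_square].
Qed.

Lemma char_of_prime_nat (n : nat) : prime n -> n%:R == 0 :> F -> l = n.
Proof. by move=> pr_n; rewrite -(dvdn_pcharf l_char) dvdn_prime2 // => /eqP. Qed.
End Characteristic.
End ResidueField.

(** * The subgroups acting on the spans of three basis vectors *)

Section Restrictions.
Variables (F : finFieldType) (red : {rmorphism Ztau -> F}) (k : nat).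
Variables (b : 'I_3 -> 'I_4) (i : 'I_4).
Hypotheses (b_inj : injective b) (b_neq : forall l, b l != i).

Lemma r_row j l m : j != l -> r k j l m = (l == m)%:R.
Proof.
by case: j => [[|[|[|[|?]]]] ?] //; case: l => [[|[|[|[|?]]]] ?] //;
  case: m => [[|[|[|[|?]]]] ?] // _; rewrite /r (tnth_nth 0) !mxE.
Qed.

Definition restricted_generator (m : 'I_3) : 'M[Ztau]_3 := mxsub b b (r k (b m)).

Lemma rpE j : mx4_of (rp red k j) = map_mx red (r k j).
Proof. by []. Qed.

Lemma rp_stabilizing m : rp red k (b m) \in stabilizing F b i.
Proof.
rewrite inE; apply/forallP=> l; rewrite rpE mxE r_row //.
by rewrite [i == _]eq_sym (negPf (b_neq l)) rmorph0 eqxx.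
Qed.

Lemma restr_rp m : restr b (rp red k (b m)) = map_mx red (restricted_generator m).
Proof. by apply/matrixP=> l n; rewrite !mxE. Qed.

(** Each generator differs from the identity in one row only; so for c to be fixed
    it suffices that this row preserves the corresponding coordinate of c. *)
Lemma Gp_sub_restricts (c : 'cV[F]_4) : c i 0 != 0 ->
  (forall m, \sum_l red (r k (b m) (b m) l) * c l 0 = c (b m) 0) ->
  restricts_to b (Gp_sub red k i) (reduced_group red restricted_generator).
Proof.
move=> ci0 fixc; apply: (restricts_to_gen b_inj b_neq ci0).
  move=> _ /imsetP[j + ->]; rewrite !inE => ji.
  have [m ->] := codom_compl b_inj b_neq ji; split=> [l|].
    by have := rp_stabilizing m; rewrite inE => /forallP/(_ l)/eqP.
  apply/colP=> l; rewrite rpE mxE; have [-> | ml] := eqVneq l (b m).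
    by rewrite -[RHS]fixc; apply: eq_bigr => n _; rewrite mxE.
  rewrite (bigD1 l) //= big1 => [|n nl]; rewrite mxE r_row 1?eq_sym //.
    by rewrite eqxx rmorph1 mul1r addr0.
  by rewrite (negPf nl) rmorph0 mul0r.
apply/setP=> M; apply/imsetP/imsetP.
  move=> [_ /imsetP[j + ->] ->]; rewrite !inE => ji.
  have [m ->] := codom_compl b_inj b_neq ji; exists (rest b (rp red k (b m))).
    by rewrite inE; apply/existsP; exists m;
       rewrite (restE b_inj b_neq (rp_stabilizing m)) restr_rp.
  by rewrite (restE b_inj b_neq (rp_stabilizing m)).
move=> [h + ->]; rewrite inE => /existsP[m /eqP ->].
by exists (rp red k (b m)); rewrite ?restr_rp //; apply/imsetP; exists (b m);
  rewrite ?inE.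
Qed.

End Restrictions.

Definition vec4 (F : nzRingType) (s : seq F) : 'cV[F]_4 := \col_j nth 0 s j.

Lemma W_inj (a b c : nat) : (a < 4)%N -> (b < 4)%N -> (c < 4)%N ->
  uniq [:: a; b; c] -> injective (tnth [tuple inord a; inord b; inord c] : 'I_3 -> 'I_4).
Proof.
move=> a4 b4 c4 U m n; rewrite !(tnth_nth (inord a)) /= => /(congr1 val).
have E (j : 'I_3) : val (nth (inord a) [:: inord a; inord b; inord c] j : 'I_4) = nth a [:: a; b; c] j.
  by case: j => [[|[|[|?]]] ?] //=; rewrite inordK.
rewrite !E => /eqP; rewrite nth_uniq // => /eqP; exact: val_inj.
Qed.

Lemma W_neq (a b c d : nat) : (a < 4)%N -> (b < 4)%N -> (c < 4)%N -> (d < 4)%N ->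
  d \notin [:: a; b; c] -> forall l, (tnth [tuple inord a; inord b; inord c] l : 'I_4) != inord d.
Proof.
move=> a4 b4 c4 d4 nd l; rewrite (tnth_nth (inord a)) -val_eqE /= (inordK d4).
by move: nd; rewrite !inE !negb_or => /and3P[da db dc];
  case: l => [[|[|[|?]]] ?] //=; rewrite inordK // eq_sym.
Qed.

Definition W0_inj : injective W0_basis := @W_inj 2 1 3 isT isT isT isT.
Definition W2_inj : injective W2_basis := @W_inj 0 1 3 isT isT isT isT.
Definition W3_inj : injective W3_basis := @W_inj 2 1 0 isT isT isT isT.
Definition W0_neq := @W_neq 2 1 3 0 isT isT isT isT isT.
Definition W2_neq := @W_neq 0 1 3 2 isT isT isT isT isT.
Definition W3_neq := @W_neq 2 1 0 3 isT isT isT isT isT.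

(** The fixed vectors are the solutions of the three linear equations given by the
    generators; their coordinate outside the hyperplane must not vanish. *)
Section FixedVectors.
Variables (F : finFieldType) (red : {rmorphism Ztau -> F}) (k : nat).
Local Notation t := (red tau).
Local Notation rh := (red (rho k)).

Let tt : t ^+ 2 = t + 1 := red_tau_sqr red.

Lemma G0_restricts : 3 - rh != 0 ->
  restricts_to W0_basis (Gp_sub red k (inord 0)) (reduced_group red (restricted_generator k W0_basis)).
Proof.
move=> h; apply: (Gp_sub_restricts W0_inj W0_neq (c := vec4 [:: 3 - rh; 2; 1; 1])).
  by rewrite mxE inordK.
by case=> [[|[|[|?]]] ?] //; rewrite !big_ord_recl big_ord0 /W0_basis (tnth_nth (inord 0)) /=
  !mxE /r (tnth_nth 0) inordK //= !mxE inordK //= ?(rmorph0, rmorph1, rmorphN); ring.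
Qed.

Lemma G2_restricts : 4 - t ^+ 2 - rh != 0 ->
  restricts_to W2_basis (Gp_sub red k (inord 2)) (reduced_group red (restricted_generator k W2_basis)).
Proof.
move=> h; apply: (Gp_sub_restricts W2_inj W2_neq (c := vec4 [:: t ^+ 2; 2; 4 - t ^+ 2 - rh; 1])).
  by rewrite mxE inordK.
by case=> [[|[|[|?]]] ?] //; rewrite !big_ord_recl big_ord0 /W2_basis (tnth_nth (inord 0)) /=
  !mxE /r (tnth_nth 0) inordK //= !mxE inordK //= ?(rmorph0, rmorph1, rmorphN, rmorphXn); ring.
Qed.

Lemma G3_restricts : 
  restricts_to W3_basis (Gp_sub red k (inord 3)) (reduced_group red (restricted_generator k W3_basis)).
Proof.
apply: (Gp_sub_restricts W3_inj W3_neq (c := vec4 [:: rh * t ^+ 2; 2 * rh; rh; 2 - t])).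
  rewrite mxE inordK //=; apply/eqP => t2.
  have : (2 - t) * (1 + t) = 1.
    by transitivity (2 + t - t ^+ 2); [ring | rewrite tt; ring].
  by rewrite t2 mul0r => /esym/eqP; rewrite oner_eq0.
case=> [[|[|[|?]]] ?] //; rewrite !big_ord_recl big_ord0 /W3_basis (tnth_nth (inord 0)) /=
  !mxE /r (tnth_nth 0) inordK //= !mxE inordK //= ?(rmorph0, rmorph1, rmorphN, rmorphXn) ?tt; ring.
Qed.

End FixedVectors.

(** * Standard representations of the Coxeter groups *)

Section StandardRepresentations.
Variable R : realType.
Implicit Types x : R.

Local Notation phi := ((1 + Num.sqrt 5) / 2 : R).

Lemma phi_sqr : phi ^+ 2 = phi + 1.
Proof.
have s5 : Num.sqrt 5 ^+ 2 = 5 :> R by rewrite sqr_sqrtr.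
transitivity ((1 + 2 * Num.sqrt 5 + Num.sqrt 5 ^+ 2) / 4 : R); first by field.
by rewrite s5; field.
Qed.

Lemma phi_gt1 : 1 < phi.
Proof.
have s5 : 1 < Num.sqrt 5 :> R.
  by rewrite -[ltLHS]sqrtr1 ltr_sqrt // ltr1n.
by rewrite ltr_pdivlMr // mul1r -[ltLHS]/(1 + 1) ltrD2l.
Qed.

Lemma Ztau_val_tau2 : Ztau_val R (tau ^+ 2) = phi ^+ 2.
Proof.
rewrite phi_sqr tau_sqr (_ : tau + 1 = ZTau 1 1) //.
by rewrite /Ztau_val /= mul1r addrC.
Qed.

Lemma cos_pi_div_gt0 (n : nat) : (2 < n)%N -> 0 < cos (pi / n%:R) :> R.
Proof.
move=> n2; have n0 : (0 : R) < n%:R by rewrite ltr0n (ltn_trans _ n2).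
apply: cos_gt0_pihalf; apply/andP; split.
  by apply: (@lt_trans _ _ 0); rewrite ?oppr_lt0 ?divr_gt0 ?pi_gt0.
by rewrite ltr_pM2l ?pi_gt0 // ltf_pV2 ?posrE // ltr_nat.
Qed.

Lemma sin_sqr x : sin x ^+ 2 = 1 - cos x ^+ 2.
Proof. by rewrite -(cos2Dsin2 x) addrAC subrr add0r. Qed.

Lemma cos_double x : cos (x + x) = 2 * cos x ^+ 2 - 1.
Proof. by rewrite cosD -[sin x * _]/(sin x ^+ 2) sin_sqr; ring. Qed.

Lemma cos_triple x : cos (x + x + x) = 4 * cos x ^+ 3 - 3 * cos x.
Proof.
rewrite cosD cos_double sinD.
transitivity (2 * cos x ^+ 3 - cos x - 2 * cos x * (sin x ^+ 2)); first ring.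
by rewrite sin_sqr; ring.
Qed.

(** -1 and 1/2 are the roots of 4 x^3 - 3 x = -1. *)
Lemma cos_pi3 : 2 * cos (pi / 3%:R) = 1 :> R.
Proof.
have x0 : 0 < cos (pi / 3%:R) :> R by apply: cos_pi_div_gt0.
have := cos_triple (pi / 3%:R).
have -> : pi / 3%:R + pi / 3%:R + pi / 3%:R = pi :> R by field.
rewrite cospi; move: x0; set x := cos _ => x0 E.
have : (x + 1) * (2 * x - 1) ^+ 2 = 0.
  transitivity (4 * x ^+ 3 - 3 * x + 1); first ring.
  by rewrite -E; ring.
move/eqP; rewrite mulf_eq0 gt_eqF ?addr_gt0 //= sqrf_eq0 subr_eq0 => /eqP.
by [].
Qed.

Lemma cos_pi4 : (2 * cos (pi / 4%:R)) ^+ 2 = 2 :> R.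
Proof.
have := cos_double (pi / 4%:R).
have -> : pi / 4%:R + pi / 4%:R = pi / 2 :> R by field.
rewrite cos_pihalf => E.
transitivity (2 * (2 * cos (pi / 4%:R) ^+ 2 - 1) + 2 : R); first ring.
by rewrite -E; ring.
Qed.

(** From cos(3 pi/5) = - cos(2 pi/5) one gets a cubic with roots -1, tau / 2 and
    (1 - tau) / 2. *)
Lemma cos_pi5 : 2 * cos (pi / 5%:R) = phi :> R.
Proof.
have x0 : 0 < cos (pi / 5%:R) :> R by apply: cos_pi_div_gt0.
have E3 := cos_triple (pi / 5%:R); have E2 := cos_double (pi / 5%:R).
have E : cos (pi / 5%:R + pi / 5%:R + pi / 5%:R) = - cos (pi / 5%:R + pi / 5%:R) :> R.
  have -> : pi / 5%:R + pi / 5%:R + pi / 5%:R = - (pi / 5%:R + pi / 5%:R) + pi :> R.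
    by field.
  by rewrite cosDpi cosN.
rewrite E3 E2 in E; move: x0 E; set x := cos _ => x0 E.
have : (x + 1) * ((2 * x) ^+ 2 - 2 * x - 1) = 0.
  transitivity (4 * x ^+ 3 - 3 * x + (2 * x ^+ 2 - 1)); first ring.
  by rewrite E; ring.
move/eqP; rewrite mulf_eq0 gt_eqF ?addr_gt0 //= => /eqP E'.
have : (2 * x - phi) * (2 * x + phi - 1) = 0.
  transitivity ((2 * x) ^+ 2 - 2 * x - 1 - (phi ^+ 2 - phi - 1)); first ring.
  by rewrite E' phi_sqr; ring.
move/eqP; rewrite mulf_eq0 => /orP[|]; first by rewrite subr_eq0 => /eqP.
by rewrite gt_eqF // -addrA addr_gt0 ?mulr_gt0 // subr_gt0 phi_gt1.
Qed.

Lemma standard_of_entries (M : 'I_3 -> 'I_3 -> nat) (S : 'I_3 -> 'M[Ztau]_3)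
    (c : 'rV[R]_3) : (forall j, 0 < c 0 j) ->
  (forall i l j, c 0 l * Ztau_val R (S i l j) = simple_reflection R M i l j * c 0 j) ->
  standard_over_Ztau R M S.
Proof.
move=> c0 E; exists c => // i.
have U : diag_mx c \in unitmx.
  rewrite unitmxE det_diag unitfE; apply/prodf_neq0 => j _.
  by rewrite gt_eqF.
apply: (can_inj (mulKmx U)); rewrite -mulmxA mulKVmx //.
by apply/matrixP=> l j; rewrite mul_diag_mx mul_mx_diag !mxE E !mxE.
Qed.

Lemma coxeter_form_linear (m n : nat) (i j : 'I_3) :
  2 * coxeter_form R (coxeter_linear m n) i j =
  nth 0 (nth [::] [:: [:: 2; - (2 * cos (pi / m%:R)); 0];
     [:: - (2 * cos (pi / m%:R)); 2; - (2 * cos (pi / n%:R))];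
     [:: 0; - (2 * cos (pi / n%:R)); 2]] i) j.
Proof.
have c1 : cos (pi / 1%:R) = -1 :> R by rewrite divr1 cospi.
rewrite /coxeter_form /coxeter_linear.
by case: i => [[|[|[|?]]] ?] //; case: j => [[|[|[|?]]] ?] //=;
  rewrite ?c1 ?cos_pihalf; ring.
Qed.

(** Rescaling the third simple root by 2 cos(pi/n) turns the two coefficients
    2 cos(pi/n) that link it with the second one into 1 and (2 cos(pi/n))^2. *)
Lemma W0_standard k n : 0 < 2 * cos (pi / n%:R) :> R ->
  Ztau_val R (rho k) = (2 * cos (pi / n%:R)) ^+ 2 ->
  standard_over_Ztau R (coxeter_linear 3 n) (restricted_generator k W0_basis).
Proof.
move=> x0 rhoE.
apply: (standard_of_entries (c := \row_j nth 0 [:: 1; 1; 2 * cos (pi / n%:R)] j)).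
  by case=> [[|[|[|?]]] ?] //; rewrite mxE.
have val0 : Ztau_val R 0 = 0 by rewrite /Ztau_val /= mul0r addr0.
have val1 : Ztau_val R 1 = 1 by rewrite /Ztau_val /= mul0r addr0.
have valN1 : Ztau_val R (-1) = -1 by rewrite /Ztau_val /= mul0r addr0.
move: x0 rhoE; have := cos_pi3.
move=> c3 x0 rhoE i l j; rewrite /simple_reflection !mxE (coxeter_form_linear 3 n) c3.
move: x0 rhoE; set x := 2 * cos (pi / n%:R) => x0 rhoE.
rewrite /W0_basis.
by case: i => [[|[|[|?]]] ?] //; case: l => [[|[|[|?]]] ?] //;
  case: j => [[|[|[|?]]] ?] //; rewrite /r !(tnth_nth (inord 0)) (tnth_nth 0) /=
  ?inordK //= !mxE ?inordK //= ?val0 ?val1 ?valN1 ?rhoE; ring.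
Qed.

(** Rescaling the first two roots by tau turns the two coefficients tau that link
    the last two into tau^2 and 1. *)
Lemma W3_standard k : standard_over_Ztau R coxeter_H3 (restricted_generator k W3_basis).
Proof.
have phi0 : phi != 0 by rewrite gt_eqF // (lt_trans ltr01) ?phi_gt1.
apply: (standard_of_entries (c := \row_j nth 0 [:: phi; phi; 1] j)).
  by case=> [[|[|[|?]]] ?] //; rewrite mxE //= (lt_trans ltr01) ?phi_gt1.
have val0 : Ztau_val R 0 = 0 by rewrite /Ztau_val /= mul0r addr0.
have val1 : Ztau_val R 1 = 1 by rewrite /Ztau_val /= mul0r addr0.
have valN1 : Ztau_val R (-1) = -1 by rewrite /Ztau_val /= mul0r addr0.
have valt := Ztau_val_tau2.
move=> i l j; rewrite /simple_reflection !mxE (coxeter_form_linear 3 5) cos_pi3 cos_pi5.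
rewrite /W3_basis; move: phi valt phi0 => x valt x0.
by case: i => [[|[|[|?]]] ?] //; case: l => [[|[|[|?]]] ?] //;
  case: j => [[|[|[|?]]] ?] //; rewrite /r !(tnth_nth (inord 0)) (tnth_nth 0) /=
  ?inordK //= !mxE ?inordK //= ?val0 ?val1 ?valN1 ?valt; ring.
Qed.

End StandardRepresentations.

(** * The group acting on the span of the first, second and fourth basis vectors *)

Definition not_order_235 (F : finFieldType) (w : {'GL_3[F]}) :=
  [/\ (w ^+ 2 != 1)%g, (w ^+ 3 != 1)%g & (w ^+ 5 != 1)%g].

(** The reflection group with diagram [5,k], in coordinates: t stands for the residue
    of tau and rh for that of rho_k. *)
Section FiveKGroup.
Variables (F : finFieldType) (B : 'M[F]_3) (t rh : F).
Local Notation GL3 := {'GL_3[F]}.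
Local Notation dot := (bform B).
Variables g0 g1 g2 : GL3.
Hypotheses (F2 : 2 != 0 :> F) (tt : t ^+ 2 = t + 1) (rh0 : rh != 0)
  (disc : 4 - t ^+ 2 - rh != 0).
Hypothesis Bsym : B^T = B.
Hypothesis dot_vec3 : forall x y z x' y' z',
  dot (vec3 x y z) (vec3 x' y' z') =
  4 * (x * x') - 2 * t ^+ 2 * (x * y' + y * x') + 4 * t ^+ 2 * (y * y')
  - 2 * t ^+ 2 * rh * (y * z' + z * y') + 4 * t ^+ 2 * rh * (z * z').
Hypotheses (vact_g0 : forall x y z, vact g0 (vec3 x y z) = vec3 (- x + t ^+ 2 * y) y z)
  (vact_g1 : forall x y z, vact g1 (vec3 x y z) = vec3 x (x - y + rh * z) z)
  (vact_g2 : forall x y z, vact g2 (vec3 x y z) = vec3 x y (y - z)).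

Let a : 'cV[F]_3 := vec3 1 0 0.
Let b : 'cV[F]_3 := vec3 0 1 0.
Let c : 'cV[F]_3 := vec3 0 0 1.

Lemma vec3P (x y z x' y' z' : F) : vec3 x y z = vec3 x' y' z' ->
  [/\ x = x', y = y' & z = z'].
Proof.
by move=> E; split; [have := congr1 (fun v : 'cV_3 => v 0 0) E
  | have := congr1 (fun v : 'cV_3 => v 1 0) E
  | have := congr1 (fun v : 'cV_3 => v 2%:R 0) E]; rewrite !mxE !(tnth_nth 0).
Qed.

Lemma vec3D (x y z x' y' z' : F) :
  vec3 x y z + vec3 x' y' z' = vec3 (x + x') (y + y') (z + z').
Proof.
by apply/colP=> i; rewrite !mxE !(tnth_nth 0); case: i => [[|[|[|?]]] ?].
Qed.

Lemma vec3Z (k x y z : F) : k *: vec3 x y z = vec3 (k * x) (k * y) (k * z).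
Proof.
by apply/colP=> i; rewrite !mxE !(tnth_nth 0); case: i => [[|[|[|?]]] ?].
Qed.

Lemma t_neq0 : t != 0.
Proof.
apply/eqP=> t0; have /eqP := tt; rewrite t0 expr0n add0r eq_sym.
by rewrite oner_eq0.
Qed.

Lemma std_basis_unit : col3 a b c \in unitmx.
Proof.
apply: col3_unit => x y z; rewrite !vec3Z !vec3D -(scale0r a) vec3Z => /vec3P[].
by rewrite !(mulr0, mulr1, addr0, add0r) => -> -> ->.
Qed.

Lemma four_neq0 : 4 != 0 :> F.
Proof. by rewrite (_ : 4 = 2 * 2) ?mulf_neq0 //; ring. Qed.

Lemma refl_g0 : is_reflection B a g0.
Proof.
apply/(reflectionP B) => v; rewrite [v]vec3_eta vact_g0.
move: (v 0 0) (v 1 0) (v 2%:R 0) => x y z.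
by rewrite -scaleNr vec3Z vec3D !dot_vec3; congr vec3; field; rewrite four_neq0.
Qed.

Lemma refl_g1 : is_reflection B b g1.
Proof.
have t0 := t_neq0; apply/(reflectionP B) => v; rewrite [v]vec3_eta vact_g1.
move: (v 0 0) (v 1 0) (v 2%:R 0) => x y z.
by rewrite -scaleNr vec3Z vec3D !dot_vec3; congr vec3; field; rewrite four_neq0 t0.
Qed.

Lemma refl_g2 : is_reflection B c g2.
Proof.
have t0 := t_neq0; apply/(reflectionP B) => v; rewrite [v]vec3_eta vact_g2.
move: (v 0 0) (v 1 0) (v 2%:R 0) => x y z.
by rewrite -scaleNr vec3Z vec3D !dot_vec3; congr vec3; field; rewrite four_neq0 t0 rh0.
Qed.

Lemma norm_a : dot a a = 2 ^+ 2.
Proof. by rewrite dot_vec3; ring. Qed.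

Lemma norm_b : dot b b = (2 * t) ^+ 2.
Proof. by rewrite dot_vec3; ring. Qed.

Lemma norm_c : dot c c = 4 * t ^+ 2 * rh.
Proof. by rewrite dot_vec3; ring. Qed.

Lemma norms_neq0 : [/\ dot a a != 0, dot b b != 0 & dot c c != 0].
Proof.
by rewrite norm_a norm_b norm_c !mulf_neq0 ?sqrf_eq0 ?mulf_neq0 ?four_neq0 ?t_neq0.
Qed.

Lemma det_vec3 (M : 'M[F]_3) (x1 x2 x3 y1 y2 y3 z1 z2 z3 : F) :
  M *m a = vec3 x1 x2 x3 -> M *m b = vec3 y1 y2 y3 -> M *m c = vec3 z1 z2 z3 ->
  \det M = x1 * (y2 * z3 - y3 * z2) - y1 * (x2 * z3 - x3 * z2)
           + z1 * (x2 * y3 - x3 * y2).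
Proof.
have E x y z : vec3 x y z = x *: a + y *: b + z *: c.
  by rewrite !vec3Z !vec3D !(mulr0, mulr1, addr0, add0r).
by rewrite !E; apply: det_on_col3 std_basis_unit.
Qed.

Lemma det_form : \det B = 16 * t ^+ 4 * rh * (4 - t ^+ 2 - rh).
Proof.
have E (i j : 'I_3) : B i j = dot (delta_mx i 0) (delta_mx j 0).
  by rewrite /bform -mulmxA -colE trmx_delta -rowE !mxE.
have e0 : delta_mx 0 0 = a.
  by apply/colP=> i; rewrite !mxE (tnth_nth 0); case: i => [[|[|[|?]]] ?].
have e1 : delta_mx 1 0 = b.
  by apply/colP=> i; rewrite !mxE (tnth_nth 0); case: i => [[|[|[|?]]] ?].
have e2 : delta_mx 2%:R 0 = c.
  by apply/colP=> i; rewrite !mxE (tnth_nth 0); case: i => [[|[|[|?]]] ?].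
by rewrite det3 !E e0 e1 e2 !dot_vec3; ring.
Qed.

Lemma form_unit : B \in unitmx.
Proof.
rewrite unitmxE unitfE det_form (_ : 16 = 4 * 4); last by ring.
by rewrite !mulf_neq0 ?expf_neq0 ?four_neq0 ?t_neq0.
Qed.

Lemma det_g0 : \det (mx_of g0) = -1.
Proof. by rewrite (det_vec3 (vact_g0 _ _ _) (vact_g0 _ _ _) (vact_g0 _ _ _)); ring. Qed.
Lemma det_g1 : \det (mx_of g1) = -1.
Proof. by rewrite (det_vec3 (vact_g1 _ _ _) (vact_g1 _ _ _) (vact_g1 _ _ _)); ring. Qed.
Lemma det_g2 : \det (mx_of g2) = -1.
Proof. by rewrite (det_vec3 (vact_g2 _ _ _) (vact_g2 _ _ _) (vact_g2 _ _ _)); ring. Qed.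

Variable G : {group GL3}.
Hypothesis GE : G :=: <<[set g0; g1; g2]>>%g.

Lemma G_gens : [/\ g0 \in G, g1 \in G & g2 \in G].
Proof. by rewrite GE; split; apply: mem_gen; rewrite !inE eqxx ?orbT. Qed.

Lemma G_isometry (g : GL3) : g \in G -> isometry B (mx_of g).
Proof.
have [aa bb cc] := norms_neq0; have Bu := form_unit.
have gO : group_set (O3 B).
  apply/group_setP; split=> [|g1' g2' /(O3P B) E1 /(O3P B) E2]; apply/(O3P B) => x y.
    by rewrite !mul1mx.
  by rewrite -!/(vact _ _) !vactM [LHS]E1 [LHS]E2.
have : G \subset Group gO.
  rewrite GE gen_subG; apply/subsetP=> h hg; suff /(O3P B) : isometry B (mx_of h) by [].
  have {hg}[->|->|->] : [\/ h = g0, h = g1 | h = g2].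
  - by move: hg; rewrite !inE -orbA => /or3P[] /eqP; [constructor 1|constructor 2|constructor 3].
  - exact: reflection_isometry refl_g0.
  - exact: reflection_isometry refl_g1.
  - exact: reflection_isometry refl_g2.
by move/subsetP => sub /sub/(O3P B).
Qed.

Let H := rotation_part_group G.

Let rotH : forall g : GL3, g \in H -> rotation B (mx_of g) := rotation_partP G_isometry.

Let five_rot := (g0 * g1)%g.

Lemma det_mul (g h : GL3) : \det (mx_of (g * h)%g) = \det (mx_of g) * \det (mx_of h).
Proof. by rewrite [mx_of _]/(mx_of g *m mx_of h) det_mulmx. Qed.

Lemma mem_rotation_pair (g h : GL3) : g \in G -> h \in G -> \det (mx_of g) = -1 ->
  \det (mx_of h) = -1 -> (g * h)%g \in H.
Proof. by move=> Gg Gh dg dh; rewrite inE groupM // det_mul dg dh mulrNN mulr1 eqxx. Qed.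

Lemma five_rot_mem : five_rot \in H.
Proof. by have [? ? ?] := G_gens; apply: mem_rotation_pair; rewrite ?det_g0 ?det_g1. Qed.

Lemma five_rotE x y z :
  vact five_rot (vec3 x y z) = vec3 (- x + t ^+ 2 * (x - y + rh * z)) (x - y + rh * z) z.
Proof. by rewrite vactM vact_g1 vact_g0. Qed.

Lemma vact_vec3_inj (g h : GL3) :
  (forall x y z, vact g (vec3 x y z) = vact h (vec3 x y z)) -> g = h.
Proof. by move=> E; apply: vact_inj => v; rewrite [v]vec3_eta E. Qed.

(** The product of the first two reflections is a rotation of order 5, because t is a
    root of X^2 - X - 1. *)
Lemma five_rot_order : (five_rot ^+ 5 = 1)%g.
Proof.
apply: vact_vec3_inj => x y z; rewrite !expgS expg0 mulg1 !vactM !(vact_g0, vact_g1) vact1.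
by congr vec3; ring: tt.
Qed.

Lemma five_rot_neq1 : five_rot != 1%g.
Proof.
apply/eqP=> E; have := five_rotE 0 1 0; rewrite E vact1 => /vec3P[_ /eqP + _].
rewrite sub0r mulr0 addr0 -subr_eq0 opprK => /eqP E2.
by case/eqP: F2; rewrite -[RHS]E2.
Qed.

(** A vector whose line is preserved by the rotations g0 g1 and g0 g2 is either zero
    or a multiple of (t^2, 2, 1), and the latter occurs only if the form is singular. *)
Lemma H_irreducible v : v != 0 -> line_stab H v != H.
Proof.
move=> v0; apply/eqP=> E; have [G0 G1 G2] := G_gens.
have HA := five_rot_mem.
have HC : (g0 * g2)%g \in H by apply: mem_rotation_pair; rewrite ?det_g0 ?det_g2.
have stab g : g \in H -> exists k, vact g v = k *: v.
  have /setP/(_ g) := E; rewrite in_set => <- /andP[_ /existsP[k /eqP gv]].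
  by exists k.
have [mu Amu] := stab _ HA; have [la Cla] := stab _ HC.
move: v0 Amu Cla; rewrite [v]vec3_eta; move: (v 0 0) (v 1 0) (v 2%:R 0) => x y z v0.
rewrite five_rotE vactM vact_g2 vact_g0 !vec3Z => /vec3P[A1 A2 A3] /vec3P[C1 C2 C3].
have [y0 | yn0] := eqVneq y 0.
  rewrite y0 in A1 A2 A3 C1 C2 C3 v0.
  have w0 : x + rh * z = 0 by move: A2; rewrite mulr0 subr0.
  have [z0 | zn0] := eqVneq z 0.
    by case/eqP: v0; rewrite z0 mulr0 addr0 in w0; rewrite w0 z0 -(scale0r a) vec3Z !mul0r.
  have mu1 : mu = 1 by apply: (mulIf zn0); rewrite -A3 mul1r.
  move: A1; rewrite mu1 mul1r subr0 w0 mulr0 addr0 => xx.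
  have x0 : x = 0 by apply: (mulfI F2); transitivity (x - (- x)); [ring | rewrite xx; ring].
  by move/eqP: w0; rewrite x0 add0r mulf_eq0 (negPf rh0) (negPf zn0).
have la1 : la = 1 by apply: (mulIf yn0); rewrite -C2 mul1r.
rewrite la1 !mul1r in C1 C3.
have yE : y = 2 * z by rewrite -[LHS](subrK z) C3; ring.
have zn0 : z != 0 by apply: contraNneq yn0 => z0; rewrite yE z0 mulr0.
have mu1 : mu = 1 by apply: (mulIf zn0); rewrite -A3 mul1r.
have xE : x = t ^+ 2 * z.
  by apply: (mulfI F2); transitivity (x + x); [ring | rewrite -{1}C1 yE; ring].
case/eqP: disc; apply: (mulIf zn0); rewrite mul0r.
move: A2; rewrite mu1 mul1r xE yE => A2.
transitivity (2 * z - (t ^+ 2 * z - 2 * z + rh * z)); first ring.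
by rewrite A2 subrr.
Qed.

(** In characteristic 5 the rotation g0 g1 is unipotent, which provides an isotropic
    axis at once; the residue field is then prime.  In the other characteristics the
    word w has the properties required by the count of axes. *)
Theorem five_k_transitive (l : nat) (w : GL3) : l \in [pchar F] ->
  w \in H -> (l != 5%N -> not_order_235 w) ->
  #|F| = l \/ (#|F| = l ^ 2 /\ 5 %| l ^ 2 + 1)%N -> (l = 5%N -> t = 3%:R) ->
  forall v v', dot v v = dot v' v' -> dot v v != 0 ->
     exists2 g, g \in G & vact g v = v'.
Proof.
move=> l_char Hw wl cF t3 v v' vv' vv; have pr_l := pcharf_prime l_char.
have Bu := form_unit; have irr := H_irreducible.
have HA := five_rot_mem; have A1 := five_rot_neq1; have A5 := five_rot_order.
suff [u [pu uu full]] : exists u, [/\ pole H u, dot u u = 0 & #|fixer H u| = #|F|].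
  have [g Hg gE] := full_pole_transitive Bsym Bu F2 rotH irr pu uu full vv' vv.
  by exists g => //; move: Hg; rewrite inE => /andP[].
have [l5 | ln5] := eqVneq l 5%N.
  have five0 : 5%:R = 0 :> F by apply/eqP; rewrite -(dvdn_pcharf l_char) l5.
  (* For t = 3 the vector u spans the radical of the plane of the first two roots. *)
  have tE := t3 l5; pose u : 'cV[F]_3 := vec3 (t ^+ 2) 2 0.
  have u0 : u != 0.
    apply/eqP; rewrite -(scale0r a) vec3Z => /vec3P[_ /eqP + _].
    by rewrite mul0r (negPf F2).
  have uu : dot u u = 0.
    rewrite dot_vec3 tE; transitivity (5%:R * (-36 : F)); first ring.
    by rewrite five0 mul0r.
  have Au : vact five_rot u = u.
    rewrite five_rotE; congr vec3.
      transitivity (t ^+ 2 + 5%:R * t ^+ 2); last by rewrite five0 mul0r addr0.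
      by rewrite tE; ring.
    transitivity (2 + 5%:R : F); last by rewrite five0 addr0.
    by rewrite tE; ring.
  have pu : pole H u by split=> //; apply: axis_fixer_neq1 HA A1 Au.
  exists u; split=> //; have [z [y fr]] := frame_of_isotropic Bsym Bu F2 u0 uu.
  case: cF => [cF | [_ ]]; last by rewrite l5.
  exact: (fixer_full_of_prime_field Bsym Bu F2 rotH fr pr_l l_char cF (proj2 pu)).
have [w2 w3 w5] := wl ln5.
case: cF => [cF | [cF l25]]; last first.
  exact: (exists_full_pole_of_square_field Bsym Bu F2 rotH irr HA A1 A5 Hw w2 w3 w5
    pr_l l_char cF l25).
have [u [pu uu]] := exists_isotropic_pole Bsym Bu F2 rotH irr HA A1 A5 Hw w2 w3 w5.
exists u; split=> //; have [u0 u1] := pu.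
have [z [y fr]] := frame_of_isotropic Bsym Bu F2 u0 uu.
exact: (fixer_full_of_prime_field Bsym Bu F2 rotH fr pr_l l_char cF u1).
Qed.

Theorem five_k_orthogonal (l : nat) (w : GL3) : l \in [pchar F] ->
  w \in H -> (l != 5%N -> not_order_235 w) ->
  #|F| = l \/ (#|F| = l ^ 2 /\ 5 %| l ^ 2 + 1)%N -> (l = 5%N -> t = 3%:R) ->
  G :=: O3 B \/ G :=: O3_1 B.
Proof.
move=> l_char Hw wl cF t3; have [aa bb cc] := norms_neq0.
apply: (reflection_group_orthogonal Bsym form_unit F2 G_isometry refl_g0 refl_g1 refl_g2
  _ _ cc GE) => [||v v' vv' vv].
- by apply/existsP; exists 2; rewrite F2 norm_a eqxx.
- by apply/existsP; exists (2 * t); rewrite mulf_neq0 ?t_neq0 // norm_b eqxx.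
- exact: (five_k_transitive l_char Hw wl cF t3 vv' vv).
Qed.

End FiveKGroup.

Section OrthogonalCase.
Variables (F : finFieldType) (red : {rmorphism Ztau -> F}) (k : nat).
Local Notation GL3 := {'GL_3[F]}.
Local Notation t := (red tau).
Local Notation rh := (red (rho k)).
Local Notation B := (form_restr red k W2_basis).
Local Notation dot := (bform B).

Definition W2_gen (m : 'I_3) : GL3 := rest W2_basis (rp red k (W2_basis m)).

Definition W2_g0 := W2_gen 0.
Definition W2_g1 := W2_gen 1.
Definition W2_g2 := W2_gen 2%:R.

Lemma W2_genE m : mx_of (W2_gen m) = map_mx red (restricted_generator k W2_basis m).
Proof.
by rewrite [LHS](restE W2_inj W2_neq (rp_stabilizing red k W2_neq m)) restr_rp.
Qed.

Lemma W2_form_sym : B^T = B.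
Proof.
apply/matrixP=> i j; rewrite !mxE; congr (red _); rewrite /W2_basis.
by case: i => [[|[|[|?]]] ?] //; case: j => [[|[|[|?]]] ?] //;
  rewrite !(tnth_nth (inord 0)) /= !inordK.
Qed.

Lemma W2_form_vec3 x y z x' y' z' :
  dot (vec3 x y z) (vec3 x' y' z') =
  4 * (x * x') - 2 * t ^+ 2 * (x * y' + y * x') + 4 * t ^+ 2 * (y * y')
  - 2 * t ^+ 2 * rh * (y * z' + z * y') + 4 * t ^+ 2 * rh * (z * z').
Proof.
rewrite /bform !mxE !big_ord_recl big_ord0 !mxE !big_ord_recl !big_ord0 !mxE.
rewrite /W2_basis !(tnth_nth (inord 0)) !(tnth_nth 0) /= !inordK //=.
by rewrite !(rmorphM, rmorphN, rmorphXn, rmorph_nat, rmorph0) /=; ring.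
Qed.

Lemma W2_gen0 x y z : vact (W2_g0) (vec3 x y z) = vec3 (- x + t ^+ 2 * y) y z.
Proof.
rewrite /vact W2_genE; apply/colP=> i; rewrite !mxE !big_ord_recl big_ord0 !mxE.
rewrite /W2_basis !(tnth_nth (inord 0)) /r !(tnth_nth 0) /= inordK //=.
by case: i => [[|[|[|?]]] ?] //; rewrite !mxE /= !inordK //=
  !(rmorphN, rmorphXn, rmorph0, rmorph1) /=; ring.
Qed.

Lemma W2_gen1 x y z : vact (W2_g1) (vec3 x y z) = vec3 x (x - y + rh * z) z.
Proof.
rewrite /vact W2_genE; apply/colP=> i; rewrite !mxE !big_ord_recl big_ord0 !mxE.
rewrite /W2_basis !(tnth_nth (inord 0)) /r !(tnth_nth 0) /= inordK //=.
by case: i => [[|[|[|?]]] ?] //; rewrite !mxE /= !inordK //=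
  !(rmorphN, rmorphXn, rmorph0, rmorph1) /=; ring.
Qed.

Lemma W2_gen2 x y z : vact (W2_g2) (vec3 x y z) = vec3 x y (y - z).
Proof.
rewrite /vact W2_genE; apply/colP=> i; rewrite !mxE !big_ord_recl big_ord0 !mxE.
rewrite /W2_basis !(tnth_nth (inord 0)) /r !(tnth_nth 0) /= inordK //=.
by case: i => [[|[|[|?]]] ?] //; rewrite !mxE /= !inordK //=
  !(rmorphN, rmorphXn, rmorph0, rmorph1) /=; ring.
Qed.

Lemma W2_reduced_group : reduced_group red (restricted_generator k W2_basis) =
  <<[set W2_g0; W2_g1; W2_g2]>>%g.
Proof.
congr (<< _ >>)%g; apply/setP=> h; rewrite [LHS]in_set.
have mem3 : (h \in [set W2_g0; W2_g1; W2_g2]) = [exists m, h == W2_gen m].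
  rewrite !inE -orbA; apply/or3P/existsP => [[]/eqP-> | [m /eqP ->]].
  - by exists 0.
  - by exists 1.
  - by exists 2%:R.
  case: m => [[|[|[|?]]] lt] //; [constructor 1|constructor 2|constructor 3];
    by apply/eqP; congr W2_gen; apply: val_inj.
rewrite mem3; apply: eq_existsb => m.
apply/eqP/eqP=> [E | ->]; last exact: W2_genE.
by apply: val_inj; rewrite E -W2_genE.
Qed.

Lemma G2_is_orthogonal (l : nat) (w : GL3) : 2 != 0 :> F -> rh != 0 ->
  4 - t ^+ 2 - rh != 0 ->
  l \in [pchar F] ->
  (forall G : {group GL3}, [/\ W2_g0 \in G, W2_g1 \in G & W2_g2 \in G] ->
     w \in rotation_part_group G) ->
  (l != 5%N -> not_order_235 w) ->
  #|F| = l \/ (#|F| = l ^ 2 /\ 5 %| l ^ 2 + 1)%N -> (l = 5%N -> t = 3%:R) ->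
  is_orthogonal_group red k W2_basis (Gp_sub red k (inord 2)).
Proof.
move=> F2 rh0 disc l_char Hw wn cF t3; have tt := red_tau_sqr red.
split; first exact: (form_unit F2 tt rh0 disc W2_form_vec3).
have R := G2_restricts disc; rewrite W2_reduced_group in R.
pose G : {group GL3} := <<[set W2_g0; W2_g1; W2_g2]>>%G.
have wG : w \in rotation_part_group G.
  by apply: Hw; split; apply: mem_gen; rewrite !inE eqxx ?orbT.
by have [<-|<-] := @five_k_orthogonal _ _ _ _ _ _ _ F2 tt rh0 disc W2_form_sym
  W2_form_vec3 W2_gen0 W2_gen1 W2_gen2 G (erefl _) l w l_char wG wn cF t3;
  [left | right].
Qed.

Lemma W2_det m : \det (mx_of (W2_gen m)) = -1.
Proof.
have tt := red_tau_sqr red.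
have [-> | m0] := eqVneq m 0; first exact: (det_g0 W2_gen0).
have [-> | m1] := eqVneq m 1; first exact: (det_g1 W2_gen1).
have -> : m = 2%:R by case: m m0 m1 => [[|[|[|?]]] lt] // _ _; apply: val_inj.
exact: (det_g2 W2_gen2).
Qed.
End OrthogonalCase.

Section WordOrders.
Variables (F : finFieldType) (red : {rmorphism Ztau -> F}) (k : nat).
Hypothesis F2 : 2 != 0 :> F.
Local Notation GL3 := {'GL_3[F]}.
Local Notation t := (red tau).
Let tt : t ^+ 2 = t + 1 := red_tau_sqr red.
Local Notation g0 := (W2_g0 red k).
Local Notation g1 := (W2_g1 red k).
Local Notation g2 := (W2_g2 red k).

Definition short_word : GL3 := (g1 * g2)%g.
Definition long_word : GL3 := (g0 * g1 * (g2 * g1))%g.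

Lemma short_word_mem (G : {group GL3}) : [/\ g0 \in G, g1 \in G & g2 \in G] ->
  short_word \in rotation_part_group G.
Proof. by move=> [? ? ?]; apply: mem_rotation_pair; rewrite ?W2_det. Qed.

Lemma long_word_mem (G : {group GL3}) : [/\ g0 \in G, g1 \in G & g2 \in G] ->
  long_word \in rotation_part_group G.
Proof.
by move=> [? ? ?]; apply: groupM; apply: mem_rotation_pair; rewrite ?W2_det.
Qed.

Lemma unit_neq0 (x y : F) : x * y = 1 -> x != 0.
Proof.
by move=> xy; apply/eqP=> x0; move/eqP: xy; rewrite x0 mul0r eq_sym oner_eq0.
Qed.

(** The product of the last two reflections is a rotation of order k; for each of the
    three powers it suffices to exhibit a vector that is moved. *)
Lemma short_word_orders : k = 4%N \/ k = 6%N -> not_order_235 short_word.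
Proof.
have wE x y z : vact short_word (vec3 x y z) = vec3 x (x - y + red (rho k) * (y - z)) (y - z).
  by rewrite vactM W2_gen2 W2_gen1.
move: short_word wE => w wE.
have ne n (x y z x' y' z' : F) : vact (w ^+ n)%g (vec3 x y z) = vec3 x' y' z' ->
    (y' - y != 0) || (z' - z != 0) -> (w ^+ n != 1)%g.
  move=> E; apply: contraL => /eqP E1; move: E; rewrite E1 vact1 => /vec3P[_ -> ->].
  by rewrite !subrr eqxx.
case=> kE.
  have r4 : red (rho k) = 2 by rewrite kE rmorph_nat.
  split; [apply: (ne 2 0 1 0 0 (-1) 0) | apply: (ne 3 0 0 1 0 2 1)
         | apply: (ne 5 0 0 1 0 (-2) (-1))];
    rewrite ?expgS ?expg0 ?mulg1 ?vactM ?wE ?r4 ?vact1.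
  all: try (by congr vec3; ring).
  - by rewrite -opprD oppr_eq0 -[1 + 1]/(2 : F) F2.
  - by rewrite subr0 F2.
  - by rewrite subr0 oppr_eq0 F2.
have r6 : red (rho k) = 3 by rewrite kE rmorph_nat.
split; [apply: (ne 2 0 1 0 0 1 1) | apply: (ne 3 0 1 0 0 (-1) 0)
         | apply: (ne 5 0 1 0 0 (-1) (-1))];
    rewrite ?expgS ?expg0 ?mulg1 ?vactM ?wE ?r6 ?vact1.
all: try (by congr vec3; ring).
- by rewrite subr0 oner_eq0 orbT.
- by rewrite -opprD oppr_eq0 -[1 + 1]/(2 : F) F2.
- by rewrite subr0 oppr_eq0 oner_eq0 orbT.
Qed.

(** For k = 5 the products of two generating reflections have orders 2 and 5, so a
    longer word is needed.  Its square, cube and fifth power change some coordinate of a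
    vector by a unit of Z[tau], by 5 times a unit and by 16 times a unit. *)
Lemma long_word_orders : k = 5%N -> 5 != 0 :> F -> not_order_235 long_word.
Proof.
move=> kE five; have r5 : red (rho k) = t ^+ 2 by rewrite kE rmorphXn.
have wE x y z : vact long_word (vec3 x y z) =
    vec3 ((1 + 3 * t) * x - (1 + 2 * t) * y + (1 + 2 * t) * z)
         ((1 + t) * x - t * y + t * z) (x - y + t * z).
  by rewrite !vactM !(W2_gen0, W2_gen1, W2_gen2) r5; congr vec3; ring: tt.
move: long_word wE => w wE.
have ne n (x y z x' y' z' : F) : vact (w ^+ n)%g (vec3 x y z) = vec3 x' y' z' ->
    z' - z != 0 -> (w ^+ n != 1)%g.
  move=> E; apply: contraNneq => E1; move: E; rewrite E1 vact1 => /vec3P[_ _ ->].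
  by rewrite subrr.
have w2 : vact (w ^+ 2)%g (vec3 0 1 0) = vec3 (- 6 - 10 * t) (- 2 - 5 * t) (- 1 - 2 * t).
  by rewrite !expgS expg0 mulg1 vactM !wE; congr vec3; ring: tt.
have w2' : vact (w ^+ 2)%g (vec3 0 0 1) = vec3 (7 + 11 * t) (3 + 5 * t) (2 + 2 * t).
  by rewrite !expgS expg0 mulg1 vactM !wE; congr vec3; ring: tt.
split.
- apply: (ne _ _ _ _ _ _ _ w2); rewrite subr0.
  by apply: (unit_neq0 (y := 3 - 2 * t)); ring: tt.
- apply/eqP=> E3; have : vact (w ^+ 3)%g (vec3 0 0 1) = vec3 0 0 1 by rewrite E3 vact1.
  rewrite expgS vactM w2' wE => /vec3P[_ E _].
  have u5 : 3 + 5 * t != 0 by apply: (unit_neq0 (y := 5 * t - 8)); ring: tt.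
  case/eqP: five; apply: (mulIf u5); rewrite mul0r -[RHS]E; ring: tt.
have E x y z : vec3 x y z = x *: vec3 1 0 0 + y *: vec3 0 1 0 + z *: vec3 0 0 1 :> 'cV[F]_3.
  by rewrite !vec3Z !vec3D !(mulr0, mulr1, addr0, add0r).
have w20 : vact (w ^+ 2)%g (vec3 1 0 0) = vec3 (8 + 12 * t) (3 + 6 * t) (3 * t).
  by rewrite !expgS expg0 mulg1 vactM !wE; congr vec3; ring: tt.
have w2E x y z : vact (w ^+ 2)%g (vec3 x y z) =
  vec3 ((8 + 12 * t) * x + (- 6 - 10 * t) * y + (7 + 11 * t) * z)
       ((3 + 6 * t) * x + (- 2 - 5 * t) * y + (3 + 5 * t) * z)
       (3 * t * x + (- 1 - 2 * t) * y + (2 + 2 * t) * z).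
  by rewrite (E x y z) !vactD !vactZ w20 w2 w2' !vec3Z !vec3D; congr vec3; ring.
have u8 : 8 + 13 * t != 0 by apply: (unit_neq0 (y := 13 * t - 21)); ring: tt.
apply/eqP=> E5.
have : vact (w ^+ 2 * (w ^+ 2 * w))%g (vec3 0 0 1) = vec3 0 0 1.
  by rewrite -expgSr -expgD E5 vact1.
rewrite !(vactM (w ^+ 2)%g) wE !w2E => /vec3P[_ _ /eqP].
rewrite -subr_eq0 => /eqP E1.
have : 2 * 2 * 2 * 2 * (8 + 13 * t) != 0 by rewrite !mulf_neq0.
by case/eqP; rewrite -[RHS]E1; ring: tt.
Qed.

End WordOrders.

Lemma residue_two_neq0 (p : Ztau) (F : finFieldType) (red : {rmorphism Ztau -> F}) :
  odd_prime p -> is_residue_field p red -> 2 != 0 :> F.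
Proof.
case=> pr_p np2 hF; apply/negP=> /(red_nat_eq0 hF) p2; apply: np2.
exact: (divides_two_three (n := 2)).
Qed.

(** For k = 3 the hypothesis forces characteristic 5, the only one in which the
    icosahedral group of that case is an orthogonal group. *)
Theorem G2_orthogonal (k : nat) (p : Ztau) (F : finFieldType)
    (red : {rmorphism Ztau -> F}) :
  k \in [:: 3; 4; 5; 6]%N -> odd_prime p -> is_residue_field p red ->
  ~ (k = 6%N /\ associate p 3) -> ~ (k = 3%N /\ `|Ztau_norm p|%N <> 5%N) ->
  is_orthogonal_group red k W2_basis (Gp_sub red k (inord 2)).
Proof.
move=> hk hp hF not6 not3; have tt := red_tau_sqr red; have [pr_p _] := hp.
have F2 := residue_two_neq0 hp hF.
have [l pr_l l_char] := finPcharP F.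
have cF := residue_card hF l_char.
have t3 := @residue_char5_tau _ red l l_char.
have five : (l != 5)%N -> 5 != 0 :> F.
  by apply: contra => /(char_of_prime_nat l_char) ->.
have units (x y : F) : x * y = 1 -> x != 0 by apply: unit_neq0.
have t0 : red tau != 0 by apply: (units _ (red tau - 1)); ring: tt.
move: hk; rewrite !inE => /or4P[] /eqP kE.
- have r3 : red (rho k) = 1 by rewrite kE rmorph1.
  have l5 : l = 5%N.
    apply: (char_of_prime_nat l_char) => //.
    have [qE | ] := eqVneq `|Ztau_norm p|%N 5%N; last by move/eqP=> ne; case: not3.
    by have := red_abs_norm0 hF; rewrite qE => ->.
  apply: (G2_is_orthogonal (l := l) (w := short_word red k)) => //.
  + by rewrite r3 oner_eq0.
  + by rewrite r3; apply: (units _ (1 + red tau)); ring: tt.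
  + exact: short_word_mem.
  + by rewrite l5.
- have r4 : red (rho k) = 2 by rewrite kE rmorph_nat.
  apply: (G2_is_orthogonal (l := l) (w := short_word red k)) => //.
  + by rewrite r4.
  + by rewrite r4; apply: (units _ (- red tau)); ring: tt.
  + exact: short_word_mem.
  + by move=> _; apply: (short_word_orders red F2 (or_introl kE)).
- have r5 : red (rho k) = red tau ^+ 2 by rewrite kE rmorphXn.
  apply: (G2_is_orthogonal (l := l)
    (w := long_word red k)) => //.
  + by rewrite r5 expf_neq0.
  + rewrite r5 (_ : _ - _ = 2 * (1 - red tau)); last by ring: tt.
    by rewrite mulf_neq0 //; apply: (units _ (- red tau)); ring: tt.
  + exact: long_word_mem.
  + by move=> l5; apply: (long_word_orders red F2 kE (five l5)).
have r6 : red (rho k) = 3 by rewrite kE rmorph_nat.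
apply: (G2_is_orthogonal (l := l) (w := short_word red k)) => //.
- rewrite r6; apply/negP=> /(red_nat_eq0 hF) p3; apply: not6; split=> //.
  exact: (divides_two_three (n := 3)).
- rewrite r6 (_ : _ - _ = - red tau); last by ring: tt.
  by rewrite oppr_eq0.
- exact: short_word_mem.
- by move=> _; apply: (short_word_orders red F2 (or_intror kE)).
Qed.

(** * The toroidal group *)

Section Torus.
Variables (F : finFieldType) (red : {rmorphism Ztau -> F}) (l : nat).
Hypotheses (l_char : l \in [pchar F]) (F2 : 2 != 0 :> F).
Local Notation GL4 := {'GL_4[F]}.

Definition mxF (rows : seq (seq F)) : 'M[F]_4 :=
  \matrix_(i, j) nth 0 (nth [::] rows i) j.

(** The columns are v_0 + 2 v_1 + v_3, then v_1 and 2 v_1 + v_3, which project onto the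
    basis of the hexagonal lattice, and u = 2 v_1 + v_2 + v_3. *)
Definition frame_mx := mxF [:: [:: 1; 0; 0; 0]; [:: 2; 1; 2; 2]; [:: 0; 0; 0; 1];
  [:: 1; 0; 1; 1]].
Definition frame_inv := mxF [:: [:: 1; 0; 0; 0]; [:: 0; 1; 0; -2]; [:: -1; 0; -1; 1];
  [:: 0; 0; 1; 0]].

Lemma frame_mxV : frame_mx *m frame_inv = 1%:M.
Proof.
apply/matrixP=> i j; rewrite !mxE !big_ord_recl big_ord0 !mxE.
by case: i => [[|[|[|[|?]]]] ?] //; case: j => [[|[|[|[|?]]]] ?] //=; ring.
Qed.

Lemma frame_inv_mx : frame_inv *m frame_mx = 1%:M.
Proof. by apply: mulmx1C; apply: frame_mxV. Qed.

Lemma frame_conjM (P Q : 'M[F]_4) :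
  frame_mx *m P *m frame_inv *m (frame_mx *m Q *m frame_inv) =
  frame_mx *m (P *m Q) *m frame_inv.
Proof. by rewrite !mulmxA -[X in X *m Q *m _ = _]mulmxA frame_inv_mx mulmx1. Qed.

(** In the basis above: the map fixing u, inducing the matrix (a b; c d) on the lattice
    part, and adding 2 (x, y) to the first vector.  The last row is forced by
    invariance of the form; it is where the quadratic form x^2 + x y + y^2 enters. *)
Definition parabolic (a b c d x y : F) := mxF [::
  [:: 1; 0; 0; 0];
  [:: 2 * x; a; b; 0];
  [:: 2 * y; c; d; 0];
  [:: 2 * (x ^+ 2 + x * y + y ^+ 2); (2 * x + y) * a + (x + 2 * y) * c;
      (2 * x + y) * b + (x + 2 * y) * d; 1]].

(** The last rows agree because the matrix (a b; c d) is an isometry. *)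
Lemma parabolicM a b c d x y a' b' c' d' x' y' :
  a ^+ 2 + a * c + c ^+ 2 = 1 -> b ^+ 2 + b * d + d ^+ 2 = 1 ->
  2 * (a * b) + a * d + b * c + 2 * (c * d) = 1 ->
  parabolic a b c d x y *m parabolic a' b' c' d' x' y' =
  parabolic (a * a' + b * c') (a * b' + b * d') (c * a' + d * c') (c * b' + d * d')
    (a * x' + b * y' + x) (c * x' + d * y' + y).
Proof.
move=> h1 h2 h3.
have e1 : a ^+ 2 + a * c + c ^+ 2 - 1 = 0 by rewrite h1 subrr.
have e2 : b ^+ 2 + b * d + d ^+ 2 - 1 = 0 by rewrite h2 subrr.
have e3 : 2 * (a * b) + a * d + b * c + 2 * (c * d) - 1 = 0 by rewrite h3 subrr.
have polar u v : 2 * (x' * u) * (a ^+ 2 + a * c + c ^+ 2 - 1)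
    + (x' * v + y' * u) * (2 * (a * b) + a * d + b * c + 2 * (c * d) - 1)
    + 2 * (y' * v) * (b ^+ 2 + b * d + d ^+ 2 - 1) = 0.
  by rewrite e1 e2 e3 !mulr0 !addr0.
apply/matrixP=> i j; rewrite !mxE !big_ord_recl big_ord0 !mxE.
case: i => [[|[|[|[|?]]]] ?] //; case: j => [[|[|[|[|?]]]] ?] //=; try by ring.
- by apply/esym/subr0_eq; rewrite -[RHS](polar x' y'); ring.
- by apply/esym/subr0_eq; rewrite -[RHS](polar a' c'); ring.
- by apply/esym/subr0_eq; rewrite -[RHS](polar b' d'); ring.
Qed.

Definition torus_mx (g : affine2) : 'M[F]_4 :=
  frame_mx *m parabolic (g.1 0 0)%:~R (g.1 0 1)%:~R (g.1 1 0)%:~R (g.1 1 1)%:~R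
    (g.2 0 0)%:~R (g.2 1 0)%:~R *m frame_inv.

Lemma sym36P (g : affine2) : sym36 g <->
  [/\ g.1 0 0 ^+ 2 + g.1 0 0 * g.1 1 0 + g.1 1 0 ^+ 2 = 1,
      g.1 0 1 ^+ 2 + g.1 0 1 * g.1 1 1 + g.1 1 1 ^+ 2 = 1 &
      2 * (g.1 0 0 * g.1 0 1) + g.1 0 0 * g.1 1 1 + g.1 0 1 * g.1 1 0
      + 2 * (g.1 1 0 * g.1 1 1) = 1].
Proof.
have lift1 : lift ord0 ord0 = 1 :> 'I_2 by apply: val_inj.
have E i j : (g.1^T *m tri_gram *m g.1) i j =
   2 * (g.1 0 i * g.1 0 j) + g.1 0 i * g.1 1 j + g.1 1 i * g.1 0 j
   + 2 * (g.1 1 i * g.1 1 j).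
  by rewrite !mxE !big_ord_recl !big_ord0 !mxE !big_ord_recl !big_ord0 !mxE !lift1 /=; ring.
split=> [S | [h1 h2 h3]].
  have S0 := congr1 (fun M : 'M_2 => M 0 0) S; have S1 := congr1 (fun M : 'M_2 => M 0 1) S.
  have S2 := congr1 (fun M : 'M_2 => M 1 1) S.
  move: S0 S1 S2; rewrite !E !mxE /= => S0 S1 S2; split.
  - by apply: (mulfI (isT : (2 : int) != 0)); rewrite mulr1 -[RHS]S0; ring.
  - by apply: (mulfI (isT : (2 : int) != 0)); rewrite mulr1 -[RHS]S2; ring.
  - by rewrite -[RHS]S1; ring.
apply/matrixP=> i j; rewrite E mxE.
have two : forall i : 'I_2, i = 0 \/ i = 1.
  by case=> [[|[|?]] ?] //; [left | right]; apply: val_inj.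
case: (two i) => ->; case: (two j) => -> /=.
- by apply: etrans (congr1 ( *%R (2 : int)) h1); ring.
- by rewrite -[RHS]h3; ring.
- by rewrite -[RHS]h3; ring.
- by apply: etrans (congr1 ( *%R (2 : int)) h2); ring.
Qed.

Lemma sym36_comp g h : sym36 g -> sym36 h -> sym36 (affine2_comp g h).
Proof.
rewrite /sym36 /affine2_comp /= => Eg Eh.
by rewrite trmx_mul -!mulmxA (mulmxA _ tri_gram) [X in _ *m X]mulmxA Eg mulmxA.
Qed.

Lemma torus_mxM g h : sym36 g -> torus_mx (affine2_comp g h) = torus_mx g *m torus_mx h.
Proof.
case/sym36P=> h1 h2 h3; rewrite /torus_mx frame_conjM parabolicM.
- have lift1 : lift ord0 ord0 = 1 :> 'I_2 by apply: val_inj.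
  rewrite /affine2_comp /= !mxE !big_ord_recl !big_ord0 !lift1 !addr0.
  by rewrite !rmorphD !rmorphM.
- by rewrite -!rmorphXn -!rmorphM -!rmorphD h1.
- by rewrite -!rmorphXn -!rmorphM -!rmorphD h2.
- by rewrite -[2 in LHS]/(2%:~R) -!rmorphM -!rmorphD h3.
Qed.

Local Notation G0 := (Gp_sub red 6 (inord 0)).
Local Notation isometric a b c d := [/\ a ^+ 2 + a * c + c ^+ 2 = 1,
  b ^+ 2 + b * d + d ^+ 2 = 1 & 2 * (a * b) + a * d + b * c + 2 * (c * d) = 1].

(** The parameters are taken in the field, so that translations can be shifted by
    multiples of the characteristic. *)
Definition realized (a b c d x y : F) := exists2 g : GL4, g \in G0 &
  mx4_of g = frame_mx *m parabolic a b c d x y *m frame_inv.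

Lemma parabolic1 : parabolic 1 0 0 1 0 0 = 1%:M.
Proof.
apply/matrixP=> i j; rewrite !mxE.
by case: i => [[|[|[|[|?]]]] ?] //; case: j => [[|[|[|[|?]]]] ?] //=; ring.
Qed.

Lemma realized1 : realized 1 0 0 1 0 0.
Proof. by exists 1%g; rewrite ?group1 // parabolic1 mulmx1 frame_mxV. Qed.

Lemma realizedM a b c d x y a' b' c' d' x' y' : isometric a b c d ->
  realized a b c d x y -> realized a' b' c' d' x' y' ->
  realized (a * a' + b * c') (a * b' + b * d') (c * a' + d * c') (c * b' + d * d')
    (a * x' + b * y' + x) (c * x' + d * y' + y).
Proof.
move=> [h1 h2 h3] [g Gg E] [h Gh E']; exists (g * h)%g; first exact: groupM.
by rewrite -parabolicM // -frame_conjM -E -E'.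
Qed.

Lemma generator_parabolic :
  [/\ mx4_of (rp red 6 (inord 1)) = frame_mx *m parabolic (-1) (-1) 0 1 0 0 *m frame_inv,
      mx4_of (rp red 6 (inord 2)) = frame_mx *m parabolic 1 0 (-1) (-1) 0 (-1) *m frame_inv &
      mx4_of (rp red 6 (inord 3)) = frame_mx *m parabolic (-1) 0 1 1 0 0 *m frame_inv].
Proof.
have conj (M P : 'M[F]_4) : M *m frame_mx = frame_mx *m P -> M = frame_mx *m P *m frame_inv.
  by move=> <-; rewrite -mulmxA frame_mxV mulmx1.
split; apply: conj; apply/matrixP=> i j; rewrite !mxE !big_ord_recl !big_ord0 !mxE;
  rewrite /r !(tnth_nth 0) inordK //=; 
  (case: i => [[|[|[|[|?]]]] ?] //; case: j => [[|[|[|[|?]]]] ?] //=;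
   rewrite !mxE /=; ring).
Qed.

(** The alternating products of the linear parts of the first and the last generator:
    they run through the point group, which is dihedral of order 12. *)
Fixpoint dihedral (n : nat) : int * int * int * int :=
  if n is m.+1 then
    let: (a, b, c, d) := dihedral m in
    if odd m then (- a, - b, a + c, b + d) else (- (a + c), - (b + d), c, d)
  else (1, 0, 0, 1).

(** Since 4 (a^2 + a c + c^2) = (2 a + c)^2 + 3 c^2, both entries are at most 1 in
    absolute value. *)
Lemma hexagon_vectors (a c : int) : a ^+ 2 + a * c + c ^+ 2 = 1 ->
  (a, c) \in [:: (1, 0); (0, 1); (-1, 1); (-1, 0); (0, -1); (1, -1)].
Proof.
move=> h.
have a2 : a ^+ 2 <= 1 by nia.
have c2 : c ^+ 2 <= 1 by nia.
have small (u : int) : u ^+ 2 <= 1 -> u \in [:: -1; 0; 1].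
  move=> u2; have : -1 <= u <= 1 by nia.
  by rewrite !inE; lia.
have := small a a2; have := small c c2; rewrite !inE.
by case/or3P=> /eqP cE; case/or3P=> /eqP aE; move: h; rewrite aE cE.
Qed.

Lemma isometric_dihedral (a b c d : int) : isometric a b c d ->
  exists n, dihedral n = (a, b, c, d).
Proof.
case=> /hexagon_vectors H /hexagon_vectors H' h3.
suff : (a, b, c, d) \in [seq dihedral n | n <- iota 0 12].
  by case/mapP=> n _ ->; exists n.
move: H H' h3; rewrite !inE.
by case/or4P=> [/eqP[-> ->]|/eqP[-> ->]|/eqP[-> ->]|/or3P[]/eqP[-> ->]];
   case/or4P=> [/eqP[-> ->]|/eqP[-> ->]|/eqP[-> ->]|/or3P[]/eqP[-> ->]].
Qed.

Lemma realized_cast a b c d x y a' b' c' d' x' y' : realized a b c d x y ->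
  a = a' -> b = b' -> c = c' -> d = d' -> x = x' -> y = y' -> realized a' b' c' d' x' y'.
Proof. by move=> H <- <- <- <- <- <-. Qed.

Lemma rp_G0 (j : nat) : (0 < j < 4)%N -> rp red 6 (inord j) \in G0.
Proof.
case/andP=> j0 j4; rewrite mem_gen //; apply/imsetP; exists (inord j) => //.
by rewrite !inE -val_eqE /= !inordK // -lt0n.
Qed.

Lemma realized_r1 : realized (-1) (-1) 0 1 0 0.
Proof. by case: generator_parabolic => E _ _; exists (rp red 6 (inord 1)); rewrite ?rp_G0. Qed.
Lemma realized_r2 : realized 1 0 (-1) (-1) 0 (-1).
Proof. by case: generator_parabolic => _ E _; exists (rp red 6 (inord 2)); rewrite ?rp_G0. Qed.
Lemma realized_r3 : realized (-1) 0 1 1 0 0.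
Proof. by case: generator_parabolic => _ _ E; exists (rp red 6 (inord 3)); rewrite ?rp_G0. Qed.

Lemma realized_dihedral n a b c d : dihedral n = (a, b, c, d) ->
  realized a%:~R b%:~R c%:~R d%:~R 0 0.
Proof.
elim: n a b c d => [|n IHn] a b c d /=.
  by case=> <- <- <- <-; apply: realized1.
case En: (dihedral n) => [[[a' b'] c'] d']; have IH := IHn _ _ _ _ En.
by case: ifP => _ [<- <- <- <-]; [apply: realized_cast (realizedM _ realized_r3 IH) _ _ _ _ _ _
  | apply: realized_cast (realizedM _ realized_r1 IH) _ _ _ _ _ _];
  rewrite ?rmorphN ?rmorphD /=; try split; ring.
Qed.

(** The second generator has the same linear part as an element fixing the origin, so
    that their product is a translation; the other translations are its conjugates
    under the point group and their sums. *)
Lemma realized_translation (x y : nat) : realized 1 0 0 1 x%:R y%:R.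
Proof.
(* These are the elements number 5, 6 and 9 of the enumeration of the point group. *)
have flip : realized 1 0 (-1) (-1) 0 0 by apply: (@realized_dihedral 5 1 0 (-1) (-1)).
have minus : realized (-1) 0 0 (-1) 0 0 by apply: (@realized_dihedral 6 (-1) 0 0 (-1)).
have swap : realized 0 1 1 0 0 0 by apply: (@realized_dihedral 9 0 1 1 0).
have tr (u v u' v' : F) : realized 1 0 0 1 u v -> realized 1 0 0 1 u' v' ->
    realized 1 0 0 1 (u + u') (v + v').
  by move=> H H'; apply: realized_cast (realizedM _ H H') _ _ _ _ _ _; try split; ring.
have down : realized 1 0 0 1 0 (-1).
  by apply: realized_cast (realizedM _ realized_r2 flip) _ _ _ _ _ _; try split; ring.
have up : realized 1 0 0 1 0 1.
  apply: realized_cast (realizedM _ (realizedM _ minus down) minus) _ _ _ _ _ _;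
  try split; ring.
have right : realized 1 0 0 1 1 0.
  apply: realized_cast (realizedM _ (realizedM _ swap up) swap) _ _ _ _ _ _;
  try split; ring.
elim: x => [|x IHx]; last by rewrite mulrSr -[y%:R]addr0; apply: tr.
elim: y => [|y IHy]; first exact: realized1.
by rewrite mulrSr -[0%:R]addr0; apply: tr.
Qed.

Definition affine (a b c d x y : int) : affine2 :=
  (\matrix_(i, j) nth 0 (nth [::] [:: [:: a; b]; [:: c; d]] i) j, \col_i nth 0 [:: x; y] i).

Lemma torus_affine a b c d x y : torus_mx (affine a b c d x y) =
  frame_mx *m parabolic a%:~R b%:~R c%:~R d%:~R x%:~R y%:~R *m frame_inv.
Proof. by rewrite /torus_mx !mxE. Qed.

Lemma torus_mx_G0 g : sym36 g -> exists2 x, x \in G0 & mx4_of x = torus_mx g.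
Proof.
move/sym36P=> iso; have [n /realized_dihedral R0] := isometric_dihedral iso.
have [x xE] := residue_int l_char (g.2 0 0).
have [y yE] := residue_int l_char (g.2 1 0).
suff : realized (g.1 0 0)%:~R (g.1 0 1)%:~R (g.1 1 0)%:~R (g.1 1 1)%:~R
  (g.2 0 0)%:~R (g.2 1 0)%:~R by [].
rewrite xE yE; apply: realized_cast (realizedM _ (realized_translation x y) R0) _ _ _ _ _ _;
  try split; ring.
Qed.

Lemma G0_torus_mx (z : GL4) : z \in G0 -> exists2 g, sym36 g & mx4_of z = torus_mx g.
Proof.
have sym_affine (a b c d x y : int) : isometric a b c d -> sym36 (affine a b c d x y).
  by case=> h1 h2 h3; apply/sym36P; rewrite !mxE.
case/gen_prodgP=> n [c Sc ->] {z}; elim: n c Sc => [|n IHn] c Sc.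
  exists (affine 1 0 0 1 0 0); first exact: sym_affine.
  by rewrite big_ord0 torus_affine parabolic1 mulmx1 frame_mxV.
rewrite big_ord_recl; have [g sg gE] := IHn _ (fun i => Sc (lift ord0 i)).
have [h sh hE] : exists2 h, sym36 h & mx4_of (c ord0) = torus_mx h.
  have /imsetP[j + ->] := Sc ord0; rewrite !inE -val_eqE /= inordK // => j0.
  have [E1 E2 E3] := generator_parabolic.
  have jE : j = inord j :> 'I_4 by rewrite inord_val.
  rewrite jE; case: j j0 {jE} => [[|[|[|[|?]]]] ?] //= _.
  - by exists (affine (-1) (-1) 0 1 0 0); [apply: sym_affine | rewrite E1 torus_affine].
  - by exists (affine 1 0 (-1) (-1) 0 (-1)); [apply: sym_affine | rewrite E2 torus_affine].
  - by exists (affine (-1) 0 1 1 0 0); [apply: sym_affine | rewrite E3 torus_affine].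
exists (affine2_comp h g); first exact: sym36_comp.
by rewrite torus_mxM // [mx4_of _]/(mx4_of _ *m mx4_of _) hE gE.
Qed.

Lemma int_char0 (a : int) : (a%:~R == 0 :> F) = (l %| `|a|)%N.
Proof.
rewrite (dvdn_pcharf l_char); case: a => // n.
by rewrite NegzE rmorphN oppr_eq0.
Qed.

(** A linear part has entries -1, 0, 1, which are distinct in odd characteristic; the
    first column contains twice the translation vector. *)
Lemma torus_mx1 g : sym36 g -> (torus_mx g = 1%:M <-> translation_in l g).
Proof.
move/sym36P=> iso.
have two : forall i : 'I_2, i = 0 \/ i = 1.
  by case=> [[|[|?]] ?] //; [left | right]; apply: val_inj.
split=> [E | [A1 [t tE]]]; last first.
  have lF : l%:R = 0 :> F := pcharf0 l_char.
  have kill u : (l%:R * u)%:~R = 0 :> F by rewrite rmorphM rmorph_nat lF mul0r.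
  rewrite /torus_mx A1 tE !mxE /= !kill.
  by rewrite parabolic1 mulmx1 frame_mxV.
have {}E : parabolic (g.1 0 0)%:~R (g.1 0 1)%:~R (g.1 1 0)%:~R (g.1 1 1)%:~R
    (g.2 0 0)%:~R (g.2 1 0)%:~R = 1%:M.
  have := congr1 (fun M => frame_inv *m M *m frame_mx) E.
  rewrite mulmx1 frame_inv_mx /torus_mx !mulmxA frame_inv_mx mul1mx.
  by rewrite -mulmxA frame_inv_mx mulmx1.
have entry (m n : nat) : (m < 4)%N -> (n < 4)%N ->
    (parabolic (g.1 0 0)%:~R (g.1 0 1)%:~R (g.1 1 0)%:~R (g.1 1 1)%:~R
      (g.2 0 0)%:~R (g.2 1 0)%:~R) (inord m) (inord n) = (m == n)%:R.
  by move=> m4 n4; rewrite E mxE -val_eqE /= !inordK.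
have Ea := entry 1 1 isT isT; have Eb := entry 1 2 isT isT.
have Ec := entry 2 1 isT isT; have Ed := entry 2 2 isT isT.
have Ex := entry 1 0 isT isT; have Ey := entry 2 0 isT isT.
move: Ea Eb Ec Ed Ex Ey; rewrite !mxE !inordK //= => Ea Eb Ec Ed Ex Ey.
have l3 : (2 < l)%N.
  rewrite ltn_neqAle prime_gt1 ?(pcharf_prime l_char) // andbT eq_sym.
  by apply: contraNneq F2 => <-; apply/eqP/(pcharf0 l_char).
have cast u (n : nat) : -1 <= u <= 1 -> (n < 2)%N -> u%:~R = n%:R :> F -> u = n.
  move=> u1 n2 /eqP; rewrite -subr_eq0 -(rmorph_nat (intr : int -> F)) -rmorphB int_char0.
  by rewrite natz => /dvdn_leq; lia.
have small (a c : int) : a ^+ 2 + a * c + c ^+ 2 = 1 -> -1 <= a <= 1 /\ -1 <= c <= 1 by nia.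
have vanish u : 2 * u%:~R = 0 :> F -> exists w, u = l%:R * w.
  move/eqP; rewrite mulf_eq0 (negPf F2) /= int_char0 => lu.
  by exists (u %/ l)%Z; rewrite mulrC natz divzK.
case: iso => /small[a1 c1] /small[b1 d1] _.
have [w wE] := vanish _ Ex; have [w' w'E] := vanish _ Ey.
split; last first.
  exists (\col_i nth 0 [:: w; w'] i); apply/colP=> i; rewrite !mxE.
  by case: (two i) => ->.
apply/matrixP=> i j; rewrite mxE.
by case: (two i) => ->; case: (two j) => ->; apply: cast.
Qed.

(** The matrices [torus_mx g] are units because they come from elements of the group,
    so they define a map to the general linear group. *)
Lemma G0_torus : isomorphic_36_torus G0 l.
Proof.
pose f g : GL4 := insubd (1%g : GL4) (torus_mx g).
have fE g : sym36 g -> f g \in G0 /\ mx4_of (f g) = torus_mx g.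
  by case/torus_mx_G0=> x Gx xE; rewrite /f -xE [insubd _ _]valKd.
have mx4_inj : injective (@mx4_of F) by apply: val_inj.
exists f; split=> [g h sg sh | x | g sg].
- have sgh := sym36_comp sg sh.
  apply: mx4_inj; rewrite (fE _ sgh).2 torus_mxM // -(fE _ sg).2 -(fE _ sh).2.
  by [].
- split=> [/G0_torus_mx[g sg E] | [g /fE[Gf _] <-]] //.
  by exists g => //; apply: mx4_inj; rewrite (fE _ sg).2.
- rewrite -torus_mx1 // -(fE _ sg).2; split=> [->|E] //.
  by apply: mx4_inj.
Qed.

End Torus.

(** * The three subgroups *)

Section TorusOfPrime.
Variables (p : Ztau) (F : finFieldType) (red : {rmorphism Ztau -> F}).
Hypotheses (hp : odd_prime p) (hF : is_residue_field p red).

Lemma associate_red0 x : associate p x -> red x = 0.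
Proof.
by case=> u _ ->; rewrite rmorphM ((hF.2 p).2 _) ?mulr0 //; exists 1; rewrite mulr1.
Qed.

Lemma torus_of_prime n : prime n -> n%:R = 0 :> F ->
  isomorphic_36_torus (Gp_sub red 6 (inord 0)) n.
Proof.
move=> pr_n n0; have [l _ l_char] := finPcharP F.
have <- : l = n by apply: (char_of_prime_nat l_char) pr_n _; rewrite n0.
exact: G0_torus l_char (residue_two_neq0 hp hF).
Qed.

Lemma class_torus :
  [/\ classI p -> isomorphic_36_torus (Gp_sub red 6 (inord 0)) 5,
      forall n : nat, classII p n -> isomorphic_36_torus (Gp_sub red 6 (inord 0)) n &
      classIII p -> isomorphic_36_torus (Gp_sub red 6 (inord 0)) `|Ztau_norm p|].
Proof.
split=> [/associate_red0 E | n [pr_n _ /associate_red0] | [_ _ _ pr_q]].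
- apply: torus_of_prime => //.
  transitivity (red (-1 + 2 * tau) * red (-1 + 2 * tau)); last by rewrite E mul0r.
  by rewrite -rmorphM -[LHS](rmorph_nat red); congr (red _).
- by rewrite rmorph_nat; apply: torus_of_prime.
- by apply: torus_of_prime pr_q _; apply: red_abs_norm0 hF.
Qed.

End TorusOfPrime.

Theorem theorem3p4 (R : realType) (k : nat) (p : Ztau)
    (F : finFieldType) (red : {rmorphism Ztau -> F})
    (hk : k \in [:: 3; 4; 5; 6]%N) (hp : odd_prime p)
    (hF : is_residue_field p red) :
  let q := `|Ztau_norm p|%N in
  let G0 := Gp_sub red k (inord 0) in
  let G2 := Gp_sub red k (inord 2) in
  let G3 := Gp_sub red k (inord 3) in
  [/\ [/\ k = 3%N -> is_reduction_of_standard R coxeter_A3 red W0_basis G0,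
          k = 4%N -> is_reduction_of_standard R coxeter_B3 red W0_basis G0,
          k = 5%N -> is_reduction_of_standard R coxeter_H3 red W0_basis G0 &
          k = 6%N ->
            [/\ classI p -> isomorphic_36_torus G0 5,
                forall n : nat, classII p n -> isomorphic_36_torus G0 n &
                classIII p -> isomorphic_36_torus G0 q]],
      (* For k = 3 exchanging v_2 and v_3 conjugates G2 to G3, a group of order
         120, while #|O3_1| = q (q ^ 2 - 1). *)
      ~ (k = 6%N /\ associate p 3) -> ~ (k = 3%N /\ q <> 5%N) ->
        is_orthogonal_group red k W2_basis G2 &
      is_reduction_of_standard R coxeter_H3 red W3_basis G3].
Proof.
have tt := red_tau_sqr red.
have W0_reduction n : 0 < 2 * cos (pi / n%:R) :> R ->
    Ztau_val R (rho k) = (2 * cos (pi / n%:R)) ^+ 2 -> 3 - red (rho k) != 0 ->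
    is_reduction_of_standard R (coxeter_linear 3 n) red W0_basis (Gp_sub red k (inord 0)).
  move=> c0 rhoE d0; exists (restricted_generator k W0_basis); first exact: W0_standard.
  exact: G0_restricts.
have cos0 n : (2 < n)%N -> 0 < 2 * cos (pi / n%:R) :> R.
  by move=> n2; rewrite mulr_gt0 ?cos_pi_div_gt0.
move=> q G0 G2 G3; split; last first.
- by exists (restricted_generator k W3_basis); [apply: W3_standard | apply: G3_restricts].
- exact: G2_orthogonal hk hp hF.
split=> kE; last by rewrite /G0 kE; apply: class_torus.
- apply: W0_reduction; rewrite ?cos0 ?kE //=.
    by rewrite cos_pi3 expr1n /Ztau_val /= mul0r addr0.
  by rewrite rmorph1; have := residue_two_neq0 hp hF; congr (_ != 0); ring.
- apply: W0_reduction; rewrite ?cos0 ?kE //=.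
    by rewrite cos_pi4 (Ztau_nat 2) /Ztau_val /= mul0r addr0.
  by rewrite rmorph_nat; have := oner_neq0 F; congr (_ != 0); ring.
- apply: W0_reduction; rewrite ?cos0 ?kE //=.
    by rewrite Ztau_val_tau2 cos_pi5.
  apply/eqP=> z; have : (3 - red (tau ^+ 2)) * (1 + red tau) = 1.
    by rewrite rmorphXn /=; ring: tt.
  by rewrite z mul0r => /esym/eqP; rewrite oner_eq0.
Qed.
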